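(* Let $G\subset\mathrm{SL}_3(\mathbb{C})$ be a finite abelian group, with character group $\hat G=\operatorname{Hom}_{\mathbb{Z}}(G,\mathbb{C}^* )$, and let $\mathbb{C}^3=\rho_1\oplus\rho_2\oplus\rho_3$ with $\rho_1,\rho_2,\rho_3\in\hat G$ be the decomposition of the tautological $G$-representation. Let $Q$ be the McKay quiver with vertex set $Q_0=\hat G$ and arrows $a_i^\rho:\rho\rho_i\to\rho$ for $\rho\in\hat G$, $i=1,2,3$. For every $\rho\in\hat G$ and every permutation $\pi\in S_3$ consider the triangular face bounded by the cycle $$\rho\xrightarrow{a_{\pi(3)}}\rho\rho_{\pi(1)}\rho_{\pi(2)}\xrightarrow{a_{\pi(2)}}\rho\rho_{\pi(1)}\xrightarrow{a_{\pi(1)}}\rho$$ (faces whose cycles agree up to rotation being identified). Then gluing these faces along common arrows gives a two-dimensional torus, so that $Q$ with these faces is the quiver dual to a brane tiling; and, if $W$ is the corresponding potential, the quiver potential algebra $\mathbb{C}Q/(\partial W)$ is a non-commutative crepant resolution of the quotient singularity $\mathbb{C}^3/G$.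
   Context: A brane tiling is a bipartite graph (with white and black vertices) embedded in the real two-dimensional torus $T$ with simply connected complementary components (faces). Its dual quiver $Q$ has the faces as vertices and the edges as arrows, each arrow joining the two faces adjacent to the edge and directed so that the white endpoint lies on the right. The faces $Q_2=Q_2^+\sqcup Q_2^-$ of $Q$ (components of the complement of $Q$ in $T$) correspond to the white ($+$) and black ($-$) vertices, and the arrows around every face $F$ form an oriented cycle $w_F$ (up to rotation). The corresponding potential is $W=\sum_{F\in Q_2^+}w_F-\sum_{F\in Q_2^-}w_F$. For a cycle $u=a_1\cdots a_n$ and an arrow $a$, $\partial u/\partial a=\sum_{i:\,a_i=a}a_{i+1}\cdots a_na_1\cdots a_{i-1}$; $(\partial W)$ is the two-sided ideal of $\mathbb{C}Q$ generated by all $\partial W/\partial a$. In the notation $a_i$ in the face cycles the upper index is omitted: the arrow $a_i$ with target $\sigma$ is $a_i^\sigma$. Since $G\subset\mathrm{SL}_3(\mathbb{C})$, $\rho_1\rho_2\rho_3=1$. In the triangular faces, the sign of the face is given by the parity of $\pi$ (well defined up to rotation). Non-commutative crepant resolution (Van den Bergh): for a normal Gorenstein domain $R$ (here the coordinate ring of $\mathbb{C}^3/G$, i.e. the ring of $G$-invariant polynomial functions on $\mathbb{C}^3$), an $R$-algebra $A$ is a non-commutative crepant resolution of $R$ (or of $\operatorname{Spec}R$) if $A\cong\operatorname{End}_R(N)$ for some finitely generated reflexive $R$-module $N$ and $A$ is homologically homogeneous (all simple $A$-modules have the same finite projective dimension); equivalently here, $A\cong\operatorname{End}_R(N)$ with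 $N$ reflexive, $A$ has finite global dimension and is a maximal Cohen-Macaulay $R$-module. *)

(* Defs.v *)
From HB Require Import structures.
From Stdlib Require Import Relation_Operators.
(* The notations of multinomials clash with those of analysis. *)
From mathcomp Require Import -(notations) mpoly.
From mathcomp Require Import -(notations) monalg.
From mathcomp Require Import all_boot all_order all_algebra all_fingroup.
From mathcomp Require Import cyclic mxrepresentation complex finmap generic_quotient.
From mathcomp Require Import all_classical all_reals.
From mathcomp Require Import topology normedtype derive trigo.

Set Implicit Arguments.
Unset Strict Implicit.
Unset Printing Implicit Defensive.

Import Order.TTheory GRing.Theory Num.Theory.
Import numFieldNormedType.Exports.

Local Open Scope classical_set_scope.
Local Open Scope ring_scope.
Local Open Scope quotient_scope.

(** * The torus and plane topology *)

Definition homeomorphic (X Y : topologicalType) : Prop :=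
  exists (f : X -> Y) (g : Y -> X),
    [/\ continuous f, continuous g, cancel f g & cancel g f].

Section Torus.
Variable R : realType.

Definition torus_rel (x y : R * R) : bool :=
  (x.1 - y.1 \is a Num.int) && (x.2 - y.2 \is a Num.int).

Lemma torus_rel_refl : reflexive torus_rel.
Proof. by move=> x; rewrite /torus_rel !subrr rpred0. Qed.

Lemma torus_rel_sym : symmetric torus_rel.
Proof.
by move=> x y; rewrite /torus_rel -[x.1 - _]opprB -[x.2 - _]opprB !rpredN.
Qed.

Lemma torus_rel_trans : transitive torus_rel.
Proof.
move=> y x z /andP[xy1 xy2] /andP[yz1 yz2]; rewrite /torus_rel.
have := rpredD xy1 yz1; have := rpredD xy2 yz2.
by rewrite !addrA !subrK => -> ->.
Qed.

Canonical torus_equiv :=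
  EquivRel torus_rel torus_rel_refl torus_rel_sym torus_rel_trans.

(* R^2 / Z^2; the orientation is the one of R^2. *)
Definition torus : topologicalType := quotient_topology {eq_quot torus_rel}.

Definition tproj (x : R * R) : torus :=
  \pi_(quotient_topology {eq_quot torus_rel}) x.

Definition path_connected (T : topologicalType) (A : set T) : Prop :=
  forall x y, A x -> A y -> exists gam : R -> T,
    [/\ {within `[0, 1], continuous gam},
        forall t, 0 <= t <= 1 -> A (gam t), gam 0 = x & gam 1 = y].

Definition simply_connected (T : topologicalType) (A : set T) : Prop :=
  path_connected A /\
  forall gam : R -> T,
    {within `[0, 1], continuous gam} ->
    (forall t, 0 <= t <= 1 -> A (gam t)) -> gam 0 = gam 1 ->
  exists H : R * R -> T,
    [/\ {within `[0, 1] `*` `[0, 1], continuous H},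
        forall t s, 0 <= t <= 1 -> 0 <= s <= 1 -> A (H (t, s)),
        forall t, 0 <= t <= 1 -> H (t, 0) = gam t /\ H (t, 1) = gam 0 &
        forall s, 0 <= s <= 1 -> H (0, s) = gam 0 /\ H (1, s) = gam 0].

(* the vector v turned by a right angle to the left *)
Definition turn_left (v : R * R) : R * R := (- v.2, v.1).

(* The vectors of s are nonzero and their directions are listed in strict
   counterclockwise cyclic order, in one turn. *)
Definition ccw (s : seq (R * R)) : Prop :=
  exists r theta : nat -> R,
    (forall i, (i < size s)%N ->
       0 < r i /\
       nth 0 s i = (r i * cos (theta i), r i * sin (theta i))) /\
    (forall i j, (i < j < size s)%N ->
       theta i < theta j < theta i + 2 * pi).

End Torus.

(** * Quivers with faces and gluing *)

(* A quiver together with a finite set of signed oriented cycles.  Paths are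
   composed from right to left: the word [:: a1; ...; an] stands for the path
   a1 a2 ... an which starts with an and ends with a1, so that
   src a_i = tgt a_(i+1).  [boundary F] is the word of a representative of the
   cycle w_F, which is only meaningful up to rotation. *)
Record quiver_with_faces := QuiverWithFaces {
  vertex : finType;
  arrow : finType;
  src : arrow -> vertex;
  tgt : arrow -> vertex;
  face : finType;
  positive : face -> bool;
  boundary : face -> seq arrow
}.

Section Gluing.
Variables (R : realType) (F A : finType) (bd : F -> 3.-tuple A).

Definition triangle : set 'rV[R]_3 :=
  [set x | (forall i, 0 <= x ord0 i) /\ \sum_i x ord0 i = 1].

(* The i-th arrow of the word of a face runs along the side from corner i+1 to
   corner i, the corners being indexed modulo 3. *)
Definition side (i : 'I_3) (t : R) : 'rV[R]_3 :=
  (1 - t) *: delta_mx ord0 (ordS i) + t *: delta_mx ord0 i.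

Definition triangles := {f : F & set_type triangle}.

Definition glue_side (p q : triangles) : Prop :=
  exists (i j : 'I_3) (t : R),
    [/\ 0 <= t <= 1, tnth (bd (tag p)) i = tnth (bd (tag q)) j,
        val (tagged p) = side i t & val (tagged q) = side j t].

Definition glue_rel (p q : triangles) : bool :=
  `[< clos_refl_sym_trans triangles glue_side p q >].

Lemma glue_rel_refl : reflexive glue_rel.
Proof. by move=> p; apply/asboolP; exact: rst_refl. Qed.

Lemma glue_rel_sym : symmetric glue_rel.
Proof.
by move=> p q; apply/asboolP/asboolP => h; apply: rst_sym.
Qed.

Lemma glue_rel_trans : transitive glue_rel.
Proof.
move=> q p r /asboolP pq /asboolP qr; apply/asboolP.
exact: rst_trans pq qr.
Qed.

Canonical glue_equiv :=
  EquivRel glue_rel glue_rel_refl glue_rel_sym glue_rel_trans.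

Definition glued : topologicalType := quotient_topology {eq_quot glue_rel}.

End Gluing.

(** * Brane tilings *)

(* A bipartite graph drawn on the torus.  An edge e is drawn as the projection
   of the curve t |-> curve e t, 0 <= t <= 1, of the universal cover; it runs
   from the white to the black endpoint. *)
Record torus_graph (R : realType) := TorusGraph {
  white : finType;
  black : finType;
  edge : finType;
  white_end : edge -> white;
  black_end : edge -> black;
  position : white + black -> R * R;
  curve : edge -> R -> R * R
}.

Section BraneTiling.
Variables (R : realType) (B : torus_graph R).

Definition node_pt (v : white B + black B) : torus R := tproj (position v).
Definition edge_pt (e : edge B) (t : R) : torus R := tproj (curve e t).

Definition drawing : set (torus R) :=
  range node_pt `|`
  [set x | exists (e : edge B) (t : R), 0 <= t <= 1 /\ x = edge_pt e t].

Definition embedded : Prop :=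
  [/\ injective node_pt,
      forall e : edge B, {within `[0, 1], continuous (curve e)},
      forall e : edge B, edge_pt e 0 = node_pt (inl (white_end e)) /\
                         edge_pt e 1 = node_pt (inr (black_end e)),
      forall (e e' : edge B) t t', 0 < t < 1 -> 0 < t' < 1 ->
        edge_pt e t = edge_pt e' t' -> e = e' /\ t = t' &
      forall (e : edge B) t v, 0 < t < 1 -> edge_pt e t <> node_pt v].

Definition tiling_faces : set (set (torus R)) :=
  [set connected_component (~` drawing) x | x in ~` drawing].

Definition brane_tiling : Prop :=
  embedded /\ forall A, tiling_faces A -> simply_connected R A.

(* Q is the quiver dual to B.  The edges are required to be regular curves
   leaving each node in distinct directions, so that one can speak of the two
   sides of an edge and of the cyclic order of the edges around a node.
   The white endpoint lies on the right of an arrow exactly if the arrow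
   crosses the edge, oriented from white to black, from left to right.  Hence
   the arrows go clockwise around the white nodes and counterclockwise around
   the black ones; as [boundary F] lists the arrows from the last to the
   first, it is counterclockwise around the white nodes. *)
Definition dual_quiver (Q : quiver_with_faces) : Prop :=
  exists (region : vertex Q -> set (torus R)) (dual_edge : arrow Q -> edge B)
         (node : face Q -> white B + black B) (velocity : edge B -> R -> R * R),
  [/\ injective region /\ range region = tiling_faces,
      bijective dual_edge,
      bijective node /\
      (forall F, positive F = if node F is inl _ then true else false),
      forall e (t : R), 0 <= t <= 1 ->
        is_derive t 1 (curve e) (velocity e t) /\ velocity e t != 0 &
   [/\ forall a (t : R), 0 < t < 1 ->
         let x := curve (dual_edge a) t in
         let n := turn_left (velocity (dual_edge a) t) in
         \forall eps \near 0^'+,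
           region (src a) (tproj (x + eps *: n)) /\
           region (tgt a) (tproj (x - eps *: n)),
       forall F : face Q, uniq (boundary F) /\
                 path.cycle (fun a b => src a == tgt b) (boundary F),
       forall F w, node F = inl w ->
         (forall a, (a \in boundary F) = (white_end (dual_edge a) == w)) /\
         ccw [seq velocity (dual_edge a) 0 | a <- boundary F] &
       forall F b, node F = inr b ->
         (forall a, (a \in boundary F) = (black_end (dual_edge a) == b)) /\
         ccw (rev [seq - velocity (dual_edge a) 1 | a <- boundary F])]].

End BraneTiling.

Definition dual_to_brane_tiling (R : realType) (Q : quiver_with_faces) : Prop :=
  exists B : torus_graph R, brane_tiling B /\ dual_quiver B Q.

(** * Path algebras *)

Section LinearExtension.
Variables (K : comNzRingType) (T : choiceType) (M : lmodType K) (f : T -> M).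

Definition lext (x : malg T K) : M :=
  \sum_(k <- msupp x) mcoeff k x *: f k.

Lemma lextEw (d : {fset T}) x : (msupp x `<=` d)%fset ->
  lext x = \sum_(k <- d) mcoeff k x *: f k.
Proof.
move=> le_d; rewrite /lext (big_fset_incl _ le_d) //= => k _ /mcoeff_outdom ->.
by rewrite scale0r.
Qed.

Lemma lext_is_linear : linear lext.
Proof.
move=> c x y; set d := (msupp x `|` msupp y `|` msupp (c *: x + y))%fset.
have dx : (msupp x `<=` d)%fset.
  exact: fsubset_trans (fsubsetUl _ _) (fsubsetUl _ _).
have dy : (msupp y `<=` d)%fset.
  exact: fsubset_trans (fsubsetUr _ _) (fsubsetUl _ _).
have dz : (msupp (c *: x + y) `<=` d)%fset by exact: fsubsetUr.
rewrite (lextEw dx) (lextEw dy) (lextEw dz) scaler_sumr -big_split /=.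
by apply: eq_bigr => k _; rewrite mcoeffD mcoeffZ scalerDl scalerA.
Qed.

Lemma malg_expand (x : malg T K) :
  x = \sum_(k <- msupp x) mcoeff k x *: mkmalgU k 1.
Proof.
rewrite [LHS]monalgE; apply: eq_bigr => k _.
by apply/malgP => l; rewrite mcoeffZ !mcoeffU mulrnAr mulr1.
Qed.

Lemma lextD x y : lext (x + y) = lext x + lext y.
Proof. by have := lext_is_linear 1 x y; rewrite !scale1r. Qed.

Lemma lext0 : lext 0 = 0.
Proof. by rewrite /lext msupp0 big_seq_fset0. Qed.

Lemma lextZ c x : lext (c *: x) = c *: lext x.
Proof. by have := lext_is_linear c x 0; rewrite lext0 !addr0. Qed.

Lemma lextU k : lext (mkmalgU k 1) = f k.
Proof. by rewrite (lextEw msuppU_le) big_seq_fset1 mcoeffUU scale1r. Qed.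

End LinearExtension.

Section PathAlgebra.
Variables (K : comNzRingType) (Q : quiver_with_faces).

Fixpoint composable (v : vertex Q) (s : seq (arrow Q)) : bool :=
  if s is a :: s' then (tgt a == v) && composable (src a) s' else true.

(* the path with target v and word s *)
Definition qpath := {p : vertex Q * seq (arrow Q) | composable p.1 p.2}.

Definition ptgt (p : qpath) : vertex Q := (val p).1.
Definition pword (p : qpath) : seq (arrow Q) := (val p).2.
Definition psrc (p : qpath) : vertex Q := last (ptgt p) (map (@src Q) (pword p)).

(* formal linear combinations of paths *)
Definition path_algebra : Type := malg qpath K.
HB.instance Definition _ := Choice.copy path_algebra (malg qpath K).

End PathAlgebra.

(* The operations are those of malg, locked for efficiency. *)
HB.lock Definition pa_zero (K : comNzRingType) (Q : quiver_with_faces) :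
  path_algebra K Q := 0 : malg (qpath Q) K.
HB.lock Definition pa_opp (K : comNzRingType) (Q : quiver_with_faces)
  (x : path_algebra K Q) : path_algebra K Q := - (x : malg (qpath Q) K).
HB.lock Definition pa_add (K : comNzRingType) (Q : quiver_with_faces)
  (x y : path_algebra K Q) : path_algebra K Q := (x : malg (qpath Q) K) + y.
HB.lock Definition pa_scale (K : comNzRingType) (Q : quiver_with_faces)
  (c : K) (x : path_algebra K Q) : path_algebra K Q :=
  c *: (x : malg (qpath Q) K).

Section PathModule.
Variables (K : comNzRingType) (Q : quiver_with_faces).
Local Notation path_algebra := (path_algebra K Q).

Lemma pa_addA : associative (@pa_add K Q).
Proof. by move=> x y z; rewrite pa_add.unlock addrA. Qed.

Lemma pa_addC : commutative (@pa_add K Q).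
Proof. by move=> x y; rewrite pa_add.unlock addrC. Qed.

Lemma pa_add0 : left_id (pa_zero K Q) (@pa_add K Q).
Proof. by move=> x; rewrite pa_add.unlock pa_zero.unlock add0r. Qed.

Lemma pa_addN : left_inverse (pa_zero K Q) (@pa_opp K Q) (@pa_add K Q).
Proof.
by move=> x; rewrite pa_add.unlock pa_opp.unlock pa_zero.unlock addNr.
Qed.

HB.instance Definition _ := GRing.isZmodule.Build path_algebra
  pa_addA pa_addC pa_add0 pa_addN.

Lemma pa_scaleA (a b : K) (x : path_algebra) :
  pa_scale a (pa_scale b x) = pa_scale (a * b) x.
Proof. by rewrite pa_scale.unlock scalerA. Qed.

Lemma pa_scale1 : left_id 1 (@pa_scale K Q).
Proof. by move=> x; rewrite pa_scale.unlock scale1r. Qed.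

Lemma pa_scaleDr : right_distributive (@pa_scale K Q) +%R.
Proof.
by move=> a x y; rewrite /GRing.add /= pa_scale.unlock pa_add.unlock scalerDr.
Qed.

Lemma pa_scaleDl (x : path_algebra) :
  {morph (@pa_scale K Q)^~ x : a b / a + b}.
Proof.
move=> a b; rewrite [RHS]/GRing.add /= pa_scale.unlock pa_add.unlock.
exact: scalerDl.
Qed.

HB.instance Definition _ := GRing.Zmodule_isLmodule.Build K path_algebra
  pa_scaleA pa_scale1 pa_scaleDr pa_scaleDl.

Lemma pa_zeroE : (0 : path_algebra) = (0 : malg (qpath Q) K).
Proof. by rewrite -[LHS]/(pa_zero K Q) pa_zero.unlock. Qed.

Lemma pa_addE (x y : path_algebra) : x + y = (x : malg (qpath Q) K) + y.
Proof. by rewrite -[LHS]/(pa_add x y) pa_add.unlock. Qed.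

Lemma pa_scaleE c (x : path_algebra) : c *: x = c *: (x : malg (qpath Q) K).
Proof. by rewrite -[LHS]/(pa_scale c x) pa_scale.unlock. Qed.

End PathModule.

HB.lock Definition path_elt (K : comNzRingType) (Q : quiver_with_faces)
    (p : qpath Q) : path_algebra K Q := mkmalgU p 1.

Section PathProduct.
Variables (K : comNzRingType) (Q : quiver_with_faces).

(* the path with target v and word s as an element of the path algebra,
   0 if the word is not composable *)
Definition word_elt (v : vertex Q) (s : seq (arrow Q)) : path_algebra K Q :=
  if insub (v, s) is Some p then path_elt K p else 0.

Definition path_mul (p q : qpath Q) : path_algebra K Q :=
  if psrc p == ptgt q then word_elt (ptgt p) (pword p ++ pword q) else 0.

Definition pa_one : path_algebra K Q := \sum_v word_elt v [::].

End PathProduct.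

HB.lock Definition pa_mul (K : comNzRingType) (Q : quiver_with_faces)
    (x y : path_algebra K Q) : path_algebra K Q :=
  lext (fun p => lext (path_mul K p) y) x.

Section PathAlgebraRing.
Variables (K : comNzRingType) (Q : quiver_with_faces).
Local Notation path_algebra := (path_algebra K Q).
Local Notation qpath := (qpath Q).
Local Notation pa_mul := (@pa_mul K Q).
Local Notation pa_one := (@pa_one K Q).
Local Notation path_mul := (@path_mul K Q).
Local Notation word_elt := (@word_elt K Q).

Local Notation pathE := (@path_elt K Q).

Lemma pa_lextD (M : lmodType K) (f : qpath -> M) (x y : path_algebra) :
  lext f (x + y) = lext f x + lext f y.
Proof. by rewrite pa_addE; apply: lextD. Qed.

Lemma pa_lext0 (M : lmodType K) (f : qpath -> M) : lext f (0 : path_algebra) = 0.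
Proof. by rewrite pa_zeroE; apply: lext0. Qed.

Lemma pa_lextZ (M : lmodType K) (f : qpath -> M) c (x : path_algebra) :
  lext f (c *: x) = c *: lext f x.
Proof. by rewrite pa_scaleE; apply: lextZ. Qed.

Lemma pa_mulDl : left_distributive pa_mul +%R.
Proof. by move=> x y z; rewrite pa_mul.unlock pa_lextD. Qed.

Lemma pa_mulE x y :
  pa_mul x y = \sum_(p <- msupp x) mcoeff p x *: lext (path_mul p) y.
Proof. by rewrite pa_mul.unlock. Qed.

Lemma pa_mulDr : right_distributive pa_mul +%R.
Proof.
move=> x y z; rewrite !pa_mulE -big_split /=.
by apply: eq_bigr => p _; rewrite pa_lextD scalerDr.
Qed.

Lemma pa_mul0l y : pa_mul 0 y = 0.
Proof. by rewrite pa_mul.unlock pa_lext0. Qed.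

Lemma pa_mul0r x : pa_mul x 0 = 0.
Proof.
by rewrite pa_mulE big1 // => p _; rewrite pa_lext0 scaler0.
Qed.

Lemma pa_mulZl c x y : pa_mul (c *: x) y = c *: pa_mul x y.
Proof. by rewrite pa_mul.unlock pa_lextZ. Qed.

Lemma pa_mulZr c x y : pa_mul x (c *: y) = c *: pa_mul x y.
Proof.
rewrite !pa_mulE scaler_sumr; apply: eq_bigr => p _.
by rewrite pa_lextZ !scalerA mulrC.
Qed.

Lemma pa_expand (x : path_algebra) :
  x = \sum_(p <- msupp x) mcoeff p x *: pathE p.
Proof.
rewrite {1}(malg_expand x); pose F (y : malg qpath K) : path_algebra := y.
rewrite -[LHS]/(F _) (big_morph F (id1 := 0) (op1 := +%R)).
- by apply: eq_bigr => p _; rewrite pa_scaleE path_elt.unlock.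
- by move=> y z; rewrite pa_addE.
- by rewrite pa_zeroE.
Qed.

Lemma pa_ind (P : path_algebra -> Prop) : P 0 ->
  (forall x y, P x -> P y -> P (x + y)) -> (forall c x, P x -> P (c *: x)) ->
  (forall p, P (pathE p)) -> forall x, P x.
Proof.
move=> P0 PD PZ PE x; have -> := pa_expand x.
elim: (X in \sum_(p <- X) _) => [|p s IHs]; first by rewrite big_nil.
by rewrite big_cons; apply: (PD) => //; apply: (PZ); apply: PE.
Qed.

Lemma pa_mulEE p q : pa_mul (pathE p) (pathE q) = path_mul p q.
Proof. by rewrite pa_mul.unlock path_elt.unlock !lextU. Qed.

Lemma composable_cat v s t :
  composable v (s ++ t) = composable v s && composable (last v (map (@src Q) s)) t.
Proof. by elim: s v => [|a s IHs] v //=; rewrite IHs andbA. Qed.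

Lemma word_eltE (p : qpath) : word_elt (ptgt p) (pword p) = pathE p.
Proof. by rewrite /word_elt -surjective_pairing valK. Qed.

Lemma path_mulN p q : psrc p != ptgt q -> path_mul p q = 0.
Proof. by rewrite /path_mul => /negPf->. Qed.

Lemma path_mulP p q : psrc p = ptgt q ->
  {pq : qpath | [/\ path_mul p q = pathE pq, ptgt pq = ptgt p,
    pword pq = pword p ++ pword q & psrc pq = psrc q]}.
Proof.
move=> pq; have c : composable (ptgt p) (pword p ++ pword q).
  rewrite composable_cat (valP p) /=.
  by move: (valP q); rewrite -/(psrc p) pq.
exists (exist _ (ptgt p, pword p ++ pword q) c); split=> //.
  by rewrite /path_mul pq eqxx -word_eltE.
by rewrite /psrc /ptgt /pword /= map_cat last_cat -/(psrc p) pq.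
Qed.

Lemma pa_mulEA p q r :
  pa_mul (pathE p) (path_mul q r) = pa_mul (path_mul p q) (pathE r).
Proof.
have [qr|qr] := eqVneq (psrc q) (ptgt r); last first.
  rewrite (path_mulN qr) pa_mul0r.
  have [pq|pq] := eqVneq (psrc p) (ptgt q); last first.
    by rewrite (path_mulN pq) pa_mul0l.
  have [x [-> _ _ xs]] := path_mulP pq.
  by rewrite pa_mulEE path_mulN // xs.
have [y [-> yt yw ys]] := path_mulP qr; rewrite pa_mulEE.
have [pq|pq] := eqVneq (psrc p) (ptgt q); last first.
  by rewrite (path_mulN pq) pa_mul0l path_mulN // yt.
have [x [-> xt xw xs]] := path_mulP pq; rewrite pa_mulEE.
have py : psrc p = ptgt y by rewrite yt.
have xr : psrc x = ptgt r by rewrite xs.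
have [z [-> zt zw _]] := path_mulP py.
have [t [-> tt tw _]] := path_mulP xr.
by rewrite -!word_eltE zt zw tt tw xt xw yw catA.
Qed.

Lemma pa_mulA : associative pa_mul.
Proof.
move=> x y z; elim/pa_ind: x => [|x x' IH IH'|c x IH|p].
- by rewrite !pa_mul0l.
- by rewrite !pa_mulDl IH IH'.
- by rewrite !pa_mulZl IH.
elim/pa_ind: y => [|y y' IH IH'|c y IH|q].
- by rewrite pa_mul0l pa_mul0r pa_mul0l.
- rewrite (pa_mulDl y y' z) (pa_mulDr (pathE p) (pa_mul y z) (pa_mul y' z)).
  rewrite (pa_mulDr (pathE p) y y').
  rewrite (pa_mulDl (pa_mul (pathE p) y) (pa_mul (pathE p) y') z).
  congr (_ + _); [apply: IH | apply: IH'].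
- rewrite (pa_mulZl c y z).
  rewrite (pa_mulZr c (pathE p) (pa_mul y z)).
  rewrite (pa_mulZr c (pathE p) y).
  rewrite (pa_mulZl c (pa_mul (pathE p) y) z).
  congr (_ *: _); apply: IH.
elim/pa_ind: z => [|z z' IH IH'|c z IH|r].
- by rewrite !pa_mul0r.
- rewrite (pa_mulDr (pathE q) z z') (pa_mulDr (pathE p) (pa_mul (pathE q) z)).
  rewrite (pa_mulDr (pa_mul (pathE p) (pathE q)) z z').
  congr (_ + _); [apply: IH | apply: IH'].
- rewrite (pa_mulZr c (pathE q) z) (pa_mulZr c (pathE p)).
  rewrite (pa_mulZr c (pa_mul (pathE p) (pathE q)) z).
  congr (_ *: _); apply: IH.
by rewrite (pa_mulEE q r) (pa_mulEE p q) pa_mulEA.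
Qed.

Definition idem (v : vertex Q) : qpath := exist _ (v, [::]) isT.

Lemma pa_oneE : pa_one = \sum_v pathE (idem v).
Proof. by apply: eq_bigr => v _; rewrite -word_eltE. Qed.

Lemma pa_mul1 : left_id pa_one pa_mul.
Proof.
elim/pa_ind => [|x y IHx IHy|c x IHx|p]; first exact: pa_mul0r.
- by rewrite pa_mulDr IHx IHy.
- by rewrite pa_mulZr IHx.
rewrite pa_oneE (big_morph (pa_mul^~ _) (fun x y => pa_mulDl x y _) (pa_mul0l _)).
rewrite (bigD1 (ptgt p)) //= big1 ?addr0 => [|v vp].
  have [|q [qE qt qw _]] := @path_mulP (idem (ptgt p)) p; first by [].
  by rewrite pa_mulEE qE -!word_eltE qt qw.
by rewrite pa_mulEE path_mulN.
Qed.

Lemma pa_mulr1 : right_id pa_one pa_mul.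
Proof.
elim/pa_ind => [|x y IHx IHy|c x IHx|p]; first exact: pa_mul0l.
- by rewrite pa_mulDl IHx IHy.
- by rewrite pa_mulZl IHx.
rewrite pa_oneE (big_morph (pa_mul _) (pa_mulDr _) (pa_mul0r _)).
rewrite (bigD1 (psrc p)) //= big1 ?addr0 => [|v vp].
  have [|q [qE qt qw _]] := @path_mulP p (idem (psrc p)); first by [].
  by rewrite pa_mulEE qE -!word_eltE qt qw cats0.
by rewrite pa_mulEE path_mulN // eq_sym.
Qed.

HB.instance Definition _ := GRing.Zmodule_isPzRing.Build path_algebra
  pa_mulA pa_mul1 pa_mulr1 pa_mulDl pa_mulDr.

End PathAlgebraRing.

(** * Quotients by two-sided ideals, and the quiver potential algebra *)

Section TwoSidedQuotient.
Variables (R : pzRingType) (G : set R).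

(* the two-sided ideal generated by G *)
Definition two_sided_ideal : {pred R} := fun x =>
  `[< exists s : seq (R * R * R), (forall t, t \in s -> G t.1.2) /\
        x = \sum_(t <- s) t.1.1 * t.1.2 * t.2 >].

Lemma two_sided_idealMl a x : x \in two_sided_ideal -> a * x \in two_sided_ideal.
Proof.
move=> /asboolP[s [sG ->]]; apply/asboolP.
exists [seq (a * t.1.1, t.1.2, t.2) | t <- s]; split.
  by move=> t /mapP[u us ->] /=; apply: sG.
by rewrite big_map mulr_sumr; apply: eq_bigr => t _; rewrite !mulrA.
Qed.

Lemma two_sided_idealMr a x : x \in two_sided_ideal -> x * a \in two_sided_ideal.
Proof.
move=> /asboolP[s [sG ->]]; apply/asboolP.
exists [seq (t.1.1, t.1.2, t.2 * a) | t <- s]; split.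
  by move=> t /mapP[u us ->] /=; apply: sG.
by rewrite big_map mulr_suml; apply: eq_bigr => t _; rewrite !mulrA.
Qed.

Lemma two_sided_ideal_zmod : zmod_closed two_sided_ideal.
Proof.
split; first by apply/asboolP; exists [::]; split=> //; rewrite big_nil.
move=> x y xI /(two_sided_idealMl (- 1)); rewrite mulN1r.
move: xI => /asboolP[s [sG ->]] /asboolP[t [tG ->]]; apply/asboolP.
exists (s ++ t); split; last by rewrite big_cat.
by move=> u; rewrite mem_cat => /orP[/sG|/tG].
Qed.

HB.instance Definition _ :=
  GRing.isZmodClosed.Build R two_sided_ideal two_sided_ideal_zmod.

Definition ring_quot : Type := Quotient.quot two_sided_ideal.
HB.instance Definition _ : EqQuotient R (Quotient.equiv two_sided_ideal) ring_quot
  := EqQuotient.on ring_quot.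
HB.instance Definition _ := GRing.Zmodule.on ring_quot.

Definition rq_one : ring_quot := \pi_ring_quot 1.
Definition rq_mul (x y : ring_quot) : ring_quot :=
  \pi_ring_quot (repr x * repr y).

Lemma rq_eq (x y : R) :
  \pi_ring_quot x = \pi_ring_quot y <-> x - y \in two_sided_ideal.
Proof.
rewrite (Quotient.idealrBE two_sided_ideal x y).
by split=> [e|/eqP//]; apply/eqP.
Qed.

Lemma rq_mulE (x y : R) :
  rq_mul (\pi_ring_quot x) (\pi_ring_quot y) = \pi_ring_quot (x * y).
Proof.
apply/rq_eq; set x' := repr _; set y' := repr _.
have hx : x' - x \in two_sided_ideal by apply/rq_eq; rewrite reprK.
have hy : y' - y \in two_sided_ideal by apply/rq_eq; rewrite reprK.
have -> : x' * y' - x * y = (x' - x) * y' + x * (y' - y).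
  by rewrite mulrBl mulrBr addrA subrK.
apply: (rpredD (V := R)); first exact: two_sided_idealMr.
exact: two_sided_idealMl.
Qed.

Lemma rq_ind (P : ring_quot -> Prop) :
  (forall x, P (\pi_ring_quot x)) -> forall x, P x.
Proof. by move=> h x; rewrite -[x]reprK; apply: h. Qed.

Lemma rq_addE (x y : R) :
  \pi_ring_quot x + \pi_ring_quot y = \pi_ring_quot (x + y).
Proof. by rewrite (raddfD (\pi_(Quotient.quot two_sided_ideal))). Qed.

Lemma rq_mulA : associative rq_mul.
Proof.
elim/rq_ind => x; elim/rq_ind => y; elim/rq_ind => z.
by rewrite !rq_mulE mulrA.
Qed.

Lemma rq_mul1 : left_id rq_one rq_mul.
Proof. by elim/rq_ind => x; rewrite rq_mulE mul1r. Qed.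

Lemma rq_mulr1 : right_id rq_one rq_mul.
Proof. by elim/rq_ind => x; rewrite rq_mulE mulr1. Qed.

Lemma rq_mulDl : left_distributive rq_mul +%R.
Proof.
elim/rq_ind => x; elim/rq_ind => y; elim/rq_ind => z.
by rewrite rq_addE !rq_mulE rq_addE mulrDl.
Qed.

Lemma rq_mulDr : right_distributive rq_mul +%R.
Proof.
elim/rq_ind => x; elim/rq_ind => y; elim/rq_ind => z.
by rewrite rq_addE !rq_mulE rq_addE mulrDr.
Qed.

HB.instance Definition _ := GRing.Zmodule_isPzRing.Build ring_quot
  rq_mulA rq_mul1 rq_mulr1 rq_mulDl rq_mulDr.

End TwoSidedQuotient.

Section Potential.
Variables (K : comNzRingType) (Q : quiver_with_faces).
Local Notation path_algebra := (path_algebra K Q).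

(* the cyclic path with word s *)
Definition cycle_elt (s : seq (arrow Q)) : path_algebra :=
  if s is a :: _ then word_elt K (tgt a) s else 0.

Definition potential : path_algebra :=
  \sum_(F : face Q | positive F) cycle_elt (boundary F) -
  \sum_(F : face Q | ~~ positive F) cycle_elt (boundary F).

(* du/da for a path u: the sum of the a_(i+1) ... a_n a_1 ... a_(i-1) over the
   i with a_i = a when u is a cycle, 0 otherwise *)
Definition path_derivative (a : arrow Q) (u : qpath Q) : path_algebra :=
  if psrc u == ptgt u then
    \sum_(i < size (pword u) | onth (pword u) i == Some a)
       word_elt K (src a) (behead (rot i (pword u)))
  else 0.

Definition cyclic_derivative (a : arrow Q) (x : path_algebra) : path_algebra :=
  lext (path_derivative a) x.

(* CQ / (dW) *)
Definition potential_algebra : pzRingType :=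
  ring_quot [set cyclic_derivative a potential | a in [set: arrow Q]].

End Potential.

(** * Modules and non-commutative crepant resolutions *)

Section HomologicalAlgebra.
Variable A : pzRingType.

Definition submodule (M : lmodType A) (U : set M) : Prop :=
  U 0 /\ forall a u v, U u -> U v -> U (a *: u + v).

Definition simple_module (M : lmodType A) : Prop :=
  (exists x : M, x != 0) /\
  forall U : set M, submodule U -> U = [set 0] \/ U = setT.

Definition projective_module (P : lmodType A) : Prop :=
  forall (M N : lmodType A) (g : {linear M -> N}) (f : {linear P -> N}),
    (forall y, exists x, g x = y) ->
    exists h : {linear P -> M}, forall x, g (h x) = f x.

(* M has a projective resolution 0 -> P_n -> ... -> P_0 -> M -> 0. *)
Definition has_projective_resolution (M : lmodType A) (n : nat) : Prop :=
  exists (P : nat -> lmodType A) (d : forall i, {linear P i.+1 -> P i})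
         (aug : {linear P 0%N -> M}),
  [/\ forall i, projective_module (P i),
       forall i, (n < i)%N -> forall x : P i, x = 0,
       forall y, exists x, aug x = y,
       forall x, aug x = 0 <-> exists y, x = d 0%N y &
       forall i x, d i x = 0 <-> exists y, x = d i.+1 y].

Definition projective_dimension (M : lmodType A) (n : nat) : Prop :=
  has_projective_resolution M n /\
  forall m, has_projective_resolution M m -> (n <= m)%N.

Definition homologically_homogeneous : Prop :=
  exists n, forall S : lmodType A, simple_module S -> projective_dimension S n.

End HomologicalAlgebra.

Section NCCR.
Variables (R : comNzRingType) (A : pzRingType) (iota : {rmorphism R -> A}).

Definition fin_gen (N : lmodType R) : Prop :=
  exists s : seq N, forall x, exists c : 'I_(size s) -> R,
    x = \sum_i c i *: s`_i.

(* The canonical map N -> Hom_R(Hom_R(N, R), R) is bijective. *)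
Definition reflexive_module (N : lmodType R) : Prop :=
  (forall x y : N, (forall f : {linear N -> R^o}, f x = f y) -> x = y) /\
  forall theta : {linear N -> R^o} -> R,
    (forall (r : R) (f g h : {linear N -> R^o}),
       (forall x, h x = r * f x + g x) -> theta h = r * theta f + theta g) ->
    exists x, forall f : {linear N -> R^o}, theta f = f x.

(* A is isomorphic to End_R(N) as an R-algebra. *)
Definition iso_End (N : lmodType R) : Prop :=
  exists Phi : A -> {linear N -> N},
  [/\ forall x, Phi 1 x = x,
       forall a b x, Phi (a * b) x = Phi a (Phi b x),
       forall a b x, Phi (a + b) x = Phi a x + Phi b x,
       forall r a x, Phi (iota r * a) x = r *: Phi a x &
       (forall a b, (forall x, Phi a x = Phi b x) -> a = b) /\
       forall f : {linear N -> N}, exists a, forall x, Phi a x = f x].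

(* The R-algebra A (with structure map iota) is a non-commutative crepant
   resolution of R. *)
Definition nccr : Prop :=
  [/\ forall r a, iota r * a = a * iota r,
       exists N : lmodType R,
         [/\ exists x : N, x != 0, fin_gen N, reflexive_module N & iso_End N] &
       homologically_homogeneous A].

End NCCR.

(** * The invariant ring *)

Section InvariantRing.
Variables (K : fieldType) (n : nat) (gT : finGroupType).
Variable rG : mx_representation K [set: gT]%G n.

(* polynomial functions on the column space K^n *)
Definition mpoly_at (f : mpoly n K) (v : 'cV[K]_n) : K :=
  meval (fun i => v i ord0) f.

Definition invariant : {pred mpoly n K} := fun f =>
  `[< forall (g : gT) (v : 'cV[K]_n), mpoly_at f (rG g *m v) = mpoly_at f v >].

Lemma invariant_subring : subring_closed invariant.
Proof.
split.
- by apply/asboolP => g v; rewrite /mpoly_at !meval1.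
- move=> f f' /asboolP hf /asboolP hf'; apply/asboolP => g v.
  by move: (hf g v) (hf' g v); rewrite /mpoly_at !mevalB => -> ->.
- move=> f f' /asboolP hf /asboolP hf'; apply/asboolP => g v.
  by move: (hf g v) (hf' g v); rewrite /mpoly_at !mevalM => -> ->.
Qed.

HB.instance Definition _ :=
  GRing.isSubringClosed.Build (mpoly n K) invariant invariant_subring.

Definition invariant_ring : Type := {f : mpoly n K | f \in invariant}.
HB.instance Definition _ := [isSub of invariant_ring for (@sval _ _)].
HB.instance Definition _ := [Choice of invariant_ring by <:].
HB.instance Definition _ :=
  [SubChoice_isSubComNzRing of invariant_ring by <:].

Lemma invariantC (c : K) : mpolyC n c \in invariant.
Proof. by apply/asboolP => g v; rewrite /mpoly_at !mevalC. Qed.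

Definition invariant_const (c : K) : invariant_ring :=
  exist (fun f => f \in invariant) (mpolyC n c) (invariantC c).

End InvariantRing.

(** * McKay quivers *)

Section Characters.
Variables (K : closedFieldType) (gT : finGroupType).

(* Hom(G, K^* ) *)
Record character := Character {
  char_fun :> {ffun gT -> K};
  _ : (char_fun 1%g == 1) &&
      [forall x, forall y, char_fun (x * y)%g == char_fun x * char_fun y]
}.

HB.instance Definition _ := [isSub for char_fun].

Lemma char1 (chi : character) : chi 1%g = 1.
Proof. by have /andP[/eqP] := valP chi. Qed.

Lemma charM (chi : character) x y : chi (x * y)%g = chi x * chi y.
Proof. by have /andP[_ /forallP/(_ x)/forallP/(_ y)/eqP] := valP chi. Qed.

(* There are finitely many characters, as their values are roots of unity. *)
Definition unity_roots : seq K :=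
  sval (closed_field_poly_normal ('X^#|gT| - 1 : {poly K})).

Lemma char_unity_root (chi : character) x : chi x \in unity_roots.
Proof.
have Xn : chi x ^+ #|gT| = 1.
  have chiX m : chi (x ^+ m)%g = chi x ^+ m.
    by elim: m => [|m IHm]; rewrite ?expg0 ?char1 // expgS charM IHm exprS.
  have xG : (#[x]%g %| #|gT|)%N.
    by rewrite -cardsT; apply: (@order_dvdG _ [set: gT]%G); rewrite inE.
  rewrite -chiX.
  by move: xG; rewrite order_dvdn => /eqP ->; rewrite char1.
have n_gt0 : (0 < #|gT|)%N by apply/card_gt0P; exists x.
have p0 : 'X^#|gT| - 1 != 0 :> {poly K}.
  by rewrite -size_poly_eq0 size_XnsubC.
have := svalP (closed_field_poly_normal ('X^#|gT| - 1 : {poly K})).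
rewrite -/unity_roots => pE.
have : root ('X^#|gT| - 1 : {poly K}) (chi x).
  by rewrite /root hornerD hornerN hornerC hornerXn Xn subrr.
by rewrite pE rootZ ?lead_coef_eq0 // root_prod_XsubC.
Qed.

Definition char_code (chi : character) : {ffun gT -> seq_sub unity_roots} :=
  [ffun x => SeqSub (char_unity_root chi x)].

Definition char_decode (f : {ffun gT -> seq_sub unity_roots}) : option character :=
  insub [ffun x => ssval (f x)].

Lemma char_codeK : pcancel char_code char_decode.
Proof.
move=> chi; rewrite /char_decode.
have -> : [ffun x => ssval (char_code chi x)] = val chi.
  by apply/ffunP => x; rewrite !ffunE.
by rewrite valK.
Qed.

HB.instance Definition _ := Finite.copy character (pcan_type char_codeK).

Lemma char_mul_subproof (chi psi : character) (f := [ffun x => chi x * psi x]) :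
  (f 1%g == 1) && [forall x, forall y, f (x * y)%g == f x * f y].
Proof.
rewrite /f ffunE !char1 mulr1 eqxx; apply/forallP => x; apply/forallP => y.
by rewrite !ffunE !charM mulrACA.
Qed.

Definition char_mul (chi psi : character) : character :=
  Character (char_mul_subproof chi psi).

End Characters.

Section McKay.
Variables (K : closedFieldType) (gT : finGroupType).
Variable rho : 'I_3 -> character K gT.
Local Notation char := (character K gT).

(* The arrow (chi, i) is a_i^chi : chi rho_i -> chi. *)
Definition mckay_arrow : finType := (char * 'I_3)%type.
Definition mckay_src (a : mckay_arrow) : char := char_mul a.1 (rho a.2).
Definition mckay_tgt (a : mckay_arrow) : char := a.1.

(* The cycle of the face given by chi and pi, as a path from chi to chi. *)
Definition face_word (x : char * 'S_3) : 3.-tuple mckay_arrow :=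
  let: (chi, pi) := x in
  let i1 := pi (inord 0) in
  let i2 := pi (inord 1) in
  let i3 := pi (inord 2) in
  let chi1 := char_mul chi (rho i1) in
  let chi12 := char_mul chi1 (rho i2) in
  [tuple (chi, i1); (chi1, i2); (chi12, i3)].

(* equality of the cycles up to rotation *)
Definition same_face (x y : char * 'S_3) : bool :=
  [exists k : 'I_3, rot k (face_word x) == face_word y :> seq _].

Lemma same_face_refl : reflexive same_face.
Proof. by move=> x; apply/existsP; exists ord0; rewrite rot0. Qed.

Lemma rot3 (T : Type) (s : 3.-tuple T) (i j : 'I_3) :
  rot i (rot j s) = rot (inord ((i + j) %% 3) : 'I_3) s.
Proof.
rewrite inordK ?ltn_mod //; case: s => [] [|a [|b [|c []]]] //= _.
by case: i => [] [|[|[|i]]] //= _; case: j => [] [|[|[|j]]].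
Qed.

Lemma same_face_sym : symmetric same_face.
Proof.
suff h x y : same_face x y -> same_face y x by move=> x y; apply/idP/idP; apply: h.
move=> /existsP[k /eqP e]; apply/existsP; exists (inord ((3 - k) %% 3)).
rewrite -{}e inordK ?ltn_mod //.
by case: (face_word x) => [] [|a [|b [|c []]]] //= _; case: k => [] [|[|[|k]]].
Qed.

Lemma same_face_trans : transitive same_face.
Proof.
move=> y x z /existsP[j /eqP xy] /existsP[i /eqP yz]; apply/existsP.
by exists (inord ((i + j) %% 3)); rewrite -rot3 xy yz.
Qed.

Canonical same_face_equiv :=
  EquivRel same_face same_face_refl same_face_sym same_face_trans.

(* The quotient by same_face; quot_type carries its finType structure. *)
Definition mckay_face : finType := quot_type {eq_quot same_face}.

Definition mckay_boundary (F : mckay_face) : 3.-tuple mckay_arrow :=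
  face_word (repr F).

Definition mckay_quiver : quiver_with_faces := {|
  vertex := char;
  arrow := mckay_arrow;
  src := mckay_src;
  tgt := mckay_tgt;
  face := mckay_face;
  positive := fun F => ~~ odd_perm (repr F).2;
  boundary := fun F => mckay_boundary F |}.

End McKay.

(* Main.v *)
(* In additive notation, rho_0 + rho_1 + rho_2 = 0 and, as G acts faithfully, the
   rho_i generate the character group, which is therefore Z^2 modulo a lattice.
   The triangles of the McKay quiver are the images of the two halves of the
   unit squares of the plane, so they glue to the torus R^2 / lattice.  The dual
   graph is the hexagonal tiling; it is drawn as a brick wall, whose edges are
   straight and whose faces are images of open rectangles.

   The relations dW/da say that the arrows of different types commute.  Hence a
   module over the potential algebra A is a graded vector space with three
   commuting operators, and S = C[y_0, y_1, y_2] is one.  Every invariant-linear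
   map between weight spaces of S is the multiplication by a polynomial, so the
   action identifies A with End_R(S), and S is reflexive over R = S^G.

   A simple A-module M has finite dimension: the |G|-th powers of the operators
   are central, hence scalars, since otherwise the uncountably many vectors
   (z - c)^-1 s would be linearly independent in a space of countable dimension.
   The Koszul resolution of M has length 3.  A shorter one would make its last
   map split, which would write the identity of M as a sum of commutators; this
   is impossible by taking traces. *)
Require Import Defs.
From HB Require Import structures.
From mathcomp Require Import -(notations) mpoly.
From mathcomp Require Import -(notations) monalg.
From mathcomp Require Import all_boot all_order all_algebra all_fingroup.
From mathcomp Require Import cyclic mxrepresentation complex finmap generic_quotient.
From mathcomp Require Import all_classical all_reals topology normedtype.
From mathcomp Require Import derive trigo lebesgue_measure.
From mathcomp Require Import zify ring lra.
From mathcomp Require Import -(notations) mpoly.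

Set Implicit Arguments.
Unset Strict Implicit.
Unset Printing Implicit Defensive.

Import GRing.Theory.
Local Open Scope ring_scope.
Local Open Scope quotient_scope.

(** * Characters and the lattice of their relations *)

(** Faithfulness and determinant one enter through [sep] and [sum_rho]: an element on which all the
    [rho i] are 1 is trivial, and the [rho i] sum to 0.

    The Koszul complex is made for an arbitrary module M, with terms M[x_0, x_1, x_2] whose
    idempotents are twisted by a character, so the simple modules need not be classified. A finite
    basis of M serves to show that the terms are projective and to take traces; characteristic 0
    makes the trace of the identity nonzero.

    Reflexivity is self-duality: the weight 0 part of a product pairs S with itself, and every
    functional over the invariants arises from this pairing.

    The covering of the torus by the plane is an upper triangular linear map with positive diagonal.
    It preserves orientation and horizontal lines, so the cyclic order of the edges at a node can be
    read off from half-planes.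

    The faces are classes of words up to rotation, and their boundaries come from chosen
    representatives. Hence boundary words are known up to rotation only, and derivatives, gluing and
    cyclic orders are all shown not to depend on it. *)

Section CharacterGroup.
Variables (K : closedFieldType) (gT : finGroupType).
Local Notation char := (character K gT).

Lemma char_neq0 (chi : char) g : chi g != 0.
Proof.
apply/eqP => chig0; have := Defs.charM chi g g^-1%g.
by rewrite mulgV Defs.char1 chig0 mul0r => /eqP; rewrite oner_eq0.
Qed.

Lemma char_zero_subproof :
  let f := [ffun _ : gT => 1 : K] in
  (f 1%g == 1) && [forall x, forall y, f (x * y)%g == f x * f y].
Proof.
rewrite /= ffunE eqxx; apply/forallP => x; apply/forallP => y.
by rewrite !ffunE mulr1.
Qed.

Definition char_zero : char := Character char_zero_subproof.

Lemma char_opp_subproof (chi : char) :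
  let f := [ffun g => (chi g)^-1] in
  (f 1%g == 1) && [forall x, forall y, f (x * y)%g == f x * f y].
Proof.
rewrite /= ffunE Defs.char1 invr1 eqxx; apply/forallP => x; apply/forallP => y.
by rewrite !ffunE Defs.charM invfM.
Qed.

Definition char_opp (chi : char) : char := Character (char_opp_subproof chi).

Lemma character_eq (chi psi : char) : (forall g, chi g = psi g) -> chi = psi.
Proof. by move=> e; apply: val_inj; apply/ffunP. Qed.

Lemma char_mulA : associative (@char_mul K gT).
Proof. by move=> x y z; apply: character_eq => g; rewrite !ffunE mulrA. Qed.

Lemma char_mulC : commutative (@char_mul K gT).
Proof. by move=> x y; apply: character_eq => g; rewrite !ffunE mulrC. Qed.

Lemma char_mul0 : left_id char_zero (@char_mul K gT).
Proof. by move=> x; apply: character_eq => g; rewrite !ffunE mul1r. Qed.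

Lemma char_mulN : left_inverse char_zero char_opp (@char_mul K gT).
Proof. by move=> x; apply: character_eq => g; rewrite !ffunE mulVf ?char_neq0. Qed.

(* The character group is written additively. *)
HB.instance Definition _ := GRing.isZmodule.Build char
  char_mulA char_mulC char_mul0 char_mulN.

Lemma character_addE (chi psi : char) g : (chi + psi) g = chi g * psi g.
Proof. by rewrite ffunE. Qed.

Lemma character_0E g : (0 : char) g = 1.
Proof. by rewrite ffunE. Qed.

Lemma character_mulrnE (chi : char) n g : (chi *+ n) g = chi g ^+ n.
Proof. by elim: n => [|n IH]; rewrite ?character_0E // mulrS character_addE IH exprS. Qed.

Lemma char_order (chi : char) : chi *+ #|gT| = 0.
Proof.
apply: character_eq => g; rewrite character_mulrnE character_0E.
have chiX m : chi (g ^+ m)%g = chi g ^+ m.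
  by elim: m => [|m IH]; rewrite ?expg0 ?Defs.char1 // expgS Defs.charM IH exprS.
have : (#[g]%g %| #|gT|)%N.
  by rewrite -cardsT; apply: (@order_dvdG _ [set: gT]%G); rewrite inE.
by rewrite order_dvdn -chiX => /eqP ->; rewrite Defs.char1.
Qed.

Lemma card_gT_gt0 : (0 < #|gT|)%N.
Proof. by apply/card_gt0P; exists 1%g. Qed.

Lemma char_sum0 (chi : char) : chi != 0 -> \sum_g chi g = 0.
Proof.
move=> chi0; have [g chig] : exists g, chi g != 1.
  apply/existsP; apply: contraNT chi0; rewrite negb_exists => /forallP e.
  by apply/eqP/character_eq => g; rewrite character_0E; have := e g; rewrite negbK => /eqP.
have e : \sum_h chi h = chi g * \sum_h chi h.
  rewrite mulr_sumr (reindex_inj (mulgI g)) /=.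
  by apply: eq_bigr => h _; rewrite Defs.charM.
apply/eqP; move/eqP: e; rewrite -subr_eq0 -{1}[\sum_h _]mul1r -mulrBl mulf_eq0.
by rewrite subr_eq0 eq_sym (negPf chig).
Qed.

(* The indicator function of 1 is the product over g <> 1 of the functions
   (rho i - rho i g) / (1 - rho i g), so it is a combination of characters in
   the monoid generated by the rho i; it is orthogonal to no character. *)
Lemma char_generated (I : finType) (rho : I -> char) (S : pred char) :
  (forall g, (forall i, rho i g = 1) -> g = 1%g) ->
  S 0 -> (forall chi i, S chi -> S (chi + rho i)) -> forall chi, S chi.
Proof.
move=> sep S0 SD chi; apply: contraT => nS.
(* These functions contain 1, since [chi] lies outside [S], and are stable under multiplication by
   each [rho i], since [S] is stable under adding it. The indicator function of 1 is then among
   them, which fails on [psi = 0]. *)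
pose orth (f : gT -> K) := forall psi : char, S psi ->
  \sum_g (psi - chi) g * f g = 0.
have orthD f f' : orth f -> orth f' -> orth (fun g => f g + f' g).
  move=> o o' psi Spsi; under eq_bigr do rewrite mulrDr.
  by rewrite big_split /= o // o' // addr0.
have orthZ c f : orth f -> orth (fun g => c * f g).
  move=> o psi Spsi; under eq_bigr do rewrite mulrCA.
  by rewrite -mulr_sumr o // mulr0.
have orthM i f : orth f -> orth (fun g => rho i g * f g).
  move=> o psi Spsi; rewrite -[RHS](o (psi + rho i)) ?SD //.
  apply: eq_bigr => g _; rewrite addrAC [in RHS]character_addE -mulrA.
  by rewrite mulrA.
have orth1 : orth (fun=> 1).
  move=> psi Spsi; under eq_bigr do rewrite mulr1; apply: char_sum0.
  by rewrite subr_eq0; apply: contraNneq nS => <-.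
have main (s : seq gT) : exists f, [/\ orth f, f 1%g = 1 &
    forall g, g \in s -> g != 1%g -> f g = 0].
  elim: s => [|h s [f [of' f1 fs]]]; first by exists (fun=> 1).
  have [-> |h1] := eqVneq h 1%g.
    exists f; split=> // g; rewrite inE => /orP[/eqP->|/fs//].
    by rewrite eqxx.
  have [i rhoi] : exists i, rho i h != 1.
    apply/existsP; apply: contraNT h1; rewrite negb_exists => /forallP e.
    by apply/eqP/sep => i; have := e i; rewrite negbK => /eqP.
  have nz : 1 - rho i h != 0 by rewrite subr_eq0 eq_sym.
  exists (fun g => (1 - rho i h)^-1 * (rho i g * f g + (- rho i h) * f g)).
  split.
  - by apply/orthZ/orthD; [apply: orthM | apply: orthZ].
  - by rewrite Defs.char1 f1 !mulr1 mulVf.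
  move=> g; rewrite inE -mulrDl => /orP[/eqP->|gs] g1.
    by rewrite addrN mul0r mulr0.
  by rewrite fs // !mulr0.
have [f [of' f1 fs]] := main (enum gT).
have := of' 0 S0; rewrite (bigD1 1%g) // big1 => [|g g1].
  by rewrite Defs.char1 mul1r f1 /= addr0 => /eqP; rewrite oner_eq0.
by rewrite fs ?mem_enum // mulr0.
Qed.

End CharacterGroup.

Section Weights.
Variables (K : closedFieldType) (gT : finGroupType).
Variable rho : 'I_3 -> character K gT.
Local Notation char := (character K gT).

Definition weight (m : multinom 3) : char := \sum_i rho i *+ m i.

Lemma weight0 : weight mnm0 = 0.
Proof. by rewrite /weight big1 // => i _; rewrite mnm0E. Qed.

Lemma weightD m n : weight (mnm_add m n) = weight m + weight n.
Proof.
by rewrite -big_split; apply: eq_bigr => i _; rewrite mnmDE mulrnDr.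
Qed.

Lemma weight1 i : weight (mnm1 i) = rho i.
Proof.
rewrite /weight (bigD1 i) //= mnm1E eqxx big1 ?addr0 // => j /negPf ji.
by rewrite mnm1E eq_sym ji.
Qed.

Hypothesis sep : forall g, (forall i, rho i g = 1) -> g = 1%g.
Hypothesis sum_rho : \sum_i rho i = 0.

Lemma weight_surj chi : exists m, weight m = chi.
Proof.
suff : `[< exists m, weight m = chi >] by move/asboolP.
apply: (char_generated sep (S := fun chi => `[< exists m, weight m = chi >])).
  by apply/asboolP; exists mnm0; rewrite weight0.
move=> psi i /asboolP[m <-]; apply/asboolP.
by exists (mnm_add m (mnm1 i)); rewrite weightD weight1.
Qed.

(* The sum of the rho i is 0, so any monomial can be made prime to one
   variable without changing its weight. *)
Lemma weight_surj_avoid (i : 'I_3) chi :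
  exists m : multinom 3, m i = 0%N /\ weight m = chi.
Proof.
have [m <-] := weight_surj chi.
(* Here [rho i] is minus the sum of the other [rho j], and [- rho j] is [#|gT|.-1] times [rho j]. *)
exists (Multinom [tuple (if j == i then 0 else m j + m i * #|gT|.-1)%N | j < 3]).
rewrite mnmE eqxx; split=> //; rewrite /weight (bigD1 i) //= mnmE eqxx add0r.
rewrite (bigD1 i (P := xpredT)) //=.
have -> : rho i = - \sum_(j < 3 | j != i) rho j.
  by apply/eqP; rewrite -addr_eq0 -(bigD1 i (P := xpredT)) //= sum_rho.
rewrite mulNrn -sumrMnl -sumrN -big_split; apply: eq_bigr => j /negPf ji.
rewrite /= (mnmE _ j) ji mulrnDr addrC [(m i * _)%N]mulnC mulrnA -mulNrn.
congr (_ *+ _ + _).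
have := char_order (rho j); rewrite -[#|gT|]prednK ?card_gT_gt0 // mulrS.
by move/eqP; rewrite addrC addr_eq0 => /eqP ->.
Qed.

Lemma sum3E (V : nmodType) (F : 'I_3 -> V) :
  \sum_i F i = F (inord 0) + F (inord 1) + F (inord 2).
Proof.
by rewrite !big_ord_recr big_ord0 /= add0r; congr (F _ + F _ + F _);
  apply: val_inj; rewrite /= inordK.
Qed.

(** With [rho 2] eliminated by [sum_rho], this is the map from Z^2 onto the character group; its
    kernel is the lattice by which the plane is divided to give the torus. *)
Definition lattice_char (p q : int) : char :=
  rho (inord 0) *~ p + rho (inord 1) *~ q.

Lemma lattice_charD p q p' q' :
  lattice_char (p + p') (q + q') = lattice_char p q + lattice_char p' q'.
Proof. by rewrite /lattice_char !mulrzDr addrACA. Qed.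

Lemma lattice_charN p q : lattice_char (- p) (- q) = - lattice_char p q.
Proof. by rewrite /lattice_char !mulrNz opprD. Qed.

Lemma lattice_charMz p q k :
  lattice_char (p * k) (q * k) = lattice_char p q *~ k.
Proof. by rewrite /lattice_char !mulrzA mulrzDl. Qed.

Lemma lattice_char_surj chi : exists pq, lattice_char pq.1 pq.2 = chi.
Proof.
have [m [m2 <-]] := weight_surj_avoid (inord 2) chi.
exists (m (inord 0) : int, m (inord 1) : int).
by rewrite /weight sum3E m2 addr0.
Qed.

(* Hermite normal form of the lattice of relations *)
Lemma lattice_basis : exists (a d : nat) (b : int), [/\ (0 < a)%N, (0 < d)%N &
  forall p q : int, lattice_char p q = 0 <->
    exists k l : int, p = k * d%:Z + l * b /\ q = l * a%:Z].
Proof.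
(* The pair (d, 0) is the shortest relation on the first axis and (b, a) one of least positive
   height. The order of the group shows that both exist; division with remainder reduces every
   relation to them. *)
pose Pd d := (0 < d)%N && (lattice_char d 0 == 0).
have exd : exists d, Pd d.
  exists #|gT|; rewrite /Pd card_gT_gt0 /lattice_char addr0.
  exact/eqP/char_order.
pose Pa a := (0 < a)%N && `[< exists b : int, lattice_char b a = 0 >].
have exa : exists a, Pa a.
  exists #|gT|; rewrite /Pa card_gT_gt0; apply/asboolP; exists 0.
  by rewrite /lattice_char mulr0z add0r; exact: char_order.
case: (ex_minnP exd) => d /andP[d0 /eqP rd] dmin.
case: (ex_minnP exa) => a /andP[a0 /asboolP[b ra]] amin.
exists a, d, b; split=> // p q; split; last first.
  move=> [k [l [-> ->]]]; rewrite -[l * a%:Z]add0r lattice_charD.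
  rewrite -[0]/(0%Z) -[X in lattice_char _ X](mulr0 k) mulr0.
  rewrite -(mul0r k) [k * _]mulrC lattice_charMz rd mul0rz add0r.
  by rewrite ![l * _]mulrC lattice_charMz ra mul0rz.
move=> pq0; have aZ : a%:Z != 0 by lia.
have dZ : d%:Z != 0 by lia.

have e1 : lattice_char (p - (q %/ a)%Z * b) (q %% a)%Z = 0.
  have -> : (q %% a)%Z = q - (q %/ a)%Z * a by rewrite {2}(divz_eq q a); lia.
  rewrite lattice_charD lattice_charN pq0 add0r ![(q %/ a)%Z * _]mulrC.
  by rewrite lattice_charMz ra mul0rz oppr0.
have [r rE] : exists r : nat, (q %% a)%Z = r.
  by exists `|(q %% a)%Z|%N; rewrite gez0_abs // modz_ge0.
have r0 : r = 0%N.
  apply/eqP; apply: contraT; rewrite -lt0n => r0.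
  have := amin r; rewrite /Pa r0 /= => /(_ _)/wrap[].
    by apply/asboolP; exists (p - (q %/ a)%Z * b); rewrite -rE.
  have := ltz_pmod q (d := a%:Z); rewrite rE; lia.
move: e1; rewrite rE r0 => e1.
set p' := p - _ in e1.
have e2 : lattice_char (p' %% d)%Z 0 = 0.
  have -> : (p' %% d)%Z = p' - (p' %/ d)%Z * d by rewrite {2}(divz_eq p' d); lia.
  rewrite -{1}[0]addr0 -{2}oppr0 -(mul0r (p' %/ d)%Z) lattice_charD lattice_charN.
  rewrite {1}mul0r -[lattice_char p' 0]/(lattice_char p' 0%Z) e1 add0r.
  by rewrite [_ * d%:Z]mulrC lattice_charMz rd mul0rz oppr0.
have [s sE] : exists s : nat, (p' %% d)%Z = s.
  by exists `|(p' %% d)%Z|%N; rewrite gez0_abs // modz_ge0.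
have s0 : s = 0%N.
  apply/eqP; apply: contraT; rewrite -lt0n => s0.
  have := dmin s; rewrite /Pd s0 /= -sE e2 eqxx => /(_ isT).
  have := ltz_pmod p' (d := d%:Z); rewrite sE; lia.
exists (p' %/ d)%Z, (q %/ a)%Z; split.
  by have := divz_eq p' d; rewrite sE s0 /p'; lia.
by have := divz_eq q a; rewrite rE r0; lia.
Qed.

End Weights.

Lemma I3_cases (i : 'I_3) : [\/ i = inord 0, i = inord 1 | i = inord 2].
Proof.
by case: i => [[|[|[|//]]] hi]; [apply: Or31 | apply: Or32 | apply: Or33];
  apply: val_inj; rewrite /= inordK.
Qed.

Lemma I3_eq (i j : nat) : (i < 3)%N -> (j < 3)%N ->
  ((inord i : 'I_3) == inord j) = (i == j).
Proof. by move=> hi hj; rewrite -val_eqE /= !inordK. Qed.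

(** * Standard representatives of the triangular faces *)

Section Faces.
Variables (K : closedFieldType) (gT : finGroupType).
Variable rho : 'I_3 -> character K gT.
Local Notation char := (character K gT).
Local Notation i0 := (inord 0 : 'I_3).
Local Notation i1 := (inord 1 : 'I_3).
Local Notation i2 := (inord 2 : 'I_3).
Hypothesis sum_rho : \sum_i rho i = 0.

(* the representative starting with an arrow of type 0 *)
Definition std_word (s : bool) (chi : char) : 3.-tuple (mckay_arrow K gT) :=
  if s then [tuple (chi, i0); (chi + rho i0, i1); (chi + rho i0 + rho i1, i2)]
  else [tuple (chi, i0); (chi + rho i0, i2); (chi + rho i0 + rho i2, i1)].

Definition std_face (s : bool) (chi : char) : mckay_face rho :=
  \pi_(mckay_face rho) (chi, if s then 1%g else tperm i1 i2).

Lemma std_face_word s chi :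
  face_word rho (chi, if s then 1%g else tperm i1 i2) = std_word s chi.
Proof.
apply: val_inj; case: s; rewrite /= ?perm1 // tpermL tpermR tpermD //.
- by rewrite I3_eq.
- by rewrite I3_eq.
Qed.

Lemma perm3E (pi q : 'S_3) :
  pi i0 = q i0 -> pi i1 = q i1 -> pi i2 = q i2 -> pi = q.
Proof. by move=> e0 e1 e2; apply/permP => i; case: (I3_cases i) => ->. Qed.

(** Rotating a word composes the permutation with a 3-cycle, which is even; so up to rotation there
    are two permutations, one of each sign. *)
Lemma perm3_cases (pi : 'S_3) :
  exists k : 'I_3, let q := if odd_perm pi then tperm i1 i2 else 1%g in
  [/\ pi (inord (k %% 3)) = q i0, pi (inord (k.+1 %% 3)) = q i1 &
      pi (inord (k.+2 %% 3)) = q i2].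
Proof.
have n01 : (i0 == i1) = false by rewrite I3_eq.
have n02 : (i0 == i2) = false by rewrite I3_eq.
have n12 : (i1 == i2) = false by rewrite I3_eq.
have odd01 : odd_perm (tperm i0 i1) by rewrite odd_tperm n01.
have odd02 : odd_perm (tperm i0 i2) by rewrite odd_tperm n02.
have odd12 : odd_perm (tperm i1 i2) by rewrite odd_tperm n12.
have inj := @perm_inj _ pi.
have t12 : tperm i1 i2 i0 = i0 by rewrite tpermD // ?I3_eq.
have t02 : tperm i0 i2 i1 = i1 by rewrite tpermD // ?I3_eq.
have t01 : tperm i0 i1 i2 = i2 by rewrite tpermD // ?I3_eq.
have pe := (permM, tpermL, tpermR, perm1, t01, t02, t12).
case: (I3_cases (pi i0)) (I3_cases (pi i1)) (I3_cases (pi i2)) =>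
  e0 [] e1 [] e2;
  try (by move: (inj i0 i1) n01; rewrite e0 e1 => /(_ erefl)->; rewrite eqxx);
  try (by move: (inj i0 i2) n02; rewrite e0 e2 => /(_ erefl)->; rewrite eqxx);
  try (by move: (inj i1 i2) n12; rewrite e1 e2 => /(_ erefl)->; rewrite eqxx).
- have piE : pi = 1%g by apply: perm3E; rewrite ?e0 ?e1 ?e2 !pe.
  have -> : odd_perm pi = false by rewrite piE odd_perm1.
  by exists ord0; rewrite /= ?e0 ?e1 ?e2 !pe.
- have piE : pi = tperm i1 i2 by apply: perm3E; rewrite ?e0 ?e1 ?e2 !pe.
  have -> : odd_perm pi = true by rewrite piE odd12.
  by exists ord0; rewrite /= ?e0 ?e1 ?e2 !pe.
- have piE : pi = tperm i0 i1 by apply: perm3E; rewrite ?e0 ?e1 ?e2 !pe.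
  have -> : odd_perm pi = true by rewrite piE odd01.
  by exists i1; rewrite /= inordK //= ?e0 ?e1 ?e2 !pe.
- have piE : pi = (tperm i0 i1 * tperm i0 i2)%g by apply: perm3E; rewrite ?e0 ?e1 ?e2 !pe.
  have -> : odd_perm pi = false by rewrite piE odd_permM odd01 odd02.
  by exists i2; rewrite /= inordK //= ?e0 ?e1 ?e2 !pe.
- have piE : pi = (tperm i0 i2 * tperm i0 i1)%g by apply: perm3E; rewrite ?e0 ?e1 ?e2 !pe.
  have -> : odd_perm pi = false by rewrite piE odd_permM odd01 odd02.
  by exists i1; rewrite /= inordK //= ?e0 ?e1 ?e2 !pe.
- have piE : pi = tperm i0 i2 by apply: perm3E; rewrite ?e0 ?e1 ?e2 !pe.
  have -> : odd_perm pi = true by rewrite piE odd02.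
  by exists i2; rewrite /= inordK //= ?e0 ?e1 ?e2 !pe.
Qed.

Lemma sum_rho3 : rho i0 + rho i1 + rho i2 = 0.
Proof. by rewrite -sum_rho sum3E. Qed.

(** The rotation that brings the arrow of type 0 to the front moves the base vertex along the cycle;
    the words match because the cycle closes, that is, because the [rho i] sum to 0. *)
Lemma face_word_std (x : char * 'S_3) :
  exists (k : 'I_3) (chi : char),
    rot k (face_word rho x) = std_word (~~ odd_perm x.2) chi.
Proof.
case: x => chi pi /=; have [k] := perm3_cases pi.
have := std_face_word (~~ odd_perm pi); rewrite if_neg.
move: (if odd_perm pi then _ else _) => q stdq [e0 e1 e2].
have sumq : rho (q i0) + rho (q i1) + rho (q i2) = 0.
  by rewrite -sum_rho (reindex_inj (@perm_inj _ q)) sum3E.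
exists k; case: (I3_cases k) e0 e1 e2 => -> /=; rewrite inordK //= => e0 e1 e2.
- by exists chi; rewrite -stdq /= e0 e1 e2.
- exists (chi + rho (pi i0)); rewrite -stdq /= e0 e1 e2 /=.
  have {1}-> : chi = chi + rho (pi i0) + rho (q i0) + rho (q i1).
    by rewrite -!addrA [rho _ + (_ + _)]addrC e2 sumq addr0.
  by rewrite e2.
exists (chi + rho (pi i0) + rho (pi i1)); rewrite -stdq /= e0 e1 e2 /=.
have {1 2}-> : chi = chi + rho (pi i0) + rho (pi i1) + rho (q i0).
  rewrite -!addrA [X in chi + X](_ : _ = 0) ?addr0 // -sumq e1 e2.
  by rewrite addrA addrC addrA.
by rewrite e1 e2.
Qed.

(** Faces are thus parametrized by a sign and a character. The boundary is read from the
    representative chosen by [repr], which leaves an unknown rotation [k]. *)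
Lemma mckay_face_std (F : mckay_face rho) :
  exists (s : bool) (chi : char) (k : 'I_3), [/\ F = std_face s chi,
    ~~ odd_perm (repr F).2 = s & mckay_boundary F = rot k (std_word s chi) :> seq _].
Proof.
have [k [chi e]] := face_word_std (repr F).
exists (~~ odd_perm (repr F).2), chi, (inord ((3 - k) %% 3)).
split=> //.
- rewrite -[F]reprK; apply/eqmodP/existsP; exists k; apply/eqP.
  by rewrite std_face_word reprK.
- rewrite -e /mckay_boundary inordK ?ltn_mod //.
  by case: (face_word _ _) => [] [|a [|b [|c []]]] //= _; case: k {e} => [] [|[|[|k]]].
Qed.

(** A standard word contains exactly one arrow of type 0 and begins with it, so only the trivial
    rotation can relate two of them; the type of the second arrow then reveals the sign. *)
Lemma std_face_inj s chi s' chi' :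
  std_face s chi = std_face s' chi' -> s = s' /\ chi = chi'.
Proof.
move=> /eqmodP/existsP[k /eqP]; rewrite !std_face_word.
have nthE n w w' : w = w' :> seq (mckay_arrow K gT) ->
    nth (chi, i0) w n = nth (chi, i0) w' n by move->.
have [->|->|->] := I3_cases k; rewrite inordK // => e;
  have /= e0 := congr1 fst (nthE 0%N _ _ e); have := congr1 snd (nthE 0%N _ _ e);
  have := congr1 snd (nthE 1%N _ _ e); clear e nthE;
  case: s e0; case: s' => /= e0 /eqP; rewrite ?I3_eq //.
- by move=> _ /eqP; rewrite I3_eq.
- by move=> _ /eqP; rewrite I3_eq.
Qed.

End Faces.

(** * The potential algebra *)

Section CyclicDerivative.
Variables (K : comNzRingType) (Q : quiver_with_faces).
Local Notation pa := (path_algebra K Q).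

Lemma cyclic_derivativeD a (x y : pa) :
  cyclic_derivative a (x + y) = cyclic_derivative a x + cyclic_derivative a y.
Proof. exact: pa_lextD. Qed.

Lemma cyclic_derivative0 a : cyclic_derivative a (0 : pa) = 0.
Proof. exact: pa_lext0. Qed.

Lemma cyclic_derivativeN a (x : pa) :
  cyclic_derivative a (- x) = - cyclic_derivative a x.
Proof.
apply/eqP; rewrite -addr_eq0 -cyclic_derivativeD addNr.
by rewrite cyclic_derivative0.
Qed.

Lemma cyclic_derivative_sum a (I : finType) (P : pred I) (F : I -> pa) :
  cyclic_derivative a (\sum_(i | P i) F i) =
  \sum_(i | P i) cyclic_derivative a (F i).
Proof.
by apply: big_morph => [x y|]; [apply: cyclic_derivativeD|apply: cyclic_derivative0].
Qed.

Lemma cyclic_derivative_cycle3 (a x y z : arrow Q) :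
  src x = tgt y -> src y = tgt z -> src z = tgt x ->
  cyclic_derivative a (cycle_elt K [:: x; y; z]) =
  (if x == a then word_elt K (src a) [:: y; z] else 0) +
  (if y == a then word_elt K (src a) [:: z; x] else 0) +
  (if z == a then word_elt K (src a) [:: x; y] else 0).
Proof.
move=> xy yz zx; have c : composable (tgt x) [:: x; y; z].
  by rewrite /= xy yz !eqxx.
rewrite /cycle_elt -[tgt x]/(ptgt (exist _ (tgt x, [:: x; y; z]) c : qpath Q)).
rewrite -[[:: x; y; z]]/(pword (exist _ (tgt x, [:: x; y; z]) c : qpath Q)).
rewrite word_eltE /cyclic_derivative path_elt.unlock lextU /path_derivative.
rewrite /psrc /ptgt /pword /= zx eqxx big_mkcond !big_ord_recr big_ord0 /=.
by rewrite add0r !(inj_eq Some_inj).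
Qed.

End CyclicDerivative.

Section PathWords.
Variables (K : comNzRingType) (Q : quiver_with_faces).
Local Notation pa := (path_algebra K Q).

Lemma word_elt_composable (v : vertex Q) (s : seq (arrow Q)) (c : composable v s) :
  word_elt K v s = path_elt K (exist _ (v, s) c : qpath Q).
Proof. by rewrite -word_eltE. Qed.

Lemma word_elt0 (v : vertex Q) (s : seq (arrow Q)) :
  ~~ composable v s -> word_elt K v s = 0.
Proof. by move=> c; rewrite /word_elt insubF // (negPf c). Qed.

Lemma word_eltM (v : vertex Q) (s t : seq (arrow Q)) :
  word_elt K v s * word_elt K (last v (map (@src Q) s)) t = word_elt K v (s ++ t).
Proof.
have [cs|cs] := boolP (composable v s); last first.
  by rewrite (word_elt0 cs) mul0r word_elt0 // composable_cat negb_and cs.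
have [ct|ct] := boolP (composable (last v (map (@src Q) s)) t); last first.
  by rewrite (word_elt0 ct) mulr0 word_elt0 // composable_cat negb_and ct orbT.
rewrite (word_elt_composable cs) (word_elt_composable ct).
by rewrite -[LHS]/(pa_mul _ _) pa_mulEE /path_mul eqxx.
Qed.

Lemma word_eltM0 (v w : vertex Q) (s t : seq (arrow Q)) :
  last v (map (@src Q) s) != w -> word_elt K v s * word_elt K w t = 0.
Proof.
move=> vw; have [cs|cs] := boolP (composable v s); last by rewrite word_elt0 ?mul0r.
have [ct|ct] := boolP (composable w t); last by rewrite [X in _ * X]word_elt0 ?mulr0.
rewrite (word_elt_composable cs) (word_elt_composable ct).
by rewrite -[LHS]/(pa_mul _ _) pa_mulEE path_mulN.
Qed.

Lemma pa_scaleAl c (x y : pa) : c *: x * y = c *: (x * y).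
Proof. exact: pa_mulZl. Qed.

Lemma pa_scaleAr c (x y : pa) : x * (c *: y) = c *: (x * y).
Proof. exact: pa_mulZr. Qed.

Lemma sum_word_elt_nil : \sum_v word_elt K v [::] = 1 :> pa.
Proof. by []. Qed.

End PathWords.

(** * The relations of the McKay potential *)

Section PotentialRelations.
Variables (K : closedFieldType) (gT : finGroupType).
Variable rho : 'I_3 -> character K gT.
Local Notation char := (character K gT).
Local Notation i0 := (inord 0 : 'I_3).
Local Notation i1 := (inord 1 : 'I_3).
Local Notation i2 := (inord 2 : 'I_3).
Local Notation Q := (mckay_quiver rho).
Local Notation pa := (path_algebra K Q).
Hypothesis sum_rho : \sum_i rho i = 0.

Definition commutation chi (j k : 'I_3) : pa :=
  word_elt K (chi : vertex Q) ([:: (chi, j); (chi + rho j, k)] : seq (arrow Q)) -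
  word_elt K (chi : vertex Q) ([:: (chi, k); (chi + rho k, j)] : seq (arrow Q)).

(** Makes the derivatives of the potential independent of the unknown rotation in
    [mckay_face_std]. *)
Lemma cyclic_derivative_rot3 a (x y z : arrow Q) (k : 'I_3) :
  src x = tgt y -> src y = tgt z -> src z = tgt x ->
  cyclic_derivative a (cycle_elt K (rot k [:: x; y; z])) =
  cyclic_derivative a (cycle_elt K [:: x; y; z]).
Proof.
move=> xy yz zx; have [->|->|->] := I3_cases k; (rewrite [nat_of_ord _]inordK; last by []).
- by rewrite rot0.
- rewrite -[rot 1 _]/[:: y; z; x].
  rewrite (cyclic_derivative_cycle3 K a yz zx xy) (cyclic_derivative_cycle3 K a xy yz zx).
  by rewrite addrC addrA.
rewrite -[rot 2 _]/[:: z; x; y].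
rewrite (cyclic_derivative_cycle3 K a zx xy yz) (cyclic_derivative_cycle3 K a xy yz zx).
by rewrite -addrA addrC.
Qed.

Lemma addr_rho3 (chi : char) : chi + rho i0 + rho i1 + rho i2 = chi.
Proof. by rewrite -!addrA [rho i0 + _]addrA sum_rho3 ?addr0. Qed.

Lemma addr_rho3' (chi : char) : chi + rho i0 + rho i2 + rho i1 = chi.
Proof. by rewrite -addrA [rho i2 + _]addrC addrA addr_rho3. Qed.

Lemma cyclic_derivative_face a s chi :
  cyclic_derivative a (cycle_elt K (boundary (std_face rho s chi : face Q))) =
  cyclic_derivative a (cycle_elt K (std_word rho s chi : seq (arrow Q))).
Proof.
have [s' [chi' [k [/std_face_inj [<- <-] _ e]]]] :=
  mckay_face_std sum_rho (std_face rho s chi).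
rewrite /boundary /= e; case: s {e}; apply: cyclic_derivative_rot3 => //=.
  exact: addr_rho3.
exact: addr_rho3'.
Qed.

(** Inverse of [std_face rho s] on the faces of sign [s]; faces of the other sign get the default
    value 0. *)
Definition face_corner s (F : mckay_face rho) : char :=
  odflt 0 [pick chi | std_face rho s chi == F].

Lemma face_cornerK s : cancel (std_face rho s) (face_corner s).
Proof.
move=> chi; rewrite /face_corner; case: pickP => [psi /eqP/std_face_inj[]//|].
by move=> /(_ chi); rewrite eqxx.
Qed.

Lemma std_face_positive s chi :
  positive (std_face rho s chi : face Q) = s.
Proof.
have [s' [chi' [k [/std_face_inj [<- <-] e _]]]] :=
  mckay_face_std sum_rho (std_face rho s chi).
exact: e.
Qed.

Lemma face_cornerKV F : std_face rho (@positive Q F) (face_corner (@positive Q F) F) = F.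
Proof.
have [s [chi [k [-> _ _]]]] := mckay_face_std sum_rho F.
by rewrite std_face_positive face_cornerK.
Qed.

Lemma sum_faces s (V : nmodType) (f : mckay_face rho -> V) :
  \sum_(F | @positive Q F == s) f F = \sum_chi f (std_face rho s chi).
Proof.
rewrite (reindex (std_face rho s)).
  by apply: eq_bigl => chi; rewrite std_face_positive eqxx.
exists (face_corner s) => [chi _|F]; first exact: face_cornerK.
by rewrite inE => /eqP <-; apply: face_cornerKV.
Qed.

Lemma sum_arrow (V : zmodType) (t : char) (p i : 'I_3) (c : char) (f : char -> V) :
  \sum_chi (if (chi + t, p) == (c, i) then f chi else 0) =
  if p == i then f (c - t) else 0.
Proof.
have [->|pi] := eqVneq p i; last first.
  by rewrite big1 // => chi _; rewrite xpair_eqE (negPf pi) andbF.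
rewrite (bigD1 (c - t)) //= subrK eqxx big1 ?addr0 // => chi ne.
rewrite xpair_eqE eqxx andbT ifN //; apply: contraNneq ne => <-.
by rewrite addrK.
Qed.

(** Every arrow lies on exactly one face of each sign, so a single term survives: the other two
    arrows of that face. Their types follow [i] in the cyclic order 0, 1, 2 on positive faces and in
    the opposite order on negative ones. *)
Lemma std_word_derivative s (c : char) (i : 'I_3) :
  \sum_chi cyclic_derivative (Q := Q) (c, i) (cycle_elt K (std_word rho s chi : seq (arrow Q))) =
  let j := if s then ordS i else ordS (ordS i) in
  let k := if s then ordS (ordS i) else ordS i in
  word_elt K (c + rho i : vertex Q)
    ([:: (c + rho i, j); (c + rho i + rho j, k)] : seq (arrow Q)).
Proof.
have SE (m n : nat) : (m < 3)%N -> n = (m.+1 %% 3)%N -> ordS (inord m : 'I_3) = inord n.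
  by move=> hm ->; apply: val_inj; rewrite /= !inordK // ltn_mod.
have S0 := SE 0%N 1%N isT erefl; have S1 := SE 1%N 2%N isT erefl.
have S2 := SE 2%N 0%N isT erefl.
have der3 chi : cyclic_derivative (Q := Q) (c, i) (cycle_elt K (std_word rho s chi : seq (arrow
  Q))) =
  let p := if s then i1 else i2 in let q := if s then i2 else i1 in
  let w a b : pa := word_elt K (c + rho i : vertex Q) ([:: a; b] : seq (arrow Q)) in
  (if (chi + 0, i0) == (c, i) then w (chi + rho i0, p) (chi + rho i0 + rho p, q) else 0) +
  (if (chi + rho i0, p) == (c, i) then w (chi + rho i0 + rho p, q) (chi, i0) else 0) +
  (if (chi + (rho i0 + rho p), q) == (c, i) then w (chi, i0) (chi + rho i0, p) else 0).
  rewrite /= addr0 addrA; case: s; apply: cyclic_derivative_cycle3 => //=.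
    exact: addr_rho3.
  exact: addr_rho3'.
under eq_bigr => chi _ do rewrite der3.
rewrite /= big_split /= big_split /= !sum_arrow subr0.
have sub_rho p q r : rho p + rho q + rho r = 0 -> c - rho p = c + rho q + rho r.
  move=> pqr; apply/eqP; rewrite subr_eq -addrA -addrA [rho r + _]addrC.
  by rewrite [rho q + _]addrCA [rho p + _]addrA pqr addr0.
have sub_rho2 p q r : rho p + rho q + rho r = 0 -> c - (rho p + rho q) = c + rho r.
  move=> pqr; apply/eqP; rewrite subr_eq -addrA [rho r + _]addrC.
  by rewrite pqr addr0.
have s012 : rho i0 + rho i1 + rho i2 = 0 by apply: sum_rho3.
have s021 : rho i0 + rho i2 + rho i1 = 0 by rewrite addrAC.
have s201 : rho i2 + rho i0 + rho i1 = 0 by rewrite addrAC addrC addrA.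
have s102 : rho i1 + rho i0 + rho i2 = 0 by rewrite [rho i1 + _]addrC.
case: s {der3}; case: (I3_cases i) => ->; rewrite !I3_eq //= ?addr0 ?add0r ?S0 ?S1 ?S2.
- by [].
- by rewrite subrK (sub_rho _ _ _ s012).
- by rewrite S0 (sub_rho2 _ _ _ s012).
- by [].
- by rewrite (sub_rho2 _ _ _ s021).
- by rewrite S0 subrK (sub_rho _ _ _ s021).
Qed.

Lemma cyclic_derivative_potential (a : arrow Q) :
  cyclic_derivative a (potential K Q) =
  commutation (a.1 + rho a.2) (ordS a.2) (ordS (ordS a.2)).
Proof.
case: a => c i; rewrite /potential.
rewrite (eq_bigl (fun F => @positive Q F == true)); last by move=> F; case: positive.
rewrite [X in _ - X](eq_bigl (fun F => @positive Q F == false)); last first.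
  by move=> F; case: positive.
rewrite cyclic_derivativeD cyclic_derivativeN !cyclic_derivative_sum !sum_faces.
under eq_bigr do rewrite cyclic_derivative_face.
under [X in _ - X]eq_bigr do rewrite cyclic_derivative_face.
by rewrite !std_word_derivative.
Qed.

Local Notation A := (potential_algebra K Q).

Definition qp (x : pa) : A := \pi_A x.

Lemma qpD x y : qp (x + y) = qp x + qp y.
Proof. by rewrite [RHS]rq_addE. Qed.

Lemma qpM x y : qp (x * y) = qp x * qp y.
Proof. by rewrite [RHS]rq_mulE. Qed.

Lemma qp1 : qp 1 = 1. Proof. by []. Qed.

Lemma qp0 : qp 0 = 0.
Proof. by apply: (addIr (qp 0)); rewrite -qpD !add0r. Qed.

Lemma qpN x : qp (- x) = - qp x.
Proof. by apply/eqP; rewrite -addr_eq0 -qpD addNr qp0. Qed.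

Lemma qp_sum (I : Type) (r : seq I) (P : pred I) (F : I -> pa) :
  qp (\sum_(i <- r | P i) F i) = \sum_(i <- r | P i) qp (F i).
Proof. by apply: big_morph; [apply: qpD | apply: qp0]. Qed.

Lemma qp_ind (P : A -> Prop) : (forall x, P (qp x)) -> forall a, P a.
Proof. by move=> h a; rewrite -[a]reprK; apply: h. Qed.

Definition scal (c : K) : A := qp (c *: (1 : pa)).

Lemma scal_qp c x : scal c * qp x = qp (c *: x).
Proof. by rewrite -qpM pa_scaleAl mul1r. Qed.

Lemma scalC c a : scal c * a = a * scal c.
Proof.
by elim/qp_ind: a => x; rewrite scal_qp -qpM pa_scaleAr mulr1.
Qed.

Lemma scalD c d : scal (c + d) = scal c + scal d.
Proof. by rewrite -qpD -scalerDl. Qed.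

Lemma scalM c d : scal (c * d) = scal c * scal d.
Proof. by rewrite scal_qp scalerA. Qed.

Lemma scal1 : scal 1 = 1.
Proof. by rewrite /scal scale1r. Qed.

Lemma scal0 : scal 0 = 0.
Proof. by rewrite /scal scale0r qp0. Qed.

Lemma scalN c : scal (- c) = - scal c.
Proof. by rewrite /scal scaleNr qpN. Qed.

Definition idA (chi : char) : A := qp (word_elt K (chi : vertex Q) [::]).
Definition arrA (chi : char) (i : 'I_3) : A :=
  qp (word_elt K (chi : vertex Q) ([:: (chi, i)] : seq (arrow Q))).
(** With the idempotents [idA chi] these sums of arrows present the algebra as a skew group algebra:
    polynomials in three commuting variables, which move the idempotents by the [rho i]. *)
Definition varA (i : 'I_3) : A := \sum_chi arrA chi i.

Lemma sum_idA : \sum_chi idA chi = 1.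
Proof. by rewrite -qp_sum -qp1 -sum_word_elt_nil. Qed.

Lemma idA_mul chi psi : idA chi * idA psi = if chi == psi then idA chi else 0.
Proof.
rewrite -qpM; case: eqP => [<-|/eqP ne]; first by rewrite word_eltM.
by rewrite word_eltM0 ?qp0.
Qed.

Lemma idA_arr chi psi i : idA chi * arrA psi i = if chi == psi then arrA psi i else 0.
Proof.
rewrite -qpM; case: eqP => [<-|/eqP ne]; first by rewrite word_eltM.
by rewrite word_eltM0 ?qp0.
Qed.

Lemma arr_idA chi psi i : arrA psi i * idA chi = if psi + rho i == chi then arrA psi i else 0.
Proof.
rewrite -qpM; case: eqP => [<-|/eqP ne].
  by rewrite -[psi + rho i]/(last psi (map (@src Q) [:: (psi, i)])) word_eltM.
by rewrite word_eltM0 ?qp0.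
Qed.

Lemma idA_var chi i : idA chi * varA i = arrA chi i.
Proof.
rewrite mulr_sumr (bigD1 chi) //= idA_arr eqxx big1 ?addr0 // => psi ne.
by rewrite idA_arr eq_sym (negPf ne).
Qed.

Lemma var_idA chi i : varA i * idA (chi + rho i) = arrA chi i.
Proof.
rewrite mulr_suml (bigD1 chi) //= arr_idA eqxx big1 ?addr0 // => psi ne.
by rewrite arr_idA (inj_eq (addIr _)) (negPf ne).
Qed.

Lemma idA_varC chi i : idA chi * varA i = varA i * idA (chi + rho i).
Proof. by rewrite idA_var var_idA. Qed.

Lemma qp_word (v : char) (s : seq (arrow Q)) :
  qp (word_elt K (v : vertex Q) s) =
  if composable (v : vertex Q) s then idA v * \prod_(a <- s) varA a.2 else 0.
Proof.
case: ifP => [|/negbT c]; last by rewrite word_elt0 ?qp0.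
elim: s v => [|[chi i] s IHs] v; first by rewrite big_nil mulr1.
move=> /= /andP[/eqP <- c]; rewrite big_cons mulrA idA_var.
rewrite -[(chi, i) :: s]/([:: (chi, i)] ++ s) -word_eltM qpM.
rewrite -[last _ _]/(chi + rho i) IHs // mulrA; congr (_ * _).
by rewrite -/(arrA chi i) arr_idA eqxx.
Qed.

(** Cut down by the idempotents, the commutator of two types splits into the derivatives of the
    potential along the arrows of the third type. *)
Lemma varC i j : varA i * varA j = varA j * varA i.
Proof.
suff main : forall k, varA (ordS k) * varA (ordS (ordS k)) =
    varA (ordS (ordS k)) * varA (ordS k).
  have SE (m n : nat) : (m < 3)%N -> n = (m.+1 %% 3)%N -> ordS (inord m : 'I_3) = inord n.
    by move=> hm ->; apply: val_inj; rewrite /= !inordK // ltn_mod.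
  have S0 := SE 0%N 1%N isT erefl; have S1 := SE 1%N 2%N isT erefl.
  have S2 := SE 2%N 0%N isT erefl.
  have := (main i0, main i1, main i2); rewrite !(S0, S1, S2) => -[[e0 e1] e2].
  by case: (I3_cases i) => ->; case: (I3_cases j) => ->.
move=> k; apply/eqP; rewrite -subr_eq0; apply/eqP.
rewrite -[LHS]mul1r -sum_idA mulr_suml big1 // => chi _.
have comm : qp (commutation chi (ordS k) (ordS (ordS k))) = 0.
  have := cyclic_derivative_potential (chi - rho k, k).
  rewrite /= subrK => <-; rewrite -qp0; apply/rq_eq; rewrite subr0.
  apply/asboolP; exists [:: (1, cyclic_derivative ((chi - rho k, k) : arrow Q) (potential K Q), 1)].
  split; last by rewrite big_seq1 /= mul1r mulr1.
  by move=> t; rewrite inE => /eqP -> /=; exists (chi - rho k, k).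
have cE j1 j2 : qp (word_elt K (chi : vertex Q)
    ([:: (chi, j1); (chi + rho j1, j2)] : seq (arrow Q))) =
    idA chi * (varA j1 * varA j2).
  by rewrite qp_word /= !eqxx !big_cons big_nil mulr1.
by rewrite mulrBr -!cE -qpN -qpD.
Qed.

Definition monA (m : multinom 3) : A := \prod_(i < 3) varA i ^+ m i.

Lemma comm_var_mon i m : GRing.comm (varA i) (monA m).
Proof. by apply: commr_prod => j _; apply: commrX; apply: varC. Qed.

Lemma monA0 : monA mnm0 = 1.
Proof. by rewrite /monA big1 // => i _; rewrite mnm0E. Qed.

Lemma monAE m : monA m = varA i0 ^+ m i0 * varA i1 ^+ m i1 * varA i2 ^+ m i2.
Proof.
rewrite /monA !big_ord_recr big_ord0 /= mul1r.
by congr (varA _ ^+ m _ * varA _ ^+ m _ * varA _ ^+ m _); apply: val_inj;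
  rewrite /= inordK.
Qed.

Lemma monA1 i m : monA (mnm_add (mnm1 i) m) = varA i * monA m.
Proof.
rewrite !monAE !mnmDE !mnm1E.
have c a b n : varA a ^+ n * varA b = varA b * varA a ^+ n.
  by apply/esym/commrX/varC.
case: (I3_cases i) => ->; rewrite !I3_eq //= ?add0n ?add1n ?exprS.
- by rewrite !mulrA.
- by rewrite !mulrA c.
- by rewrite !mulrA -[_ * _ * varA i2]mulrA c mulrA c.
Qed.

Lemma idA_varX chi i n : idA chi * varA i ^+ n = varA i ^+ n * idA (chi + rho i *+ n).
Proof.
elim: n chi => [|n IHn] chi; first by rewrite mulr1 mul1r addr0.
by rewrite exprS mulrA idA_varC -mulrA IHn mulrA mulrS addrA.
Qed.

Lemma idA_mon chi m : idA chi * monA m = monA m * idA (chi + weight rho m).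
Proof.
rewrite !monAE /weight sum3E !mulrA idA_varX -(mulrA (varA i0 ^+ _)) idA_varX.
rewrite -!mulrA; congr (_ * (_ * _)); rewrite idA_varX; congr (_ * idA _).
by rewrite !addrA.
Qed.

(** By [qp_word] a path becomes an idempotent times a product of commuting variables, so the
    elements [idA chi * monA m] span over the scalars. Their independence is established in the
    proof of [alg_faithful]. *)
Lemma potential_algebra_ind (S : A -> Prop) : S 0 ->
  (forall a b, S a -> S b -> S (a + b)) -> (forall c a, S a -> S (scal c * a)) ->
  (forall chi m, S (idA chi * monA m)) -> forall a, S a.
Proof.
move=> S0 SD SZ Sm; elim/qp_ind; elim/pa_ind => [|x y|c x|p].
- by rewrite qp0.
- by rewrite qpD; apply: SD.
- by rewrite -scal_qp; apply: SZ.
rewrite -word_eltE qp_word; case: ifP => // _.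
suff [m ->] : exists m, \prod_(a <- pword p) varA a.2 = monA m by apply: Sm.
elim: (pword p) => [|a s [m e]]; first by exists mnm0; rewrite big_nil monA0.
by exists (mnm_add (mnm1 a.2) m); rewrite big_cons monA1 e.
Qed.

Lemma potential_algebra_gen (S : A -> Prop) :
  (forall a b, S a -> S b -> S (a + b)) -> (forall a b, S a -> S b -> S (a * b)) ->
  (forall c, S (scal c)) -> (forall chi, S (idA chi)) -> (forall i, S (varA i)) ->
  forall a, S a.
Proof.
move=> SD SM SZ Si Sv; apply: potential_algebra_ind => [||c a Sa|chi m] //.
- by rewrite -scal0.
- by apply: SM.
apply: (SM); first exact: Si.
have SX i n : S (varA i ^+ n).
  by elim: n => [|n IHn]; rewrite ?expr0 -?scal1 // exprS; apply: SM.
by rewrite monAE; do 2?[apply: (SM) => //].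
Qed.

End PotentialRelations.

Definition linear_of (R : pzRingType) (M N : lmodType R) (f : M -> N) (lf : linear f) :
  {linear M -> N} := HB.pack f (GRing.isLinear.Build R M N _ f lf).

(** * Modules given by graded commuting operators *)

Section UniversalProperty.
Variables (K : closedFieldType) (gT : finGroupType).
Variable rho : 'I_3 -> character K gT.
Local Notation char := (character K gT).
Local Notation Q := (mckay_quiver rho).
Local Notation pa := (path_algebra K Q).
Local Notation A := (potential_algebra K Q).

(* By the relations, an A-module is a K-module with such operators. *)
Record mckay_ops (V : lmodType K) := McKayOps {
  op_id : char -> V -> V;
  op_var : 'I_3 -> V -> V;
  op_idP : forall chi, linear (op_id chi);
  op_varP : forall i, linear (op_var i);
  op_idM : forall chi psi v,
    op_id chi (op_id psi v) = if chi == psi then op_id chi v else 0;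
  op_id_sum : forall v, \sum_chi op_id chi v = v;
  op_id_var : forall chi i v,
    op_id chi (op_var i v) = op_var i (op_id (chi + rho i) v);
  op_varC : forall i j v, op_var i (op_var j v) = op_var j (op_var i v)
}.

Section Action.
Hypothesis sum_rho : \sum_i rho i = 0.
Variables (V : lmodType K) (o : mckay_ops V).

HB.instance Definition _ chi :=
  GRing.Linear.copy (op_id o chi) (linear_of (op_idP o chi)).
HB.instance Definition _ i :=
  GRing.Linear.copy (op_var o i) (linear_of (op_varP o i)).

Definition word_act (s : seq (arrow Q)) (v : V) : V :=
  foldr (fun a w => op_var o a.2 w) v s.

(** [word_act] forgets the vertices of the path. Projecting to the target restores all of them,
    since [op_id_word] carries the projection through the word to the source. *)
Definition path_act (p : qpath Q) (v : V) : V :=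
  op_id o (ptgt p) (word_act (pword p) v).

Lemma word_act_linear s : linear (word_act s).
Proof. by elim: s => [|a s IHs] c u v //=; rewrite IHs linearP. Qed.

Lemma path_act_linear p : linear (path_act p).
Proof. by move=> c u v; rewrite /path_act word_act_linear linearP. Qed.

Lemma op_id_word (t : char) (s : seq (arrow Q)) v : composable (t : vertex Q) s ->
  op_id o t (word_act s v) =
  word_act s (op_id o (last (t : vertex Q) (map (@src Q) s)) v).
Proof.
elim: s t => [|[chi i] s IHs] t //= /andP[/eqP <- c].
by rewrite op_id_var; congr (op_var o i _); apply: IHs c.
Qed.

Definition pa_act (x : pa) (v : V) : V := lext (fun p => path_act p v) x.

Lemma pa_actD x y v : pa_act (x + y) v = pa_act x v + pa_act y v.
Proof. exact: pa_lextD. Qed.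

Lemma pa_actZ c x v : pa_act (c *: x) v = c *: pa_act x v.
Proof. exact: pa_lextZ. Qed.

Lemma pa_act0 v : pa_act 0 v = 0.
Proof. exact: pa_lext0. Qed.

Lemma pa_act_path p v : pa_act (path_elt K p) v = path_act p v.
Proof. by rewrite /pa_act path_elt.unlock lextU. Qed.

Lemma pa_act_word (t : char) (s : seq (arrow Q)) v :
  pa_act (word_elt K (t : vertex Q) s) v =
  if composable (t : vertex Q) s then op_id o t (word_act s v) else 0.
Proof.
case: ifP => [c|/negbT c]; last by rewrite word_elt0 // pa_act0.
by rewrite (word_elt_composable _ c) pa_act_path.
Qed.

Lemma pa_act_linear x : linear (pa_act x).
Proof.
move=> c u v; elim/pa_ind: x => [|x y IHx IHy|d x IHx|p].
- by rewrite !pa_act0 scaler0 addr0.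
- by rewrite !pa_actD IHx IHy scalerDr addrACA.
- by rewrite !pa_actZ IHx scalerDr !scalerA mulrC.
- by rewrite !pa_act_path path_act_linear.
Qed.

HB.instance Definition _ x :=
  GRing.Linear.copy (pa_act x) (linear_of (pa_act_linear x)).

Lemma pa_actM x y v : pa_act (x * y) v = pa_act x (pa_act y v).
Proof.
elim/pa_ind: x => [|x x' IHx IHx'|c x IHx|p].
- by rewrite mul0r !pa_act0.
- by rewrite mulrDl !pa_actD IHx IHx'.
- by rewrite pa_scaleAl !pa_actZ IHx.
elim/pa_ind: y => [|y y' IHy IHy'|c y IHy|q].
- by rewrite mulr0 !pa_act0 linear0.
- by rewrite mulrDr !pa_actD linearD IHy IHy'.
- by rewrite pa_scaleAr !pa_actZ linearZ IHy.
rewrite -!word_eltE.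
have cp : composable (ptgt p) (pword p) := valP p.
have cq : composable (ptgt q) (pword q) := valP q.
have [pq|pq] := eqVneq (psrc p) (ptgt q).
  rewrite -{1}pq word_eltM !pa_act_word composable_cat cp cq -/(psrc p) pq cq /=.
  rewrite [word_act (_ ++ _) _]foldr_cat -/(word_act _ _) -/(word_act _ _).
  by rewrite !(op_id_word _ cp) -/(psrc p) pq op_idM eqxx.
rewrite word_eltM0 // pa_act0 !pa_act_word cp cq op_id_word // -/(psrc p).
by rewrite op_idM (negPf pq) -[0]/(0 : V) (_ : word_act _ 0 = 0) //;
  elim: (pword p) => //= a s ->; rewrite linear0.
Qed.

Lemma pa_act1 v : pa_act 1 v = v.
Proof.
rewrite -sum_word_elt_nil (big_morph (pa_act^~ v) (fun x y => pa_actD x y v) (pa_act0 v)).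
by rewrite -[RHS](op_id_sum o); apply: eq_bigr => chi _; rewrite pa_act_word.
Qed.

Lemma pa_actN x v : pa_act (- x) v = - pa_act x v.
Proof. by apply/eqP; rewrite -addr_eq0 -pa_actD addNr pa_act0. Qed.

Lemma pa_act_relation a v :
  pa_act (cyclic_derivative a (potential K Q)) v = 0.
Proof.
rewrite cyclic_derivative_potential // /commutation pa_actD pa_actN !pa_act_word.
by rewrite /= !eqxx /= op_varC addrN.
Qed.

Lemma pa_act_ideal (x : pa) v :
  x \in two_sided_ideal [set cyclic_derivative a (potential K Q) | a in [set: arrow Q]]%classic ->
  pa_act x v = 0.
Proof.
move=> /asboolP[s [sG ->]].
rewrite (big_morph (pa_act^~ v) (fun x y => pa_actD x y v) (pa_act0 v)) big_seq big1 //.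
move=> t /sG[a _ e]; rewrite !pa_actM -e pa_act_relation.
exact: linear0.
Qed.

Definition alg_act (a : A) (v : V) : V := pa_act (repr a) v.

Lemma alg_act_qp (x : pa) v : alg_act (qp x) v = pa_act x v.
Proof.
apply/eqP; rewrite -subr_eq0 -pa_actN -pa_actD; apply/eqP/pa_act_ideal.
by apply/rq_eq; rewrite reprK.
Qed.

(** The operators and the hypothesis are arguments of the alias, so that different operators on one
    space [V] yield different [A]-modules; the terms of the Koszul complex arise in this way. *)
Definition ops_module of (\sum_i rho i = 0) & mckay_ops V : Type := V.
Local Notation M := (ops_module sum_rho o).
HB.instance Definition _ := GRing.Zmodule.copy M V.

Lemma alg_actA a b (v : M) : alg_act a (alg_act b v) = alg_act (a * b) v.
Proof.
by elim/qp_ind: a => x; elim/qp_ind: b => y; rewrite -qpM !alg_act_qp pa_actM.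
Qed.

Lemma alg_act1 : left_id 1 (alg_act : A -> M -> M).
Proof. by move=> v; rewrite -qp1 alg_act_qp pa_act1. Qed.

Lemma alg_actDr : right_distributive (alg_act : A -> M -> M) +%R.
Proof. by elim/qp_ind => x u v; rewrite !alg_act_qp linearD. Qed.

Lemma alg_actDl (v : M) : {morph (alg_act^~ v : A -> M) : a b / a + b}.
Proof.
by elim/qp_ind => x; elim/qp_ind => y; rewrite -qpD !alg_act_qp pa_actD.
Qed.

HB.instance Definition _ := GRing.Zmodule_isLmodule.Build A M
  alg_actA alg_act1 alg_actDr alg_actDl.

Lemma scal_act c (v : M) : scal rho c *: v = (c *: (v : V) : V).
Proof. by rewrite -[LHS]/(alg_act _ _) alg_act_qp pa_actZ pa_act1. Qed.

Lemma idA_act chi (v : M) : idA rho chi *: v = op_id o chi v.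
Proof. by rewrite -[LHS]/(alg_act _ _) alg_act_qp pa_act_word. Qed.

Lemma varA_act i (v : M) : varA rho i *: v = op_var o i v.
Proof.
rewrite scaler_suml -[RHS](op_id_sum o); apply: eq_bigr => chi _.
by rewrite -[LHS]/(alg_act _ _) alg_act_qp pa_act_word /= eqxx.
Qed.

End Action.

Lemma alg_linear (sum_rho : \sum_i rho i = 0) (M N : lmodType A) (f : M -> N) :
  {morph f : u v / u + v} ->
  (forall c v, f (scal rho c *: v) = scal rho c *: f v) ->
  (forall chi v, f (idA rho chi *: v) = idA rho chi *: f v) ->
  (forall i v, f (varA rho i *: v) = varA rho i *: f v) -> linear f.
Proof.
move=> fD fZ fi fv a u v; rewrite fD; congr (_ + _).
move: a u; apply: (potential_algebra_gen sum_rho) => // [a b IHa IHb|a b IHa IHb] u.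
  by rewrite !scalerDl fD IHa IHb.
by rewrite -!scalerA IHa IHb.
Qed.

End UniversalProperty.

(** * The endomorphism ring of the module of polynomials *)

Local Notation "''X_[' m ]" := (mpolyX _ m).
Local Notation mcf := mcoeff.

Section MpolyComplements.
Variable K : closedFieldType.

(** If [p] vanishes everywhere, ['X * p + 1] has no root, hence is constant over the algebraically
    closed field, which forces [p = 0]. *)
Lemma poly_eq0_horner (p : {poly K}) : (forall x, p.[x] = 0) -> p = 0.
Proof.
move=> p0; have [/eqP s1|s1] := boolP (size ('X * p + 1) == 1%N).
  apply/eqP; apply: contraT => pn0; move: s1.
  rewrite size_polyDl; rewrite size_mul ?polyX_eq0 // size_polyX ?size_poly1 /=.
    by case: (size p) (size_poly_eq0 p) => // -[]//; rewrite (negPf pn0).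
  by rewrite ltnS size_poly_gt0.
have /closed_rootP[x] := s1.
by rewrite /root hornerD hornerM p0 mulr0 add0r hornerC oner_eq0.
Qed.

(* Kronecker substitution x_i := t^(D^i) *)
Lemma mpoly3_eq0_meval (p : mpoly 3 K) : (forall v, meval v p = 0) -> p = 0.
Proof.
(* [D] exceeds the degree of [p], so the exponents of a monomial of [p] are the digits of [e m] in
   base [D], and distinct monomials have distinct [e m]. *)
move=> p0; set D := mmeasure (R := K) mdeg p.
have digits_inj a b a' b' : (a < D -> a' < D -> a + D * b = a' + D * b' ->
    a = a' /\ b = b')%N.
  move=> lta lta' e; have D0 : (0 < D)%N by apply: leq_ltn_trans lta.
  have := congr1 (divn^~ D) e; have := congr1 (modn^~ D) e.
  rewrite /= ![(_ + D * _)%N]addnC ![(D * _)%N]mulnC !modnMDl !divnMDl //.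
  by rewrite !modn_small // !divn_small // !addn0.
pose e (m : multinom 3) := (m 0%R + D * (m 1%R + D * m 2%R))%N.
pose P : {poly K} := \sum_(m <- msupp p) mcf m p *: 'X^(e m).
have P0 : P = 0.
  apply: poly_eq0_horner => t; rewrite -[RHS](p0 (fun i : 'I_3 => t ^+ (D ^ i))).
  rewrite mevalE horner_sum; apply: eq_bigr => m _; rewrite hornerZ hornerXn.
  rewrite !big_ord_recr big_ord0 /= mul1r /e exprD exprM expn0 expr1 expn1.
  have -> : widen_ord (leqnSn 2) (widen_ord (leqnSn 1) ord_max) = 0 :> 'I_3 by apply: val_inj.
  have -> : widen_ord (leqnSn 2) ord_max = 1 :> 'I_3 by apply: val_inj.
  have -> : ord_max = 2 :> 'I_3 by apply: val_inj.
  by rewrite exprD exprM !mulrA expnS expn1 exprM.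
have lt_D m i : m \in msupp p -> (m i < D)%N.
  move=> mp; apply: leq_ltn_trans (msize_mdeg_lt mp).
  by rewrite mdegE (bigD1 i) //= leq_addr.
have e_inj m m' : m \in msupp p -> m' \in msupp p -> e m = e m' -> m = m'.
  move=> mp mp'; rewrite /e => ee.
  have [e0 e12] := digits_inj _ _ _ _ (lt_D _ 0 mp) (lt_D _ 0 mp') ee.
  have [e1 e2] := digits_inj _ _ _ _ (lt_D _ 1 mp) (lt_D _ 1 mp') e12.
  apply/mnmP => -[[|[|[|//]]] hi].
  - by rewrite (_ : Ordinal hi = 0) //; apply: val_inj.
  - by rewrite (_ : Ordinal hi = 1) //; apply: val_inj.
  - by rewrite (_ : Ordinal hi = 2) //; apply: val_inj.
apply/mpolyP => m; rewrite mcoeff0; apply/eqP; rewrite mcoeff_eq0.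
apply/negP => mp; have := congr1 (fun q : {poly K} => q`_(e m)) P0.
rewrite coef0 coef_sum (bigD1_seq m) ?msupp_uniq //= coefZ coefXn eqxx mulr1.
rewrite big_seq_cond big1 ?addr0 => [/eqP|m' /andP[mp' ne]].
  by rewrite mcoeff_eq0 mp.
rewrite coefZ coefXn; case: eqP => [/esym/e_inj em|]; last by rewrite mulr0.
by rewrite em ?eqxx in ne.
Qed.

Lemma mpoly_linear_ext n (V : lmodType K) (f g : mpoly n K -> V) :
  linear f -> linear g -> (forall m, f 'X_[m] = g 'X_[m]) -> forall p, f p = g p.
Proof.
move=> fl gl fg p.
pose F : {linear mpoly n K -> V} := HB.pack f (GRing.isLinear.Build K _ V _ f fl).
pose G : {linear mpoly n K -> V} := HB.pack g (GRing.isLinear.Build K _ V _ g gl).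
rewrite -[f]/(F : _ -> _) -[g]/(G : _ -> _) [p]mpolyE !linear_sum.
by apply: eq_bigr => m _; rewrite !linearZ /= fg.
Qed.

Lemma mpoly_divX n (m : multinom n) (f : mpoly n K) :
  (forall m', m' \in msupp f -> lem m m') -> exists q, f = 'X_[m] * q.
Proof.
move=> le_m; exists (\sum_(m' <- msupp f) mcf m' f *: 'X_[mnm_sub m' m]).
rewrite [LHS]mpolyE mulr_sumr !big_seq; apply: eq_bigr => m' /le_m le.
by rewrite -scalerAr -mpolyXD addmC submK.
Qed.

End MpolyComplements.

(** * Weight spaces of the polynomial ring *)

Section WeightProjection.
Variables (K : closedFieldType) (gT : finGroupType).
Variable rho : 'I_3 -> character K gT.
Local Notation char := (character K gT).
Local Notation S := (mpoly 3 K).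

(** In eigencoordinates the polynomials of weight 0 are the invariants; [wproj 0 r = r] is how
    invariance of [r] is expressed below. *)
Definition wproj (s : char) (f : S) : S :=
  \sum_(m <- msupp f | weight rho m == s) mcf m f *: 'X_[m].

Lemma mcoeff_wproj s f m : mcf m (wproj s f) = if weight rho m == s then mcf m f else 0.
Proof.
rewrite /wproj raddf_sum /=.
under eq_bigr => m' _ do rewrite mcoeffZ mcoeffX.
have [mf|mf] := boolP (m \in msupp f); last first.
  rewrite (memN_msupp_eq0 mf) if_same big_seq_cond big1 // => m' /andP[m'f _].
  by case: (eqVneq m' m) mf => [<-|_ _]; [rewrite m'f | rewrite mulr0].
rewrite -big_filter.
case: ifP => ms.
  rewrite (bigD1_seq m) ?mem_filter ?ms ?filter_uniq ?msupp_uniq //= eqxx mulr1.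
  by rewrite big1 ?addr0 // => m' /negPf->; rewrite mulr0.
rewrite big_seq big1 // => m'; rewrite mem_filter => /andP[ms' _].
by case: (eqVneq m' m) ms => [<-|_ _]; [rewrite ms' | rewrite mulr0].
Qed.

Lemma wproj_linear s : linear (wproj s).
Proof.
move=> c f g; apply/mpolyP => m.
by rewrite mcoeff_wproj !mcoeffD !mcoeffZ !mcoeff_wproj; case: ifP; rewrite ?mulr0 ?addr0.
Qed.

HB.instance Definition _ s :=
  GRing.Linear.copy (wproj s) (linear_of (wproj_linear s)).

Lemma wprojX s m : wproj s 'X_[m] = if weight rho m == s then 'X_[m] else 0.
Proof.
apply/mpolyP => m'; rewrite mcoeff_wproj mcoeffX.
case: (eqVneq m m') => [<-|ne]; first by case: ifP; rewrite ?mcoeffX ?eqxx ?mcoeff0.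
by rewrite if_same; case: ifP; rewrite ?mcoeffX ?(negPf ne) ?mcoeff0.
Qed.

Lemma wproj_proj s t f : wproj s (wproj t f) = if s == t then wproj s f else 0.
Proof.
apply/mpolyP => m; rewrite !mcoeff_wproj.
have [<-|ne] := eqVneq s t; first by rewrite mcoeff_wproj; case: (weight rho m == s).
by rewrite mcoeff0; case: eqP => // ->; rewrite (negPf ne).
Qed.

Lemma sum_wproj f : \sum_s wproj s f = f.
Proof.
apply/mpolyP => m; rewrite raddf_sum /= (bigD1 (weight rho m)) //=.
rewrite mcoeff_wproj eqxx big1 ?addr0 // => s /negPf ne.
by rewrite mcoeff_wproj eq_sym ne.
Qed.

Lemma wprojMX s m f : wproj s ('X_[m] * f) = 'X_[m] * wproj (s - weight rho m) f.
Proof.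
pose mulm := fun f : S => 'X_[m] * f.
have mulm_linear : linear mulm by move=> c u v; rewrite /mulm mulrDr scalerAr.
move: f; apply: mpoly_linear_ext.
- by move=> c u v; rewrite -[X in wproj s X]/(mulm _) mulm_linear linearP.
- by move=> c u v; rewrite linearP; apply: mulm_linear.
move=> m'; rewrite -mpolyXD !wprojX weightD addrC.
by rewrite eq_sym -subr_eq eq_sym; case: ifP; rewrite ?mulr0 ?mpolyXD.
Qed.

Lemma wproj0M (r f : S) s : wproj 0 r = r -> wproj s (r * f) = r * wproj s f.
Proof.
move=> r0; have -> : r = \sum_(m <- msupp r | weight rho m == 0) mcf m r *: 'X_[m].
  by rewrite -{1}r0.
rewrite mulr_suml linear_sum mulr_suml; apply: eq_bigr => m /eqP m0.
by rewrite -!scalerAl linearZ /= wprojMX m0 subr0.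
Qed.

Lemma wproj_var s i f : wproj s ('X_[mnm1 i] * f) = 'X_[mnm1 i] * wproj (s - rho i) f.
Proof. by rewrite wprojMX weight1. Qed.

Lemma poly_op_id_var chi i f : wproj (- chi) ('X_[mnm1 i] * f) =
  'X_[mnm1 i] * wproj (- (chi + rho i)) f.
Proof. by rewrite wproj_var opprD. Qed.

Lemma poly_op_idM chi psi f : wproj (- chi) (wproj (- psi) f) =
  if chi == psi then wproj (- chi) f else 0.
Proof. by rewrite wproj_proj (inj_eq oppr_inj). Qed.

Lemma poly_op_id_sum f : \sum_chi wproj (- chi) f = f.
Proof. by rewrite -[RHS]sum_wproj [RHS](reindex_inj oppr_inj). Qed.

Lemma poly_op_varP i : linear (fun f : S => 'X_[mnm1 i] * f).
Proof. by move=> c u v; rewrite mulrDr scalerAr. Qed.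

Lemma poly_op_varC i j (f : S) :
  'X_[mnm1 i] * ('X_[mnm1 j] * f) = 'X_[mnm1 j] * ('X_[mnm1 i] * f).
Proof. exact: mulrCA. Qed.

(** The vertex [chi] carries the weight [- chi]: an arrow of type [i] leads from [chi + rho i] to
    [chi], whereas multiplication by its variable adds [rho i] to the weight. *)
Definition poly_ops : mckay_ops rho S :=
  McKayOps (fun chi => wproj_linear (- chi)) poly_op_varP poly_op_idM poly_op_id_sum
    poly_op_id_var poly_op_varC.

Hypothesis sep : forall g, (forall i, rho i g = 1) -> g = 1%g.
Hypothesis sum_rho : \sum_i rho i = 0.

(* Linearity over the ring of invariants forces phi on a weight space to be
   multiplication by a rational function; it has no poles, because each
   weight space contains a monomial prime to any given variable. *)
Lemma invariant_linear_mul (phi : S -> S) : linear phi ->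
  (forall r f, wproj 0 r = r -> phi (r * f) = r * phi f) ->
  forall s, exists q, forall f, phi (wproj s f) = q * wproj s f.
Proof.
move=> lin phiM s.
(* A monomial [n] of the opposite weight makes both [n + m] and [n + m'] invariant, and [phi]
   commutes with multiplication by invariants. *)
have swap m m' : weight rho m = s -> weight rho m' = s ->
    'X_[m] * phi 'X_[m'] = 'X_[m'] * phi 'X_[m].
  move=> ms ms'; have [n ns] := weight_surj sep (- s).
  have inv k : weight rho k = s -> wproj 0 'X_[mnm_add n k] = 'X_[mnm_add n k].
    by move=> ks; rewrite wprojX weightD ns ks addNr eqxx.
  have X0 : 'X_[n] != 0 :> S.
    by apply/eqP => /(congr1 (mcf n)); rewrite mcoeffX eqxx mcoeff0; apply/eqP/oner_neq0.
  apply: (mulfI X0); rewrite !mulrA -!mpolyXD -!phiM ?inv // -!mpolyXD.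
  by congr (phi 'X_[_]); rewrite -!addmA [mnm_add m m']addmC.
have [m1 [m10 m1s]] := weight_surj_avoid sep sum_rho 0 s.
have [q phi1] : exists q, phi 'X_[m1] = 'X_[m1] * q.
  (* If [mj] is free of the variable [j], the identity [swap] for [mj] and [m1] shows that [phi
     'X_[m1]] is divisible by the full power of this variable in [m1]. *)
  apply: mpoly_divX => a af; apply/mnm_lepP => j.
  have [mj [mj0 mjs]] := weight_surj_avoid sep sum_rho j s.
  have : mcf (mnm_add mj a) ('X_[mj] * phi 'X_[m1]) != 0.
    by rewrite mulrC mcoeffMX -mcoeff_msupp.
  rewrite swap // mulrC -mcoeff_msupp (perm_mem (msuppMX _ _)) => /mapP[b _].
  by move=> /(congr1 (fun m : multinom 3 => m j)); rewrite !mnmDE mj0 add0n => ->; apply: leq_addr.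
exists q; apply: mpoly_linear_ext.
- by move=> c u v; rewrite linearP lin.
- by move=> c u v; rewrite linearP mulrDr scalerAr.
pose Phi : {linear S -> S} := HB.pack phi (GRing.isLinear.Build K S S _ phi lin).
move=> m; rewrite wprojX; case: eqP => [ms|_]; last first.
  by rewrite mulr0 -[phi]/(Phi : _ -> _) linear0.
have X0 : 'X_[m1] != 0 :> S.
  by apply/eqP => /(congr1 (mcf m1)); rewrite mcoeffX eqxx mcoeff0; apply/eqP/oner_neq0.
by apply: (mulfI X0); rewrite swap // phi1 mulrCA [q * _]mulrC.
Qed.

End WeightProjection.

Section ScalarRestriction.
Variables (K : closedFieldType) (gT : finGroupType).
Variable rho : 'I_3 -> character K gT.
Local Notation A := (potential_algebra K (mckay_quiver rho)).

Definition restrict_scal (M : lmodType A) : Type := M.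
Variable M : lmodType A.
Local Notation MK := (restrict_scal M).

HB.instance Definition _ := GRing.Zmodule.copy MK M.

Definition res_scale (c : K) (v : MK) : MK := scal rho c *: (v : M).

Lemma res_scaleA a b v : res_scale a (res_scale b v) = res_scale (a * b) v.
Proof. by rewrite /res_scale scalerA -scalM. Qed.

Lemma res_scale1 : left_id 1 res_scale.
Proof. by move=> v; rewrite /res_scale scal1 scale1r. Qed.

Lemma res_scaleDr : right_distributive res_scale +%R.
Proof. by move=> a u v; apply: scalerDr. Qed.

Lemma res_scaleDl v : {morph res_scale^~ v : a b / a + b}.
Proof. by move=> a b; rewrite /res_scale scalD; apply: scalerDl. Qed.

HB.instance Definition _ := GRing.Zmodule_isLmodule.Build K MK
  res_scaleA res_scale1 res_scaleDr res_scaleDl.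

End ScalarRestriction.

(** * Action of the algebra on polynomials *)

Section EndomorphismRing.
Variables (K : closedFieldType) (gT : finGroupType).
Variable rho : 'I_3 -> character K gT.
Local Notation char := (character K gT).
Local Notation S := (mpoly 3 K).
Local Notation A := (potential_algebra K (mckay_quiver rho)).
Hypothesis sep : forall g, (forall i, rho i g = 1) -> g = 1%g.
Hypothesis sum_rho : \sum_i rho i = 0.
Local Notation SA := (ops_module sum_rho (poly_ops rho)).

Lemma monA_act m (f : SA) : monA rho m *: f = 'X_[m] * (f : S) :> S.
Proof.
have varX i n (g : SA) : varA rho i ^+ n *: g = 'X_[mnm1 i] ^+ n * (g : S) :> S.
  elim: n g => [|n IHn] g; first by rewrite !expr0 scale1r mul1r.
  by rewrite exprS -scalerA varA_act /= IHn exprS mulrA.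
rewrite monAE -!scalerA !varX !mulrA; congr (_ * _).
rewrite [RHS]mpolyXE_id !big_ord_recr big_ord0 /= mul1r.
by congr ('X_[mnm1 _] ^+ m _ * 'X_[mnm1 _] ^+ m _ * 'X_[mnm1 _] ^+ m _);
  apply: val_inj; rewrite /= inordK.
Qed.

(** The coefficient at [(chi0, m0)] with respect to the spanning elements of [potential_algebra_ind]
    is detected on a monomial [n] such that [m0 + n] has weight [- chi0]: no other pair contributes
    the monomial [m0 + n] to the result. *)
Lemma alg_faithful (a : A) : (forall f : SA, a *: f = 0) -> a = 0.
Proof.
pose G (k : char * multinom 3) : restrict_scal (A^o : lmodType A) :=
  idA rho k.1 * monA rho k.2.
have [x ->] : exists x : malg (char * multinom 3)%type K, a = lext G x.
  elim/(potential_algebra_ind sum_rho): a => [|a b [x ->] [y ->]|c a [x ->]|chi m].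
  - by exists 0; rewrite lext0.
  - by exists (x + y); rewrite lextD.
  - by exists (c *: x); rewrite lextZ.
  - by exists (mkmalgU (chi, m) 1); rewrite lextU.
move=> act0; suff -> : x = 0 by rewrite lext0.
apply/malgP => -[chi0 m0]; rewrite monalg.mcoeff0.
have [n nE] := weight_surj sep (- chi0 - weight rho m0).
have act (f : SA) : lext G x *: f =
    \sum_(k <- monalg.msupp x) monalg.mcoeff k x *: wproj rho (- k.1) ('X_[k.2] * (f : S)).
  rewrite /lext scaler_suml; apply: eq_bigr => k _.
  rewrite -[LHS]/((scal rho _ * (idA rho k.1 * monA rho k.2)) *: f).
  by rewrite -!scalerA scal_act idA_act monA_act.
have := congr1 (mcf (mnm_add m0 n)) (etrans (esym (act 'X_[n])) (act0 'X_[n])).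
rewrite mcoeff0 raddf_sum /=.
have [k0|k0] := boolP ((chi0, m0) \in monalg.msupp x); last first.
  by rewrite monalg.mcoeff_outdom.
rewrite (bigD1_seq (chi0, m0)) ?fset_uniq //= big1 => [|[chi m] ne].
  rewrite addr0 mcoeffZ mcoeff_wproj weightD nE addrCA addrN addr0 eqxx.
  by rewrite -mpolyXD mcoeffX eqxx mulr1.
rewrite mcoeffZ mcoeff_wproj weightD nE addrCA addrN addr0 -mpolyXD mcoeffX.
rewrite eqm_add2r (inj_eq oppr_inj) /=.
case: (eqVneq chi0 chi) ne => [<-|]; last by rewrite mulr0.
by case: (eqVneq m m0) => [->|]; rewrite ?eqxx ?mulr0.
Qed.

Lemma mul_alg (q : S) : exists a : A, forall f : SA, a *: f = q * (f : S) :> S.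
Proof.
elim/mpolyind: q => [|c m q _ _ [a aE]].
  by exists 0 => f; rewrite scale0r mul0r.
exists (scal rho c * monA rho m + a) => f.
by rewrite scalerDl aE mulrDl -scalerA scal_act monA_act scalerAl.
Qed.

(** On the space of weight [s] the map is multiplication by some [q s]; the idempotents
    [idA rho (- s)] assemble these multiplications into one element of the algebra. *)
Lemma invariant_linear_alg (phi : S -> S) : linear phi ->
  (forall r f, wproj rho 0 r = r -> phi (r * f) = r * phi f) ->
  exists a : A, forall f : SA, a *: f = phi f.
Proof.
move=> lin phiM; have [q qE] := choice (invariant_linear_mul sep sum_rho lin phiM).
have [b bE] := choice (fun s => mul_alg (q s)).
pose Phi : {linear S -> S} := HB.pack phi (GRing.isLinear.Build K S S _ phi lin).
exists (\sum_s b s * idA rho (- s)) => f.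
rewrite scaler_suml -[in RHS](sum_wproj rho f) -[phi]/(Phi : _ -> _) linear_sum.
apply: eq_bigr => s _; rewrite -scalerA bE idA_act /= opprK.
by rewrite -[RHS]/(phi _) qE.
Qed.

Lemma alg_invariant_linear (a : A) (r f : S) : wproj rho 0 r = r ->
  a *: (r * f : SA) = r * (a *: (f : SA) : S) :> S.
Proof.
move=> r0; move: a f; apply: (potential_algebra_gen sum_rho) => [a b IHa IHb|a b IHa IHb|c|chi|i] f.
- by rewrite !scalerDl IHa IHb mulrDr.
- by rewrite -!scalerA IHb IHa.
- by rewrite !scal_act scalerAr.
- by rewrite !idA_act /= wproj0M.
- by rewrite !varA_act /= mulrCA.
Qed.

End EndomorphismRing.

(** * Polynomials as a module over the invariants *)

Section InvariantModule.
Variables (K : closedFieldType) (gT : finGroupType).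
Variable rho : 'I_3 -> character K gT.
Local Notation char := (character K gT).
Local Notation S := (mpoly 3 K).
Local Notation A := (potential_algebra K (mckay_quiver rho)).
Hypothesis sep : forall g, (forall i, rho i g = 1) -> g = 1%g.
Hypothesis sum_rho : \sum_i rho i = 0.
Local Notation SA := (ops_module sum_rho (poly_ops rho)).
Variables (R : comNzRingType) (t : {rmorphism R -> S}).
Hypothesis t_inv : forall r, wproj rho 0 (t r) = t r.
Hypothesis t_surj : forall f, wproj rho 0 f = f -> exists r, t r = f.
Hypothesis t_inj : injective t.

(** The ring of invariants is an abstract [R] with an isomorphism [t] onto the polynomials of weight
    0, which keeps the change of coordinates out of the argument; [t] is an argument of the alias
    because it fixes the action of [R]. *)
Definition invariant_module of {rmorphism R -> S} : Type := S.
Local Notation N := (invariant_module t).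
HB.instance Definition _ := GRing.Zmodule.copy N S.

Definition inv_scale (r : R) (f : N) : N := t r * (f : S).

Lemma inv_scaleA a b v : inv_scale a (inv_scale b v) = inv_scale (a * b) v.
Proof. by rewrite /inv_scale rmorphM mulrA. Qed.

Lemma inv_scale1 : left_id 1 inv_scale.
Proof. by move=> v; rewrite /inv_scale rmorph1 mul1r. Qed.

Lemma inv_scaleDr : right_distributive inv_scale +%R.
Proof. by move=> a u v; apply: mulrDr. Qed.

Lemma inv_scaleDl v : {morph inv_scale^~ v : a b / a + b}.
Proof. by move=> a b; rewrite /inv_scale rmorphD; apply: mulrDl. Qed.

HB.instance Definition _ := GRing.Zmodule_isLmodule.Build R N
  inv_scaleA inv_scale1 inv_scaleDr inv_scaleDl.

Lemma inv_scaleE r (f : N) : r *: f = t r * (f : S) :> S.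
Proof. by []. Qed.

Lemma const_inv (c : K) : wproj rho 0 (mpolyC 3 c) = mpolyC 3 c.
Proof.
by rewrite -[mpolyC 3 c]mulr1 mul_mpolyC -mpolyX0 linearZ /= wprojX weight0 eqxx.
Qed.

Lemma inv_linearK (M : lmodType R) (phi : N -> M) (f g : N) c : linear phi ->
  exists r, t r = mpolyC 3 c /\ phi (c *: (f : S) + (g : S) : N) = r *: phi f + phi g.
Proof.
move=> lin; have [r rE] := t_surj (const_inv c); exists r; split=> //.
by rewrite -lin; congr (phi (_ + _)); rewrite -mul_mpolyC -rE.
Qed.

Lemma wprojM u s (a b : S) :
  wproj rho u (a * wproj rho s b) = wproj rho (u - s) a * wproj rho s b.
Proof.
move: b; apply: mpoly_linear_ext => [c f g|c f g|m].
- by rewrite linearP mulrDr -scalerAr linearP.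
- by rewrite linearP mulrDr -scalerAr.
rewrite wprojX; case: eqP => [<-|_]; last by rewrite !mulr0 linear0.
by rewrite mulrC wprojMX mulrC.
Qed.

(** On weight [s] the functional is multiplication by some [q s]; as its values have weight 0, only
    the part of [q s] of weight [- s] matters, and [p] is the sum of these parts. *)
Lemma functional_form (phi : S -> S) : linear phi ->
  (forall r f, wproj rho 0 r = r -> phi (r * f) = r * phi f) ->
  (forall f, wproj rho 0 (phi f) = phi f) ->
  exists p, forall f, phi f = wproj rho 0 (p * f).
Proof.
move=> lin phiM phi0; have [q qE] := choice (invariant_linear_mul sep sum_rho lin phiM).
pose Phi : {linear S -> S} := HB.pack phi (GRing.isLinear.Build K S S _ phi lin).
exists (\sum_s wproj rho (- s) (q s)) => f.
rewrite -[in LHS](sum_wproj rho f) -{2}(sum_wproj rho f) -[phi]/(Phi : _ -> _).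
rewrite mulr_sumr !linear_sum; apply: eq_bigr => s _; rewrite -[LHS]/(phi _).
rewrite /= wprojM sub0r linear_sum /= (bigD1 s) //= wproj_proj eqxx big1 ?addr0 => [|u ne].
  by rewrite -phi0 qE wprojM sub0r.
by rewrite wproj_proj (inj_eq oppr_inj) eq_sym (negPf ne).
Qed.

Lemma inv_linear_invariant (phi : N -> N) : linear phi ->
  linear (phi : S -> S) /\
  forall r f, wproj rho 0 r = r -> phi (r * f) = r * (phi f : S).
Proof.
move=> lin; split=> [c f g|r f r0].
  by have [r [rE ->]] := inv_linearK f g c lin; rewrite inv_scaleE rE mul_mpolyC.
have [r' rE] := t_surj r0; rewrite -rE -[t r' * f]/(r' *: (f : N)) -[t r' * _]/(r' *: phi f).
pose Phi : {linear N -> N} := HB.pack phi (GRing.isLinear.Build R N N _ phi lin).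
by rewrite -[phi]/(Phi : _ -> _) linearZ.
Qed.

Lemma pairing_exists (s f : S) : exists r, t r = wproj rho 0 (s * f).
Proof. by apply: t_surj; rewrite wproj_proj eqxx. Qed.

(** By [functional_form] every functional on [S] over [R] is of this kind; the pairing makes [S] its
    own dual. *)
Definition pairing (s : S) (f : N) : R^o := sval (cid (pairing_exists s f)).

Lemma pairingE s f : t (pairing s f) = wproj rho 0 (s * (f : S)).
Proof. exact: (svalP (cid (pairing_exists s f))). Qed.

Lemma pairing_linear s : linear (pairing s).
Proof.
move=> r f g; apply: t_inj.
rewrite -[r *: pairing s f + _]/(r * pairing s f + pairing s g : R) rmorphD rmorphM.
rewrite !pairingE mulrDr linearD /=.
by rewrite inv_scaleE mulrCA (wproj0M _ _ (t_inv r)).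
Qed.

HB.instance Definition _ s :=
  GRing.Linear.copy (pairing s) (linear_of (pairing_linear s)).

(** By self-duality a functional [theta] on the dual becomes the functional [phi] on [S] itself, so
    it is again given by a polynomial [x]; symmetry of the pairing turns this into evaluation at
    [x]. Points are separated by pairing with monomials of opposite weight. *)
Lemma invariant_module_reflexive : reflexive_module N.
Proof.
split=> [x y xy|theta thetaP].
  apply/eqP; rewrite -subr_eq0; apply/eqP/mpolyP => m; rewrite mcoeff0.
  have [n nE] := weight_surj sep (- weight rho m).
  have := congr1 t (xy (pairing 'X_[n])); rewrite /= !pairingE => /eqP.
  rewrite -subr_eq0 -linearB -mulrBr /= => /eqP/(congr1 (mcf (mnm_add n m))).
  rewrite mcoeff0 mcoeff_wproj weightD nE addNr eqxx mulrC mcoeffMX.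
  by rewrite -[x - y]/((x : S) - (y : S)).
(* [theta] is defined on bundled linear maps; that it depends only on their values follows from its
   linearity. *)
have theta_ext (f g : {linear N -> R^o}) : (forall x, f x = g x) -> theta f = theta g.
  move=> fg; have z : theta \0 = 0.
    have := thetaP 1 \0 \0 \0; rewrite !mul1r => /(_ _)/wrap[].
      by move=> x /=; rewrite mulr0 addr0.
    by move/eqP; rewrite -subr_eq0 opprD addrA addrN sub0r oppr_eq0 => /eqP.
  rewrite (thetaP 1 g \0 f) ?mul1r ?z ?addr0 // => x.
  by rewrite fg mul1r /= addr0.
pose phi (s : N) : N := t (theta (pairing s)).
have phi_lin : linear phi.
  move=> r f g; rewrite /phi inv_scaleE.
  rewrite (thetaP r (pairing f) (pairing g)) ?rmorphD ?rmorphM // => x.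
  apply: t_inj; rewrite rmorphD rmorphM /= !pairingE mulrDl linearD /=.
  by rewrite -mulrA (wproj0M _ _ (t_inv r)).
have [phiK phiM] := inv_linear_invariant phi_lin.
have [x xE] := functional_form phiK phiM (fun f => t_inv _).
exists x => f; pose tf (h : N) : N := t (f h).
have tf_lin : linear tf.
  move=> r g h; rewrite /tf linearP.
  by rewrite -[r *: f g + f h]/(r * f g + f h : R) rmorphD rmorphM.
have [tfK tfM] := inv_linear_invariant tf_lin.
have [p pE] := functional_form tfK tfM (fun f => t_inv _).
have fp y : f y = pairing p y by apply: t_inj; rewrite pairingE -pE.
apply: t_inj; rewrite (theta_ext _ (pairing p)) // -/(phi p) xE.
by rewrite fp pairingE mulrC.
Qed.

(** The [#|gT|]-th powers of the variables are invariant, so the monomials with all exponents below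
    [#|gT|] generate. *)
Lemma invariant_module_fin_gen : fin_gen N.
Proof.
pose n := #|gT|; pose gen (f : {ffun 'I_3 -> 'I_n}) : N :=
  'X_[Multinom [tuple (f i : nat) | i < 3]].
pose s := [seq gen f | f <- enum {ffun 'I_3 -> 'I_n}].
exists s; elim/mpolyind => [|c m p _ _ [d dE]].
  by exists (fun=> 0); rewrite big1 // => i _; rewrite scale0r.
pose f := [ffun i : 'I_3 => Ordinal (ltn_pmod (m i) (card_gT_gt0 gT))].
pose l := Multinom [tuple (m i %/ n * n)%N | i < 3].
have [r rE] : exists r, t r = c *: 'X_[l].
  apply: t_surj; rewrite linearZ /= wprojX ifT //; apply/eqP.
  rewrite /weight big1 // => i _.
  by rewrite mnmE mulnC mulrnA char_order mul0rn.
have fs : (index (gen f) s < size s)%N by rewrite index_mem map_f // mem_enum.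
exists (fun i => (if i == Ordinal fs then r else 0) + d i).
under eq_bigr do rewrite scalerDl; rewrite big_split /= -dE; congr (_ + _).
rewrite (bigD1 (Ordinal fs)) //= eqxx big1 ?addr0 => [|i /negPf->]; last by rewrite scale0r.
rewrite nth_index ?map_f ?mem_enum // inv_scaleE rE -scalerAl -mpolyXD.
congr (_ *: 'X_[_]); apply/mnmP => i.
by rewrite mnmDE !mnmE ffunE /= -divn_eq.
Qed.

Lemma alg_act_linear (a : A) : linear (fun f : N => a *: (f : SA) : N).
Proof.
move=> r f g; apply: etrans (scalerDr a (t r * (f : S) : SA) (g : SA)) _.
congr (_ + _ : S); exact: (alg_invariant_linear sum_rho).
Qed.

Definition alg_endo (a : A) : {linear N -> N} :=
  HB.pack (fun f : N => a *: (f : SA) : N)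
    (GRing.isLinear.Build R N N _ _ (alg_act_linear a)).

Definition invariant_to_alg (r : R) : A := sval (cid (mul_alg sum_rho (t r))).

Lemma invariant_to_algE r (f : SA) : invariant_to_alg r *: f = t r * (f : S) :> S.
Proof. exact: (svalP (cid (mul_alg sum_rho (t r)))). Qed.

Lemma alg_ext (a b : A) : (forall f : SA, a *: f = b *: f) -> a = b.
Proof.
move=> ab; apply/eqP; rewrite -subr_eq0; apply/eqP;
  apply: (alg_faithful sep (sum_rho := sum_rho)) => f.
by rewrite scalerBl ab addrN.
Qed.

Lemma invariant_to_alg_additive : zmod_morphism invariant_to_alg.
Proof.
move=> r s; apply: alg_ext => f.
by rewrite scalerBl !invariant_to_algE rmorphB mulrBl.
Qed.

Lemma invariant_to_alg_monoid : monoid_morphism invariant_to_alg.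
Proof.
split; first by apply: alg_ext => f; rewrite invariant_to_algE rmorph1 mul1r scale1r.
move=> r s; apply: alg_ext => f.
by rewrite -scalerA !invariant_to_algE rmorphM mulrA.
Qed.

HB.instance Definition _ :=
  GRing.isZmodMorphism.Build R A invariant_to_alg invariant_to_alg_additive.
HB.instance Definition _ :=
  GRing.isMonoidMorphism.Build R A invariant_to_alg invariant_to_alg_monoid.

Definition invariant_to_alg_rmorphism : {rmorphism R -> A} := invariant_to_alg.

Lemma invariant_to_alg_central r (a : A) :
  invariant_to_alg r * a = a * invariant_to_alg r.
Proof.
apply: alg_ext => f; rewrite -!scalerA invariant_to_algE.
rewrite [in RHS](_ : invariant_to_alg r *: f = t r * (f : S)) ?invariant_to_algE //.
by rewrite alg_invariant_linear.
Qed.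

Lemma invariant_to_alg_const r c : t r = mpolyC 3 c -> invariant_to_alg r = scal rho c.
Proof.
move=> rE; apply: alg_ext => f; rewrite invariant_to_algE rE scal_act.
by rewrite mul_mpolyC.
Qed.

Lemma alg_iso_End : iso_End invariant_to_alg N.
Proof.
exists alg_endo; split=> [x|a b x|a b x|r a x|].
- exact: (scale1r (x : SA)).
- exact: (esym (scalerA a b (x : SA))).
- exact: (scalerDl (x : SA) a b).
- by rewrite /= -scalerA invariant_to_algE.
split=> [a b ab|f]; first by apply: alg_ext.
have [fK fM] := inv_linear_invariant (linearP f).
by have [a aE] := invariant_linear_alg sep sum_rho fK fM; exists a.
Qed.

End InvariantModule.

(** * Invariants in eigencoordinates *)

Section DiagonalizedRepresentation.
Variables (K : closedFieldType) (gT : finGroupType).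
Variable rG : mx_representation K [set: gT]%G 3.
Variable rho : 'I_3 -> character K gT.
Variable P : 'M[K]_3.
Hypothesis unitP : P \in unitmx.
Hypothesis decomposition : forall g : gT,
  rG g *m P = P *m diag_mx (\row_i rho i g).
Local Notation S := (mpoly 3 K).

Lemma faithful_separates : mx_faithful rG ->
  forall g, (forall i, rho i g = 1) -> g = 1%g.
Proof.
move=> faithfulG g g1; apply: (mx_faithful_inj faithfulG); rewrite ?inE //.
rewrite repr_mx1; apply: (can_inj (mulmxK unitP)).
rewrite decomposition mul1mx (_ : \row_i rho i g = const_mx 1) ?diag_const_mx ?mulmx1 //.
by apply/rowP => i; rewrite !mxE g1.
Qed.

Lemma character_sumE (s : seq 'I_3) (F : 'I_3 -> character K gT) g :
  (\sum_(i <- s) F i) g = \prod_(i <- s) F i g.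
Proof.
elim: s => [|i s IHs]; first by rewrite !big_nil character_0E.
by rewrite !big_cons character_addE IHs.
Qed.

Lemma det1_sum_rho : (forall g : gT, \det (rG g) = 1) -> \sum_i rho i = 0.
Proof.
move=> detG; apply: character_eq => g; rewrite character_0E.
have dP : \det P != 0 by rewrite -unitfE -unitmxE.
have := congr1 determinant (decomposition g); rewrite !det_mulmx detG mul1r det_diag.
move=> e; apply: (mulfI dP); rewrite mulr1 [RHS]e character_sumE.
by congr (_ * _); apply: eq_bigr => i _; rewrite mxE.
Qed.

Definition mx_subst (M : 'M[K]_3) : 3.-tuple S :=
  [tuple \sum_j M i j *: 'X_[mnm1 j] | i < 3].

Lemma meval_mx_subst M (v : 'cV[K]_3) p :
  meval (fun i => v i ord0) (comp_mpoly (mx_subst M) p) =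
  meval (fun i => (M *m v) i ord0) p.
Proof.
rewrite comp_mpoly_meval; apply: meval_eq => i; rewrite tnth_mktuple.
by rewrite raddf_sum mxE; apply: eq_bigr => j _; rewrite /= mevalZ mevalXU.
Qed.

Lemma mpoly_ext_meval (p q : S) :
  (forall v : 'cV[K]_3, meval (fun i => v i ord0) p = meval (fun i => v i ord0) q) ->
  p = q.
Proof.
move=> pq; apply/eqP; rewrite -subr_eq0; apply/eqP/mpoly3_eq0_meval => v.
rewrite mevalB; have := pq (\col_i v i).
by under eq_fun do rewrite mxE; move=> ->; rewrite subrr.
Qed.

(** The columns of [P] are common eigenvectors, so this rewrites a polynomial function in the
    coordinates that the group scales by the [rho i]. *)
Definition eigen_coord : S -> S := comp_mpoly (mx_subst P).

Lemma eigen_coord_inj : injective eigen_coord.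
Proof.
move=> p q pq; apply: mpoly_ext_meval => v.
by rewrite -[v](mulKVmx unitP) -!meval_mx_subst -/eigen_coord pq.
Qed.

Lemma eigen_coord_surj q : exists p, eigen_coord p = q.
Proof.
exists (comp_mpoly (mx_subst (invmx P)) q); apply: mpoly_ext_meval => v.
by rewrite !meval_mx_subst mulKmx.
Qed.

Definition twist (g : gT) (f : S) : S := \sum_s (s : character K gT) g *: wproj rho s f.

Lemma mcoeff_twist g f m : mcf m (twist g f) = weight rho m g * mcf m f.
Proof.
rewrite raddf_sum /= (bigD1 (weight rho m)) //= mcoeffZ mcoeff_wproj eqxx.
rewrite big1 ?addr0 // => s /negPf ne.
by rewrite mcoeffZ mcoeff_wproj eq_sym ne mulr0.
Qed.

Lemma meval_diag (f : S) g (v : 'cV[K]_3) :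
  meval (fun i => (diag_mx (\row_i rho i g) *m v) i ord0) f =
  meval (fun i => v i ord0) (twist g f).
Proof.
move: f; apply: (@mpoly_linear_ext _ _ K^o) => [c p q|c p q|m].
- by rewrite mevalD mevalZ.
- have -> : twist g (c *: p + q) = c *: twist g p + twist g q.
    by apply/mpolyP => m; rewrite !(mcoeffD, mcoeffZ, mcoeff_twist) mulrDr mulrCA.
  by rewrite mevalD mevalZ.
have -> : twist g 'X_[m] = weight rho m g *: 'X_[m].
  apply/mpolyP => m'; rewrite mcoeff_twist mcoeffZ mcoeffX.
  by case: eqP => [->|]; rewrite ?mulr0.
rewrite mevalZ !mevalX /weight character_sumE -big_split /=.
apply: eq_bigr => i _; rewrite mul_diag_mx !mxE exprMn.
by rewrite character_mulrnE.
Qed.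

(** In eigencoordinates [g] multiplies a monomial by the value of its weight at [g], which is what
    [twist] does; a polynomial is fixed by all [g] exactly if only monomials of trivial weight occur
    in it. *)
Lemma invariant_eigen_coord p :
  (p \in Defs.invariant rG) <-> wproj rho 0 (eigen_coord p) = eigen_coord p.
Proof.
have meq g (v : 'cV[K]_3) : mpoly_at p (rG g *m (P *m v)) =
    meval (fun i => v i ord0) (twist g (eigen_coord p)).
  by rewrite mulmxA decomposition -mulmxA /mpoly_at -meval_mx_subst meval_diag.
split=> [/asboolP inv|inv0].
  have tw g : twist g (eigen_coord p) = eigen_coord p.
    apply: mpoly_ext_meval => v; rewrite -meq inv /mpoly_at.
    by rewrite -meval_mx_subst.
  apply/mpolyP => m; rewrite mcoeff_wproj; case: ifP => // /negbT w0.
  apply/esym/eqP; apply: contraNT w0 => c0; apply/eqP/character_eq => g.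
  by rewrite character_0E; apply: (mulIf c0); rewrite -mcoeff_twist tw mul1r.
apply/asboolP => g v; rewrite -[v](mulKVmx unitP); move: (invmx P *m v) => w.
rewrite meq /mpoly_at -[RHS]meval_mx_subst.
congr (meval _ _); apply/mpolyP => m; rewrite mcoeff_twist -/eigen_coord -inv0 mcoeff_wproj.
by case: eqP => [->|]; rewrite ?mulr0 ?character_0E ?mul1r.
Qed.

Definition invariant_coord (f : invariant_ring rG) : S := eigen_coord (val f).

Lemma invariant_coord_additive : zmod_morphism invariant_coord.
Proof. by move=> f g; apply: (comp_mpolyB (mx_subst P) (val f) (val g)). Qed.

Lemma invariant_coord_monoid : monoid_morphism invariant_coord.
Proof.
split=> [|f g]; first exact: (comp_mpoly1 (mx_subst P)).
exact: (rmorphM (comp_mpoly (mx_subst P)) (val f) (val g)).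
Qed.

HB.instance Definition _ := GRing.isZmodMorphism.Build (invariant_ring rG) S
  invariant_coord invariant_coord_additive.
HB.instance Definition _ := GRing.isMonoidMorphism.Build (invariant_ring rG) S
  invariant_coord invariant_coord_monoid.

Lemma invariant_coord_inv r : wproj rho 0 (invariant_coord r) = invariant_coord r.
Proof. by apply/invariant_eigen_coord; apply: valP. Qed.

Lemma invariant_coord_inj : injective invariant_coord.
Proof. by move=> r s /eigen_coord_inj/val_inj. Qed.

Lemma invariant_coord_surj f : wproj rho 0 f = f -> exists r, invariant_coord r = f.
Proof.
have [p <-] := eigen_coord_surj f; move=> /invariant_eigen_coord pi.
by exists (exist _ p pi).
Qed.

Lemma invariant_coord_const c : invariant_coord (invariant_const rG c) = mpolyC 3 c.
Proof. by rewrite /invariant_coord /eigen_coord /= comp_mpolyC. Qed.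

End DiagonalizedRepresentation.

(** * The Koszul resolution *)

Section ImageSubmodule.
Variables (A : pzRingType) (B C : lmodType A) (u : {linear B -> C}).

Definition lin_image : {pred C} := fun c => `[< exists b, u b = c >].

Lemma lin_image_submod : submod_closed lin_image.
Proof.
split; first by apply/asboolP; exists 0; rewrite linear0.
move=> a c d /asboolP[x <-] /asboolP[y <-]; apply/asboolP.
by exists (a *: x + y); rewrite linearP.
Qed.

HB.instance Definition _ := GRing.isSubmodClosed.Build A C lin_image lin_image_submod.

Definition image_module : Type := {c : C | c \in lin_image}.
HB.instance Definition _ := [isSub of image_module for (@sval _ _)].
HB.instance Definition _ := [Choice of image_module by <:].
HB.instance Definition _ := [SubChoice_isSubZmodule of image_module by <:].
HB.instance Definition _ := [SubZmodule_isSubLmodule of image_module by <:].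

(** [projective_module] only speaks of surjections, so [u] is replaced by its corestriction to the
    image. *)
Lemma projective_lift (P : lmodType A) (phi : {linear P -> C}) :
  projective_module P -> (forall x, exists b, u b = phi x) ->
  exists psi : {linear P -> B}, forall x, u (psi x) = phi x.
Proof.
move=> projP ex.
have uI b : u b \in lin_image by apply/asboolP; exists b.
have phiI x : phi x \in lin_image by apply/asboolP.
pose u' (b : B) : image_module := exist _ (u b) (uI b).
pose phi' (x : P) : image_module := exist _ (phi x) (phiI x).
have lu : linear u' by move=> a x y; apply: val_inj; rewrite /= linearP.
have lphi : linear phi' by move=> a x y; apply: val_inj; rewrite /= linearP.
pose U : {linear B -> image_module} := HB.pack u' (GRing.isLinear.Build A B _ _ u' lu).
pose F : {linear P -> image_module} := HB.pack phi' (GRing.isLinear.Build A P _ _ phi' lphi).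
have [|psi psiE] := projP B image_module U F.
  move=> [c cI]; have /asboolP[b bE] := cI; exists b; apply: val_inj => /=.
  by rewrite bE.
by exists psi => x; have := congr1 val (psiE x).
Qed.

End ImageSubmodule.

(** * Resolutions of length three *)

Section LengthThree.
Variables (A : pzRingType) (M P0 P1 P2 P3 : lmodType A).
Variables (e : {linear P0 -> M}) (d1 : {linear P1 -> P0}) (d2 : {linear P2 -> P1})
  (d3 : {linear P3 -> P2}).
Hypotheses (proj0 : projective_module P0) (proj1 : projective_module P1)
  (proj2 : projective_module P2) (proj3 : projective_module P3).
Hypotheses (e_surj : forall y, exists x, e x = y)
  (exact0 : forall x, e x = 0 <-> exists y, x = d1 y)
  (exact1 : forall x, d1 x = 0 <-> exists y, x = d2 y)
  (exact2 : forall x, d2 x = 0 <-> exists y, x = d3 y)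
  (d3_inj : forall x, d3 x = 0 -> x = 0).

Definition trivial_module : lmodType A := 'rV[A]_0.

Lemma trivial_moduleE (x : trivial_module) : x = 0.
Proof. by apply/rowP => -[]. Qed.

Definition res_obj (i : nat) : lmodType A :=
  match i with 0 => P0 | 1 => P1 | 2 => P2 | 3 => P3 | _ => trivial_module end.

Definition res_diff (i : nat) : {linear res_obj i.+1 -> res_obj i} :=
  match i return {linear res_obj i.+1 -> res_obj i} with
  | 0 => d1 | 1 => d2 | 2 => d3 | _ => \0 end.

Lemma projective_resolution3 : has_projective_resolution M 3.
Proof.
exists res_obj, res_diff, e; split=> //.
- move=> [|[|[|[|i]]]] //= N L g f surj.
  by exists \0 => x; rewrite linear0 (trivial_moduleE x) linear0.
- by move=> [|[|[|[|i]]]] //= _; apply: trivial_moduleE.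
move=> [|[|[|i]]] x; [exact: exact1 | exact: exact2 | |]; split.
- by move=> x0; exists 0; apply: d3_inj.
- by move=> [y ->]; rewrite /= linear0.
- by move=> _; exists 0; apply: trivial_moduleE.
- by [].
Qed.

(* A shorter resolution would make the Koszul-type resolution split at the
   left end: compare the two and use that they are homotopy equivalent. *)
Lemma short_resolution_split m : (m < 3)%N -> has_projective_resolution M m ->
  exists h : {linear P2 -> P3}, forall x, h (d3 x) = - x.
Proof.
move=> m3 [Q [d [aug [projQ Q0 aug_surj aug_exact d_exact]]]].
have Q3 := Q0 3 m3.
have dd1 y : d1 (d2 y) = 0 by apply/exact1; exists y.
have dd2 y : d2 (d3 y) = 0 by apply/exact2; exists y.
have ed y : e (d1 y) = 0 by apply/exact0; exists y.
have qa y : aug (d 0 y) = 0 by apply/aug_exact; exists y.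
have qd i y : d i (d i.+1 y) = 0 by apply/d_exact; exists y.
have [f0 f0E] := projective_lift (u := aug) (phi := e) proj0 (fun x => aug_surj _).
have [f1 f1E] : exists f1 : {linear P1 -> Q 1}, forall x, d 0 (f1 x) = f0 (d1 x).
  apply: (projective_lift (phi := f0 \o d1)) => // x /=.
  have /aug_exact[y ->] : aug (f0 (d1 x)) = 0 by rewrite f0E ed.
  by exists y.
have [f2 f2E] : exists f2 : {linear P2 -> Q 2}, forall x, d 1 (f2 x) = f1 (d2 x).
  apply: (projective_lift (phi := f1 \o d2)) => // x /=.
  have /d_exact[y ->] : d 0 (f1 (d2 x)) = 0 by rewrite f1E dd1 linear0.
  by exists y.
(* The bound on [m] enters here: the next term [Q 3] is zero, so [d 1] is injective. *)
have f2d3 x : f2 (d3 x) = 0.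
  have /d_exact[y ->] : d 1 (f2 (d3 x)) = 0 by rewrite f2E dd2 linear0.
  by rewrite (Q3 y) linear0.
have [g0 g0E] := projective_lift (u := e) (phi := aug) (projQ 0) (fun x => e_surj _).
have [g1 g1E] : exists g1 : {linear Q 1 -> P1}, forall x, d1 (g1 x) = g0 (d 0 x).
  apply: (projective_lift (phi := g0 \o d 0)) => // x /=.
  have /exact0[y ->] : e (g0 (d 0 x)) = 0 by rewrite g0E qa.
  by exists y.
have [g2 g2E] : exists g2 : {linear Q 2 -> P2}, forall x, d2 (g2 x) = g1 (d 1 x).
  apply: (projective_lift (phi := g1 \o d 1)) => // x /=.
  have /exact1[y ->] : d1 (g1 (d 1 x)) = 0 by rewrite g1E qd linear0.
  by exists y.
(* [h0], [h1], [h2] form a homotopy between the identity and the composite of the two comparison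
   maps; on the image of [d3] its last equation loses the term with [f2]. *)
have [h0 h0E] : exists h0 : {linear P0 -> P1}, forall x, d1 (h0 x) = g0 (f0 x) - x.
  apply: (projective_lift (phi := (g0 \o f0) \- idfun)) => // x /=.
  have /exact0[y ->] : e (g0 (f0 x) - x) = 0 by rewrite linearB g0E f0E addrN.
  by exists y.
have [h1 h1E] : exists h1 : {linear P1 -> P2},
    forall x, d2 (h1 x) = g1 (f1 x) - x - h0 (d1 x).
  apply: (projective_lift (phi := ((g1 \o f1) \- idfun) \- (h0 \o d1))) => // x /=.
  have /exact1[y ->] : d1 (g1 (f1 x) - x - h0 (d1 x)) = 0.
    by rewrite !linearB /= h0E g1E f1E addrN.
  by exists y.
have [h2 h2E] : exists h2 : {linear P2 -> P3},
    forall x, d3 (h2 x) = g2 (f2 x) - x - h1 (d2 x).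
  apply: (projective_lift (phi := ((g2 \o f2) \- idfun) \- (h1 \o d2))) => // x /=.
  have /exact2[y ->] : d2 (g2 (f2 x) - x - h1 (d2 x)) = 0.
    by rewrite !linearB /= h1E g2E f2E dd1 linear0 subr0 addrN.
  by exists y.
exists h2 => x; apply/eqP; rewrite -addr_eq0; apply/eqP/d3_inj.
by rewrite linearD h2E f2d3 linear0 dd2 linear0 subr0 sub0r addNr.
Qed.

End LengthThree.

Local Notation "<< x *g k >>" := (mkmalgU k x).

HB.lock Definition malg_ext (T : choiceType) (M V : zmodType) (F : T -> M -> V)
    (v : malg T M) : V :=
  \sum_(k <- monalg.msupp v) F k (monalg.mcoeff k v).

Section MalgExtension.
Variables (T : choiceType) (M V : zmodType).

Lemma malg_ind (S : malg T M -> Prop) : S 0 -> (forall u v, S u -> S v -> S (u + v)) ->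
  (forall x k, S << x *g k >>) -> forall v, S v.
Proof.
move=> S0 SD SU v; rewrite [v]monalgE.
by elim/big_ind: _ => // k _; apply: SU.
Qed.

Lemma malg_additive_ext (f g : malg T M -> V) : {morph f : u v / u + v} ->
  {morph g : u v / u + v} -> (forall x k, f << x *g k >> = g << x *g k >>) ->
  forall v, f v = g v.
Proof.
move=> fD gD fg; have z (h : malg T M -> V) : {morph h : u v / u + v} -> h 0 = 0.
  by move=> hD; apply: (addIr (h 0)); rewrite -hD !add0r.
by elim/malg_ind => [|u v fu fv|x k]; rewrite ?z // fD gD fu fv.
Qed.

Variable F : T -> M -> V.
Hypothesis FD : forall k, {morph F k : x y / x + y}.

Let F0 k : F k 0 = 0.
Proof. by apply: (addIr (F k 0)); rewrite -FD !add0r. Qed.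

Lemma malg_extE (d : {fset T}) v : (monalg.msupp v `<=` d)%fset ->
  malg_ext F v = \sum_(k <- d) F k (monalg.mcoeff k v).
Proof.
by move=> le_d; rewrite malg_ext.unlock (big_fset_incl _ le_d) //= => k _ /mcoeff_outdom ->.
Qed.

Lemma malg_extD : {morph malg_ext F : u v / u + v}.
Proof.
move=> u v; set d := (monalg.msupp u `|` monalg.msupp v)%fset.
have du : (monalg.msupp u `<=` d)%fset by apply: fsubsetUl.
have dv : (monalg.msupp v `<=` d)%fset by apply: fsubsetUr.
have duv : (monalg.msupp (u + v) `<=` d)%fset by apply: monalg.msuppD_le.
rewrite (malg_extE du) (malg_extE dv) (malg_extE duv) -big_split /=.
by apply: eq_bigr => k _; rewrite monalg.mcoeffD FD.
Qed.

Lemma malg_extU x k : malg_ext F << x *g k >> = F k x.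
Proof. by rewrite (malg_extE msuppU_le) big_seq_fset1 mcoeffUU. Qed.

End MalgExtension.

(** * Polynomials with coefficients in a module *)

Section PolynomialModule.
Variables (K : closedFieldType) (gT : finGroupType).
Variable rho : 'I_3 -> character K gT.
Local Notation char := (character K gT).
Local Notation A := (potential_algebra K (mckay_quiver rho)).
Hypothesis sum_rho : \sum_i rho i = 0.
Variable M : lmodType A.

(* M[x_0, x_1, x_2] *)
Definition polymod : Type := malg (multinom 3) M.
HB.instance Definition _ := GRing.Zmodule.on polymod.

Definition pmono (m : multinom 3) (x : M) : polymod := << x *g m >>.

Lemma pmonoD m : {morph pmono m : x y / x + y}.
Proof. exact: monalgUD. Qed.

Lemma pmono0 m : pmono m 0 = 0.
Proof. exact: monalgU0. Qed.

End PolynomialModule.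

(** The operators of the Koszul complex are built from these: the coefficient at [m] is multiplied
    by [a m] and moved to [s m]. Identities between them reduce to identities between [a] and
    [s]. *)
HB.lock Definition pop (K : closedFieldType) (gT : finGroupType)
    (rho : 'I_3 -> character K gT)
    (M : lmodType (potential_algebra K (mckay_quiver rho)))
    (a : multinom 3 -> potential_algebra K (mckay_quiver rho))
    (s : multinom 3 -> multinom 3) (v : polymod M) : polymod M :=
  malg_ext (fun m x => pmono (s m) (a m *: x)) v.

Section PolynomialOperators.
Variables (K : closedFieldType) (gT : finGroupType).
Variable rho : 'I_3 -> character K gT.
Local Notation char := (character K gT).
Local Notation A := (potential_algebra K (mckay_quiver rho)).
Hypothesis sum_rho : \sum_i rho i = 0.
Variable M : lmodType A.
Local Notation polymod := (polymod M).
Local Notation pmono := (@pmono K gT rho M).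
Local Notation pop := (@pop K gT rho M).

Lemma pop_sub (a : multinom 3 -> A) (s : multinom 3 -> multinom 3) m :
  {morph (fun x => pmono (s m) (a m *: x)) : x y / x + y}.
Proof. by move=> x y; rewrite scalerDr pmonoD. Qed.

Lemma popD a s : {morph pop a s : u v / u + v}.
Proof. by rewrite pop.unlock; apply: malg_extD (pop_sub a s). Qed.

Lemma popU a s m x : pop a s (pmono m x) = pmono (s m) (a m *: x).
Proof. by rewrite pop.unlock; apply: malg_extU (pop_sub a s) _ _. Qed.

Lemma polymod_ext (V : zmodType) (f g : polymod -> V) : {morph f : u v / u + v} ->
  {morph g : u v / u + v} -> (forall m x, f (pmono m x) = g (pmono m x)) ->
  forall v, f v = g v.
Proof. by move=> fD gD fg; apply: malg_additive_ext => // x m; apply: fg. Qed.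

Definition pop_eq := @polymod_ext polymod.

Lemma pop_comp a s b t v :
  pop a s (pop b t v) = pop (fun m => a (t m) * b m) (s \o t) v.
Proof.
move: v; apply: pop_eq => [u v|u v|m x]; rewrite ?popD //.
by rewrite !popU scalerA.
Qed.

Lemma eq_pop a s b t v : a =1 b -> s =1 t -> pop a s v = pop b t v.
Proof.
move=> ab st; move: v; apply: pop_eq => [u v|u v|m x]; rewrite ?popD //.
by rewrite !popU ab st.
Qed.

Lemma pop_id v : pop (fun=> 1) id v = v.
Proof. by move: v; apply: pop_eq => [u v|//|m x]; rewrite ?popD // popU scale1r. Qed.

Lemma pop_addl a b s v : pop (fun m => a m + b m) s v = pop a s v + pop b s v.
Proof.
move: v; apply: (pop_eq (g := fun v => pop a s v + pop b s v)) => [u v|u v|m x].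
- by rewrite popD.
- by rewrite !popD addrACA.
- by rewrite !popU scalerDl pmonoD.
Qed.

Lemma pop_zero s v : pop (fun=> 0) s v = 0.
Proof.
move: v; apply: (pop_eq (g := fun=> 0)) => [u v|u v|m x]; rewrite ?popD ?addr0 //.
by rewrite popU scale0r pmono0.
Qed.

Lemma pop_sum (I : finType) (a : I -> multinom 3 -> A) s v :
  \sum_i pop (a i) s v = pop (fun m => \sum_i a i m) s v.
Proof.
elim: (index_enum I) => [|i r IHr].
  by rewrite big_nil -[LHS](pop_zero s v); apply: eq_pop => // m; rewrite big_nil.
rewrite big_cons IHr -pop_addl; apply: eq_pop => // m.
by rewrite big_cons.
Qed.

Definition pscale (c : K) : polymod -> polymod := pop (fun=> scal rho c) id.

Lemma pscaleA b c v : pscale b (pscale c v) = pscale (b * c) v.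
Proof. by rewrite /pscale pop_comp; apply: eq_pop => // m; rewrite scalM. Qed.

Lemma pscale1 : left_id 1 pscale.
Proof. by move=> v; rewrite -[RHS]pop_id; apply: eq_pop => // m; rewrite scal1. Qed.

Lemma pscaleDr : right_distributive pscale +%R.
Proof. by move=> c u v; apply: popD. Qed.

Lemma pscaleDl v : {morph pscale^~ v : b c / b + c}.
Proof. by move=> b c; rewrite /pscale -pop_addl; apply: eq_pop => // m; rewrite scalD. Qed.

HB.instance Definition _ := GRing.Zmodule_isLmodule.Build K polymod
  pscaleA pscale1 pscaleDr pscaleDl.

Lemma pop_linear a s : linear (pop a s).
Proof.
move=> c u v; rewrite popD; congr (_ + _).
rewrite -[c *: u]/(pscale c u) -[c *: pop _ _ _]/(pscale c (pop a s u)) /pscale !pop_comp.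
by apply: eq_pop => // m; rewrite scalC.
Qed.

(* the action on A (x) M (x) chi, tensor product over the span of the idempotents *)
Definition kos_id (chi psi : char) := pop (fun m => idA rho (psi + weight rho m + chi)) id.
Definition kos_var (i : 'I_3) := pop (fun=> 1) (mnm_add (mnm1 i)).

Lemma kos_idM chi psi phi v : kos_id chi psi (kos_id chi phi v) =
  if psi == phi then kos_id chi psi v else 0.
Proof.
rewrite /kos_id pop_comp; case: eqP => [<-|/eqP ne].
  by apply: eq_pop => // m; rewrite idA_mul eqxx.
rewrite -[RHS](pop_zero id v); apply: eq_pop => // m; rewrite idA_mul ifN //.
by rewrite -!addrA (inj_eq (addIr _)).
Qed.

Lemma kos_id_sum chi v : \sum_psi kos_id chi psi v = v.
Proof.
rewrite pop_sum -[RHS]pop_id; apply: eq_pop => // m; rewrite -sum_idA.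
rewrite [RHS](reindex_inj (addIr (weight rho m + chi))) /=.
by apply: eq_bigr => psi _; rewrite addrA.
Qed.

Lemma kos_id_var chi psi i v :
  kos_id chi psi (kos_var i v) = kos_var i (kos_id chi (psi + rho i) v).
Proof.
rewrite /kos_id /kos_var !pop_comp; apply: eq_pop => // m.
by rewrite mulr1 mul1r weightD weight1 addrA.
Qed.

Lemma kos_varC i j v : kos_var i (kos_var j v) = kos_var j (kos_var i v).
Proof.
by rewrite /kos_var !pop_comp; apply: eq_pop => // m /=;
  rewrite addmA [mnm_add (mnm1 i) _]addmC -addmA.
Qed.

Definition kos_ops chi : mckay_ops rho polymod :=
  McKayOps (fun psi => pop_linear _ _) (fun i => pop_linear _ _)
    (kos_idM chi) (kos_id_sum chi) (kos_id_var chi) kos_varC.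

Definition kos_mod chi : lmodType A := ops_module sum_rho (kos_ops chi).

End PolynomialOperators.

(* The Koszul complex of three commuting operators D_i with sections e_i of
   the quotients by their images, as for D_i = x_i - X_i on M[x_0, x_1, x_2]
   and e_i the substitution x_i := X_i *)
Section AbstractKoszul.
Variables (V : zmodType) (D e : 'I_3 -> {additive V -> V}).
Hypothesis D_inj : forall i v, D i v = 0 -> v = 0.
Hypothesis DC : forall i j v, D i (D j v) = D j (D i v).
Hypothesis eD0 : forall i v, e i (D i v) = 0.
Hypothesis eDC : forall i j v, i != j -> e i (D j v) = D j (e i v).
Hypothesis e_id : forall i v, exists y, v - e i v = D i y.

Lemma koszul_ker i v : e i v = 0 -> exists y, v = D i y.
Proof. by move=> ev; have [y] := e_id i v; rewrite ev subr0; exists y. Qed.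

Lemma koszul_eq i u v : D i u = D i v -> u = v.
Proof.
by move=> uv; apply/eqP; rewrite -subr_eq0; apply/eqP; apply: (@D_inj i); rewrite raddfB uv subrr.
Qed.

(** Applying [e i] to the first equation gives [D j (e i a) = 0], so [a] is divisible by [D i]; the
    quotient also serves for [b] and [c] because [D i] is injective. *)
Lemma koszul_exact2 (i j k : 'I_3) a b c : j != i ->
  D i b = D j a -> D i c = D k a -> exists u, [/\ a = D i u, b = D j u & c = D k u].
Proof.
move=> ji ab ac; have [u uE] : exists u, a = D i u.
  by apply: koszul_ker; apply: (@D_inj j); rewrite -eDC 1?eq_sym // -ab eD0.
exists u; split=> //; apply: (@koszul_eq i).
  by rewrite ab uE DC.
by rewrite ac uE DC.
Qed.

(** Modulo the images of [D i] and [D j] the operator [D k] stays injective, so [c] lies in the sum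
    of these images; subtracting the corresponding boundary leaves the case of two operators. *)
Lemma koszul_exact1 (i j k : 'I_3) a b c : i != j -> i != k -> j != k ->
  D i a + D j b + D k c = 0 ->
  exists p q r, [/\ a = D j r - D k q, b = D k p - D i r & c = D i q - D j p].
Proof.
move=> ij ik jk e0.
have ce : e j (e i c) = 0.
  apply: (@D_inj k); rewrite -eDC // -eDC //.
  have := congr1 (e j \o e i) e0; rewrite /= !raddfD !raddf0 eD0 (eDC _ ij) raddf0 add0r eD0 add0r.
  by [].
have [q qE] := e_id i c; have [p pE] := koszul_ker ce.
have cE : c = D i q - D j (- p).
  by rewrite raddfN opprK -pE -qE subrK.
have eq : D i (a + D k q) = D j (D k (- p) - b).
  rewrite raddfD raddfB; apply/eqP; rewrite -subr_eq0 -[X in _ == X]e0 cE raddfB.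
  rewrite (DC k i) (DC k j) opprB; apply/eqP.
  by rewrite -!addrA; congr (_ + _); rewrite addrC -addrA; congr (_ + _); rewrite addrC.
have [r rE] : exists r, D k (- p) - b = D i r.
  by apply: koszul_ker; apply: (@D_inj j); rewrite -eDC // -eq eD0.
exists (- p), q, r; split=> //.
- apply: (@koszul_eq i); move: eq; rewrite rE raddfD => eq.
  by rewrite raddfB (DC i j) -eq (DC i k) addrK.
- by rewrite -rE opprB addrC subrK.
Qed.

Lemma koszul_exact0 (i j k : 'I_3) v : e k (e j (e i v)) = 0 ->
  exists a b c, v = D i a + D j b + D k c.
Proof.
have [a aE] := e_id i v; have [b bE] := e_id j (e i v).
move=> /koszul_ker[c cE]; exists a, b, c.
by rewrite -aE -bE -cE -addrA subrK subrK.
Qed.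

End AbstractKoszul.

Lemma mcoeff_malgU_scale (T : choiceType) (R : pzRingType) (N : lmodType R) (a : R) (x : N)
    (k m : T) :
  monalg.mcoeff m (mkmalgU k (a *: x)) = a *: monalg.mcoeff m (mkmalgU k x).
Proof. by rewrite !monalg.mcoeffU scalerMnr. Qed.

Section KoszulComplex.
Variables (K : closedFieldType) (gT : finGroupType).
Variable rho : 'I_3 -> character K gT.
Local Notation char := (character K gT).
Local Notation A := (potential_algebra K (mckay_quiver rho)).
Hypothesis sum_rho : \sum_i rho i = 0.
Variable M : lmodType A.
Local Notation polymod := (polymod M).
Local Notation pmono := (@pmono K gT rho M).
Local Notation pop := (@pop K gT rho M).
Local Notation Kos := (kos_mod sum_rho M).

Definition kos_act (i : 'I_3) : polymod -> polymod := pop (fun=> varA rho i) id.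
Definition kos_D (i : 'I_3) (v : polymod) : polymod := kos_var i v - kos_act i v.

Definition clear_mnm (i : 'I_3) (m : multinom 3) : multinom 3 :=
  Multinom [tuple (if j == i then 0 else m j)%N | j < 3].

Definition kos_ev (i : 'I_3) : polymod -> polymod :=
  pop (fun m => varA rho i ^+ m i) (clear_mnm i).

Lemma popB a s : {morph pop a s : u v / u - v}.
Proof.
have p0 : pop a s 0 = 0 by apply: (addIr (pop a s 0)); rewrite -popD !add0r.
have pN w : pop a s (- w) = - pop a s w.
  by apply/eqP; rewrite -addr_eq0 -popD addNr p0.
by move=> u v; rewrite popD pN.
Qed.

HB.instance Definition _ a s :=
  GRing.isZmodMorphism.Build polymod polymod (pop a s) (popB a s).

Lemma kos_varB i : zmod_morphism (kos_var i : polymod -> polymod).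
Proof. exact: popB. Qed.

HB.instance Definition _ i :=
  GRing.isZmodMorphism.Build polymod polymod (kos_var i) (kos_varB i).

Lemma kos_actB i : zmod_morphism (kos_act i).
Proof. exact: popB. Qed.

HB.instance Definition _ i :=
  GRing.isZmodMorphism.Build polymod polymod (kos_act i) (kos_actB i).

Lemma kos_DB i : zmod_morphism (kos_D i).
Proof.
move=> u v; rewrite /kos_D kos_varB kos_actB !opprB [LHS]addrACA [RHS]addrACA.
by congr (_ + _); rewrite addrC.
Qed.

HB.instance Definition _ i :=
  GRing.isZmodMorphism.Build polymod polymod (kos_D i) (kos_DB i).

Lemma kos_evB i : zmod_morphism (kos_ev i).
Proof. exact: popB. Qed.

HB.instance Definition _ i :=
  GRing.isZmodMorphism.Build polymod polymod (kos_ev i) (kos_evB i).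

Lemma kos_actC i j v : kos_act i (kos_act j v) = kos_act j (kos_act i v).
Proof. by rewrite /kos_act !pop_comp; apply: eq_pop => // m; apply: varC. Qed.

Lemma kos_act_var i j v : kos_act i (kos_var j v) = kos_var j (kos_act i v).
Proof. by rewrite /kos_act /kos_var !pop_comp; apply: eq_pop => // m; rewrite mulr1 mul1r. Qed.

Lemma kos_DC i j v : kos_D i (kos_D j v) = kos_D j (kos_D i v).
Proof.
rewrite /kos_D !kos_varB !kos_actB !kos_act_var kos_varC kos_actC !opprB.
by rewrite [LHS]addrACA [RHS]addrACA; congr (_ + _); rewrite addrC.
Qed.

Lemma clear_mnmD1 i m : clear_mnm i (mnm_add (mnm1 i) m) = clear_mnm i m.
Proof.
apply/mnmP => j; rewrite !mnmE; by case: (eqVneq j i).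
Qed.

Lemma kos_evD0 i v : kos_ev i (kos_D i v) = 0.
Proof.
rewrite /kos_D /kos_ev popB /kos_var /kos_act !pop_comp; apply/eqP; rewrite subr_eq0; apply/eqP.
apply: eq_pop => m /=; last by rewrite clear_mnmD1.
by rewrite mulr1 mnmDE mnm1E eqxx add1n exprSr.
Qed.

Lemma kos_evDC i j v : i != j -> kos_ev i (kos_D j v) = kos_D j (kos_ev i v).
Proof.
move=> ij; rewrite /kos_D /kos_ev popB /kos_var /kos_act !pop_comp.
congr (_ - _); apply: eq_pop => m /=.
- by rewrite mulr1 mul1r mnmDE mnm1E eq_sym (negPf ij) add0n.
- apply/mnmP => k; rewrite !mnmE; case: (eqVneq k i) => // ->.
  by rewrite eq_sym (negPf ij).
- by apply/esym/commrX/varC.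
- by [].
Qed.

(** Modulo the image of [kos_D i] a factor of the variable can be traded for its action on [M]; this
    is repeated until the variable has disappeared. *)
Lemma kos_ev_id i v : exists y, v - kos_ev i v = kos_D i y.
Proof.
elim/malg_ind: v => [|u v [y yE] [z zE]|x m].
- by exists 0; rewrite (raddf0 (kos_ev i)) (raddf0 (kos_D i)) subrr.
- by exists (y + z); rewrite (raddfD (kos_ev i)) (raddfD (kos_D i)) /= -yE -zE addrACA -opprD.
rewrite -/(pmono m x); move: {2}(m i) (erefl (m i)) => n.
elim: n m x => [|n IHn] m x mi.
  exists 0; rewrite /kos_ev popU mi expr0 scale1r.
  have -> : clear_mnm i m = m.
    by apply/mnmP => j; rewrite mnmE; case: eqP => // ->; rewrite mi.
  by rewrite subrr (raddf0 (kos_D i)).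
have [m' mE] : exists m', m = mnm_add (mnm1 i) m'.
  by exists (mnm_sub m (mnm1 i)); rewrite addmC submK // lep1mP mi.
move: mi; rewrite {m}mE mnmDE mnm1E eqxx add1n => -[m'i].
have [y yE] := IHn m' (varA rho i *: x) m'i.
have varE : kos_var i (pmono m' x) = pmono (mnm_add (mnm1 i) m') x.
  by rewrite /kos_var popU scale1r.
have actE : kos_act i (pmono m' x) = pmono m' (varA rho i *: x).
  exact: popU.
exists (y + pmono m' x); rewrite (raddfD (kos_D i)) /= -yE -actE -varE.
have -> : kos_ev i (kos_var i (pmono m' x)) = kos_ev i (kos_act i (pmono m' x)).
  by apply/eqP; rewrite -subr_eq0 -kos_evB kos_evD0.
by rewrite /kos_D [RHS]addrC addrA subrK.
Qed.

Lemma mcoeff_kos_var i (v : polymod) m :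
  monalg.mcoeff (mnm_add (mnm1 i) m) (kos_var i v) = monalg.mcoeff m v.
Proof.
move: v; apply: malg_additive_ext => [u v|u v|x k].
- by rewrite (raddfD (kos_var i)) /= monalg.mcoeffD.
- by rewrite monalg.mcoeffD.
by rewrite -/(pmono k x) /kos_var popU scale1r /pmono !monalg.mcoeffU eqm_add2l.
Qed.

Lemma mcoeff_kos_act i (v : polymod) m :
  monalg.mcoeff m (kos_act i v) = varA rho i *: monalg.mcoeff m v.
Proof.
move: v; apply: malg_additive_ext => [u v|u v|x k].
- by rewrite /kos_act popD monalg.mcoeffD.
- by rewrite monalg.mcoeffD scalerDr.
have -> : kos_act i (mkmalgU k x) = mkmalgU k (varA rho i *: x) by exact: popU.
exact: mcoeff_malgU_scale.
Qed.

(** In the kernel each coefficient is [varA rho i] times the next one in the direction [i], and the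
    support is finite. *)
Lemma kos_D_inj i v : kos_D i v = 0 -> v = 0.
Proof.
move=> /eqP; rewrite subr_eq0 => /eqP e.
have step m : monalg.mcoeff m v = varA rho i *: monalg.mcoeff (mnm_add (mnm1 i) m) v.
  by rewrite -mcoeff_kos_act -e mcoeff_kos_var.
have steps n m : monalg.mcoeff m v = varA rho i ^+ n *:
    monalg.mcoeff (mnm_add (mnm_muln (mnm1 i) n) m) v.
  elim: n m => [|n IHn] m; first by rewrite scale1r mulm0n add0m.
  by rewrite step IHn scalerA -exprS mulmSr -addmA.
apply/malgP => m; rewrite monalg.mcoeff0.
pose n := (\max_(k <- monalg.msupp v) k i).+1.
rewrite (steps n) monalg.mcoeff_outdom ?scaler0 //; apply/negP => mv.
have : (mnm_add (mnm_muln (mnm1 i) n) m i <= \max_(k <- monalg.msupp v) k i)%N.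
  by rewrite (bigD1_seq _ mv) ?fset_uniq //= leq_maxl.
by rewrite mnmDE mulmnE mnm1E eqxx mul1n /n addSn ltnNge leq_addr.
Qed.

End KoszulComplex.

Local Opaque potential_algebra.

Lemma scaler_sub_add (R : pzRingType) (V : lmodType R) (a : R) (x y z w : V) :
  (a *: x + y) - (a *: z + w) = a *: (x - z) + (y - w).
Proof. by rewrite scalerBr opprD addrACA. Qed.

Lemma sub_cycle3 (V : zmodType) (x y z : V) : (x - y) + (z - x) + (y - z) = 0.
Proof. by rewrite [x - y + _]addrC !subrKA subrr. Qed.

HB.lock Definition kos_aug (K : closedFieldType) (gT : finGroupType)
    (rho : 'I_3 -> character K gT)
    (M : lmodType (potential_algebra K (mckay_quiver rho))) (v : polymod M) : M :=
  malg_ext (fun m x => monA rho m *: x) v.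

(** * The Koszul resolution of a module *)

Section KoszulMaps.
Variables (K : closedFieldType) (gT : finGroupType).
Variable rho : 'I_3 -> character K gT.
Local Notation char := (character K gT).
Local Notation A := (potential_algebra K (mckay_quiver rho)).
Hypothesis sum_rho : \sum_i rho i = 0.
Variable M : lmodType A.
Local Notation polymod := (polymod M).
Local Notation pmono := (@pmono K gT rho M).
Local Notation pop := (@pop K gT rho M).
Local Notation Kos := (kos_mod sum_rho M).
Local Notation i0 := (inord 0 : 'I_3).
Local Notation i1 := (inord 1 : 'I_3).
Local Notation i2 := (inord 2 : 'I_3).

Lemma kos_scal chi c (v : Kos chi) : scal rho c *: v = pop (fun=> scal rho c) id v.
Proof. exact: scal_act. Qed.

Lemma kos_idA chi psi (v : Kos chi) : idA rho psi *: v = kos_id chi psi v.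
Proof. exact: idA_act. Qed.

Lemma kos_varA chi i (v : Kos chi) : varA rho i *: v = kos_var i v.
Proof. exact: varA_act. Qed.

(** Both terms of [kos_D i] move the idempotents by [rho i], which the twist absorbs; this dictates
    the twists in [kos_P1], [kos_P2] and [kos_P3]. The equation on [chi'] leaves the order of the
    summands free. *)
Lemma kos_D_linear i chi chi' : chi' = chi + rho i -> linear (kos_D i : Kos chi' -> Kos chi).
Proof.
move=> ->; apply: (alg_linear sum_rho) => [u v|c v|psi v|j v].
- exact: (raddfD (kos_D i)).
- rewrite !kos_scal -[LHS]/(kos_D i _) /kos_D -[RHS]/(pop _ _ (_ - _)) popB.
  rewrite /kos_var /kos_act !pop_comp; congr (_ - _); apply: eq_pop => // m.
    by rewrite mulr1 mul1r.
  by rewrite scalC.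
- rewrite !kos_idA -[LHS]/(kos_D i _) /kos_D -[RHS]/(kos_id _ _ (_ - _)).
  rewrite /kos_id popB /kos_var /kos_act !pop_comp; congr (_ - _); apply: eq_pop => // m.
    by rewrite mulr1 mul1r weightD weight1 addrACA [rho i + _]addrC [in RHS]addrAC !addrA addrAC.
  by rewrite idA_varC -!addrA.
- rewrite !kos_varA -[LHS]/(kos_D i _) /kos_D -[RHS]/(kos_var _ (_ - _)) kos_varB.
  by rewrite kos_varC kos_act_var.
Qed.

Local Notation kos_aug := (@kos_aug K gT rho M).

Lemma kos_augD : {morph kos_aug : u v / u + v}.
Proof. by rewrite kos_aug.unlock; apply: malg_extD => m x y; apply: scalerDr. Qed.

Lemma kos_augU m x : kos_aug (pmono m x) = monA rho m *: x.
Proof. by rewrite kos_aug.unlock; apply: malg_extU => k y z; apply: scalerDr. Qed.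

Lemma kos_aug_var i v : kos_aug (kos_var i v) = varA rho i *: kos_aug v.
Proof.
move: v; apply: polymod_ext => [u v|u v|m x].
- by rewrite (raddfD (kos_var i)) kos_augD.
- by rewrite kos_augD scalerDr.
rewrite [kos_var i _]popU [LHS]kos_augU scale1r [kos_aug _]kos_augU scalerA.
by rewrite (monA1 sum_rho).
Qed.

Lemma kos_aug_scal c v : kos_aug (pop (fun=> scal rho c) id v) = scal rho c *: kos_aug v.
Proof.
move: v; apply: polymod_ext => [u v|u v|m x].
- by rewrite popD kos_augD.
- by rewrite kos_augD scalerDr.
rewrite popU [LHS]kos_augU [in RHS]kos_augU.
rewrite [LHS]scalerA [RHS]scalerA.
by rewrite scalC.
Qed.

Lemma kos_aug_linear : linear (kos_aug : Kos 0 -> M).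
Proof.
apply: (alg_linear sum_rho) => [u v|c v|psi v|j v].
- exact: kos_augD.
- by rewrite kos_scal kos_aug_scal.
- rewrite kos_idA; move: v; apply: polymod_ext => [u v|u v|m x].
  + by rewrite /kos_id popD kos_augD.
  + by rewrite kos_augD scalerDr.
  rewrite [kos_id _ _ _]popU [LHS]kos_augU [in RHS]kos_augU.
  rewrite [LHS]scalerA [RHS]scalerA addr0.
  by rewrite idA_mon.
- by rewrite kos_varA kos_aug_var.
Qed.

Lemma kos_aug_surj x : exists v, kos_aug v = x.
Proof. by exists (pmono mnm0 x); rewrite kos_augU monA0 scale1r. Qed.

(** Substituting all three variables leaves only a constant term, so the kernel of the augmentation
    is that of the composed [kos_ev], as [koszul_exact0] needs. *)
Lemma kos_ev_aug v : kos_ev (inord 2) (kos_ev (inord 1) (kos_ev (inord 0) v)) =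
  pmono mnm0 (kos_aug v).
Proof.
move: v; apply: polymod_ext => [u v|u v|m x].
- by rewrite /kos_ev !popD.
- by rewrite kos_augD pmonoD.
rewrite [kos_ev i0 _]popU [kos_ev i1 _]popU [LHS]popU [in RHS]kos_augU.
have c1 : clear_mnm i0 m i1 = m i1 by rewrite mnmE I3_eq.
have c2 : clear_mnm i1 (clear_mnm i0 m) i2 = m i2 by rewrite !mnmE !I3_eq.
have c3 : clear_mnm i2 (clear_mnm i1 (clear_mnm i0 m)) = mnm0.
  by apply/mnmP => j; rewrite !mnmE; case: (I3_cases j) => ->; rewrite !I3_eq.
have mE : monA rho m = varA rho i2 ^+ m i2 * (varA rho i1 ^+ m i1 * varA rho i0 ^+ m i0).
  have cX i j p q : varA rho i ^+ p * varA rho j ^+ q = varA rho j ^+ q * varA rho i ^+ p.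
    by apply/commrX/commr_sym/commrX/varC.
  by rewrite monAE (cX i0 i1) -mulrA (cX i0 i2) mulrA (cX i1 i2) -mulrA.
rewrite c1 c2 c3 mE.
exact: (congr1 (pmono mnm0) (etrans (congr1 _ (scalerA _ _ _)) (scalerA _ _ _))).
Qed.

Lemma kos_exact0 v : kos_aug v = 0 -> exists a b c,
  v = kos_D i0 a + kos_D i1 b + kos_D i2 c.
Proof.
move=> v0; apply: (koszul_exact0 (D := fun i => kos_D i) (e := fun i => kos_ev i)).
  exact: kos_ev_id.
rewrite -[LHS]/(kos_ev i2 (kos_ev i1 (kos_ev i0 v))).
by rewrite kos_ev_aug v0 pmono0.
Qed.

Local Notation r0 := (rho i0).
Local Notation r1 := (rho i1).
Local Notation r2 := (rho i2).

(** One summand for each set of variables, twisted by the sum of their [rho i]; in [kos_P2] the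
    summands are listed by the missing variable. The twist of [kos_P3] is 0 by [sum_rho] but left as
    a sum to fit [kos_D_linear]. *)
Definition kos_P1 : lmodType A := (Kos r0 * Kos r1 * Kos r2)%type.
Definition kos_P2 : lmodType A := (Kos (r1 + r2)%R * Kos (r0 + r2)%R * Kos (r0 + r1)%R)%type.
Definition kos_P3 : lmodType A := Kos (r0 + r1 + r2).

(** [kos_d1], [kos_d2] and [kos_d3] are divergence, curl and gradient for the operators [kos_D]. *)
Definition kos_d1 (v : kos_P1) : Kos 0 :=
  kos_D i0 v.1.1 + kos_D i1 v.1.2 + kos_D i2 v.2.

Definition kos_d2 (v : kos_P2) : kos_P1 :=
  (kos_D i1 v.2 - kos_D i2 v.1.2, kos_D i2 v.1.1 - kos_D i0 v.2,
   kos_D i0 v.1.2 - kos_D i1 v.1.1).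

Definition kos_d3 (v : kos_P3) : kos_P2 := (kos_D i0 v, kos_D i1 v, kos_D i2 v).

Lemma kos_d1_linear : linear kos_d1.
Proof.
have l0 := @kos_D_linear i0 0 r0 (esym (add0r r0)).
have l1 := @kos_D_linear i1 0 r1 (esym (add0r r1)).
have l2 := @kos_D_linear i2 0 r2 (esym (add0r r2)).
move=> a u v; apply: (etrans (congr2 _ (congr2 _ (l0 a _ _) (l1 a _ _)) (l2 a _ _))).
rewrite /kos_d1 [in RHS]scalerDr [in RHS]scalerDr.
rewrite [X in X + _ = _]addrACA [LHS]addrACA.
by [].
Qed.

Lemma kos_d2_linear : linear kos_d2.
Proof.
have l12 := @kos_D_linear i1 r0 (r0 + r1) erefl.
have l21 := @kos_D_linear i2 r0 (r0 + r2) erefl.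
have l20 := @kos_D_linear i2 r1 (r1 + r2) erefl.
have l02 := @kos_D_linear i0 r1 (r0 + r1) (addrC _ _).
have l01 := @kos_D_linear i0 r2 (r0 + r2) (addrC _ _).
have l10 := @kos_D_linear i1 r2 (r1 + r2) (addrC _ _).
move=> a u v; congr (_, _, _).
- exact: (etrans (congr2 (fun x y => x - y) (l12 a _ _) (l21 a _ _)) (scaler_sub_add _ _ _ _ _)).
- exact: (etrans (congr2 (fun x y => x - y) (l20 a _ _) (l02 a _ _)) (scaler_sub_add _ _ _ _ _)).
- exact: (etrans (congr2 (fun x y => x - y) (l01 a _ _) (l10 a _ _)) (scaler_sub_add _ _ _ _ _)).
Qed.

Lemma kos_d3_linear : linear kos_d3.
Proof.
have l0 := @kos_D_linear i0 (r1 + r2) (r0 + r1 + r2) (etrans (esym (addrA _ _ _)) (addrC _ _)).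
have l1 := @kos_D_linear i1 (r0 + r2) (r0 + r1 + r2) (addrAC _ _ _).
have l2 := @kos_D_linear i2 (r0 + r1) (r0 + r1 + r2) erefl.
by move=> a u v; congr (_, _, _); [apply: l0 | apply: l1 | apply: l2].
Qed.

Let kos_exact1 := @koszul_exact1 _ (fun i => kos_D i) (fun i => kos_ev i)
  (@kos_D_inj _ _ _ M) (@kos_DC _ _ _ sum_rho M) (@kos_evD0 _ _ _ M)
  (@kos_evDC _ _ _ sum_rho M) (@kos_ev_id _ _ _ M).

Let kos_exact2 := @koszul_exact2 _ (fun i => kos_D i) (fun i => kos_ev i)
  (@kos_D_inj _ _ _ M) (@kos_DC _ _ _ sum_rho M) (@kos_evD0 _ _ _ M)
  (@kos_evDC _ _ _ sum_rho M) (@kos_ev_id _ _ _ M).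

Lemma kos_d1_exact v : kos_d1 v = 0 <-> exists w, v = kos_d2 w.
Proof.
have n01 : i0 != i1 by rewrite I3_eq.
have n02 : i0 != i2 by rewrite I3_eq.
have n12 : i1 != i2 by rewrite I3_eq.
split=> [v0|[[[a b] c] ->]].
  have [p [q [r [e1 e2 e3]]]] := kos_exact1 n01 n02 n12 v0.
  by exists (p, q, r); case: v {v0} e1 e2 e3 => [[a b] c] /= -> -> ->.
apply: (etrans (congr2 _ (congr2 _ (kos_DB i0 _ _) (kos_DB i1 _ _)) (kos_DB i2 _ _))).
rewrite (kos_DC sum_rho i1 i0) (kos_DC sum_rho i2 i0) (kos_DC sum_rho i2 i1).
exact: sub_cycle3.
Qed.

Lemma kos_d2_exact v : kos_d2 v = 0 <-> exists w, v = kos_d3 w.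
Proof.
have n10 : i1 != i0 by rewrite I3_eq.
split=> [v0|[w ->]].
  have e1 : kos_D i1 v.2 = kos_D i2 v.1.2 := subr0_eq (congr1 (fun w : kos_P1 => w.1.1) v0).
  have e2 : kos_D i2 v.1.1 = kos_D i0 v.2 := subr0_eq (congr1 (fun w : kos_P1 => w.1.2) v0).
  have e3 : kos_D i0 v.1.2 = kos_D i1 v.1.1 := subr0_eq (congr1 (fun w : kos_P1 => w.2) v0).
  have [u [ea eb ec]] := kos_exact2 n10 e3 (esym e2).
  by exists u; case: v {v0 e1 e2 e3} ea eb ec => [[a b] c] /= -> -> ->.
have sub0 i j u : kos_D i (kos_D j u) - kos_D j (kos_D i u) = 0 :> polymod.
  by rewrite (kos_DC sum_rho i j) subrr.
exact: (congr2 pair (congr2 pair (sub0 i1 i2 w) (sub0 i2 i0 w)) (sub0 i0 i1 w)).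
Qed.

Lemma kos_d3_inj v : kos_d3 v = 0 -> v = 0.
Proof. by move=> v0; apply: (@kos_D_inj _ _ _ _ i0);
  apply: (congr1 (fun w : kos_P2 => w.1.1) v0). Qed.

Lemma kos_aug_exact v : kos_aug v = 0 <-> exists w, v = kos_d1 w.
Proof.
split=> [/kos_exact0[a [b [c ->]]]|[w ->]]; first by exists (a, b, c).
have aN : {morph kos_aug : u v / u - v}.
  have a0 : kos_aug 0 = 0 by apply: (addIr (kos_aug 0)); rewrite -kos_augD !add0r.
  have aN u : kos_aug (- u) = - kos_aug u.
    by apply/eqP; rewrite -addr_eq0 -kos_augD addNr a0.
  by move=> u x; rewrite kos_augD aN.
have aD i u : kos_aug (kos_D i u) = 0.
  rewrite aN kos_aug_var; apply/eqP; rewrite subr_eq0; apply/eqP.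
  move: u; apply: polymod_ext => [u x|u x|m x].
  - by rewrite kos_augD scalerDr.
  - by rewrite (raddfD (kos_act i)) kos_augD.
  rewrite [kos_act i _]popU.
  apply: etrans (congr1 _ (kos_augU m x)) (etrans (scalerA _ _ _) _).
  apply/esym/(etrans (kos_augU _ _))/(etrans (scalerA _ _ _)).
  by rewrite (comm_var_mon sum_rho).
rewrite /kos_d1 kos_augD aD addr0 kos_augD.
by rewrite (aD i0) (aD i1) addr0.
Qed.

Lemma koszul_resolution :
  projective_module (Kos 0) -> projective_module kos_P1 ->
  projective_module kos_P2 -> projective_module kos_P3 ->
  has_projective_resolution M 3 /\
  forall m, (m < 3)%N -> has_projective_resolution M m ->
    exists h : {linear kos_P2 -> kos_P3}, forall v, h (kos_d3 v) = - v.
Proof.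
move=> p0 p1 p2 p3; split=> [|m m3 res].
  apply: (projective_resolution3 (e := linear_of kos_aug_linear)
    (d1 := linear_of kos_d1_linear) (d2 := linear_of kos_d2_linear)
    (d3 := linear_of kos_d3_linear)) => //.
  - exact: kos_aug_surj.
  - exact: kos_aug_exact.
  - exact: kos_d1_exact.
  - exact: kos_d2_exact.
  - exact: kos_d3_inj.
apply: (short_resolution_split (e := linear_of kos_aug_linear)
    (d1 := linear_of kos_d1_linear) (d2 := linear_of kos_d2_linear)
    (d3 := linear_of kos_d3_linear) _ _ _ _ _ _ _ _ m3 res) => //.
- exact: kos_aug_surj.
- exact: kos_aug_exact.
- exact: kos_d1_exact.
- exact: kos_d2_exact.
- exact: kos_d3_inj.
Qed.

End KoszulMaps.

Lemma projective_prod (R : pzRingType) (P Q : lmodType R) :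
  projective_module P -> projective_module Q -> projective_module (P * Q)%type.
Proof.
move=> projP projQ M N g f surj.
have lP : linear (fun x : P => f (x, 0)).
  by move=> a u v; rewrite -linearP; congr (f (_, _)); rewrite /= scaler0 addr0.
have lQ : linear (fun y : Q => f (0, y)).
  by move=> a u v; rewrite -linearP; congr (f (_, _)); rewrite /= scaler0 addr0.
have [hP hPE] := projP M N g (linear_of lP) surj.
have [hQ hQE] := projQ M N g (linear_of lQ) surj.
have lh : linear (fun v : P * Q => hP v.1 + hQ v.2).
  by move=> a u v; rewrite /= !linearP scalerDr addrACA.
exists (linear_of lh) => -[x y]; rewrite /= linearD hPE hQE /= -linearD.
by congr (f (_, _)); rewrite ?addr0 ?add0r.
Qed.

(** * Finite-dimensional modules: projectivity and traces *)

Section FiniteDimensional.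
Variables (K : closedFieldType) (gT : finGroupType).
Variable rho : 'I_3 -> character K gT.
Local Notation char := (character K gT).
Local Notation A := (potential_algebra K (mckay_quiver rho)).
Local Notation i0 := (inord 0 : 'I_3).
Local Notation i1 := (inord 1 : 'I_3).
Local Notation i2 := (inord 2 : 'I_3).
Hypothesis sum_rho : \sum_i rho i = 0.
Variable M : lmodType A.
Local Notation polymod := (polymod M).
Local Notation pmono := (@pmono K gT rho M).
Local Notation pop := (@pop K gT rho M).
Local Notation Kos := (kos_mod sum_rho M).
Variables (d : nat) (b : 'I_d -> M) (co : 'I_d -> M -> K).
Hypothesis coP : forall j c x y, co j (scal rho c *: x + y) = c * co j x + co j y.
Hypothesis co_expand : forall x, x = \sum_j scal rho (co j x) *: b j.

Lemma coD j x y : co j (x + y) = co j x + co j y.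
Proof. by have := coP j 1 x y; rewrite scal1 scale1r mul1r. Qed.

Lemma co0 j : co j 0 = 0.
Proof. by apply: (addIr (co j 0)); rewrite -coD !add0r. Qed.

Lemma coZ j c x : co j (scal rho c *: x) = c * co j x.
Proof. by have := coP j c x 0; rewrite co0 !addr0. Qed.

Lemma kos_mono_scal chi c m x :
  scal rho c *: (pmono m x : Kos chi) = pmono m (scal rho c *: x).
Proof. exact: etrans (kos_scal _ _) (popU _ _ _ _). Qed.

Lemma kos_mono_id chi psi m x :
  idA rho psi *: (pmono m x : Kos chi) = pmono m (idA rho (psi + weight rho m + chi) *: x).
Proof. exact: etrans (kos_idA _ _) (popU _ _ _ _). Qed.

Lemma kos_mono_var chi i m x :
  varA rho i *: (pmono m x : Kos chi) = pmono (mnm_add (mnm1 i) m) x.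
Proof.
apply: etrans (kos_varA _ _) (etrans (popU _ _ _ _) _).
exact: (congr1 (pmono _) (scale1r x)).
Qed.

Lemma kos_mono_varX chi i n m x :
  varA rho i ^+ n *: (pmono m x : Kos chi) = pmono (mnm_add (mnm_muln (mnm1 i) n) m) x.
Proof.
elim: n m => [|n IHn] m; first by rewrite expr0 mulm0n add0m; exact: scale1r.
rewrite exprS; apply: etrans (esym (scalerA _ _ _)) _.
rewrite IHn; apply: etrans (kos_mono_var _ _ _ _) _.
by rewrite mulmS addmA.
Qed.

Lemma kos_mono_mon chi m x : monA rho m *: (pmono mnm0 x : Kos chi) = pmono m x.
Proof.
rewrite monAE; apply: etrans (esym (scalerA _ _ _)) _.
apply: etrans (esym (scalerA _ _ _)) _; rewrite !kos_mono_varX.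
congr (pmono _ _); apply/mnmP => j; rewrite !mnmDE !mulmnE !mnm1E mnm0E.
by case: (I3_cases j) => ->; rewrite !I3_eq //= ?mul1n ?mul0n ?addn0 ?add0n.
Qed.

(** The constants [pmono mnm0 x] with [x] fixed by [idA rho (phi + chi)] generate copies of the left
    ideal of [idA rho phi], and the module is the direct sum of these. A lift only has to be chosen
    on constants. *)
Lemma kos_projective chi : projective_module (Kos chi).
Proof.
move=> N' N g f surj.
have [n nE] := choice (fun j => surj (f (pmono mnm0 (b j)))).
pose l (x : M) : N' := \sum_j scal rho (co j x) *: n j.
have lD : {morph l : x y / x + y}.
  move=> x y; rewrite /l -big_split /=; apply: eq_bigr => j _.
  by rewrite coD scalD scalerDl.
have lZ c x : l (scal rho c *: x) = scal rho c *: l x.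
  rewrite /l scaler_sumr; apply: eq_bigr => j _.
  by rewrite coZ scalM scalerA.
have pmono_sum (I : finType) (F : I -> M) :
    pmono mnm0 (\sum_i F i) = \sum_i pmono mnm0 (F i).
  by apply: big_morph; [apply: pmonoD | apply: pmono0].
have gl x : g (l x) = f (pmono mnm0 x).
  rewrite /l linear_sum [in RHS](co_expand x) pmono_sum.
  rewrite -[\sum_i pmono _ _]/(\sum_i pmono _ _ : Kos chi) linear_sum.
  apply: eq_bigr => j _; rewrite linearZ_LR /= nE -linearZ_LR.
  by congr (f _); apply: kos_mono_scal.
clearbody l.
(* The lift [l] of the constants disregards the idempotents; [l'] is its part compatible with them,
   and it still lifts [f] because [g] and [f] are [A]-linear. *)
pose l' (x : M) : N' := \sum_psi idA rho psi *: l (idA rho (psi + chi) *: x).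
have l'D : {morph l' : x y / x + y}.
  move=> x y; rewrite /l' -big_split /=; apply: eq_bigr => psi _.
  by rewrite scalerDr lD scalerDr.
have l'Z c x : l' (scal rho c *: x) = scal rho c *: l' x.
  rewrite /l' scaler_sumr; apply: eq_bigr => psi _.
  apply: etrans (congr1 _ (congr1 l (scalerA _ _ _))) _; rewrite -scalC.
  by rewrite -scalerA lZ !scalerA scalC.
have l'id u x : l' (idA rho (u + chi) *: x) = idA rho u *: l' x.
  rewrite /l' (bigD1 u) //= [in RHS](bigD1 u) //= big1 ?addr0 => [|psi ne].
    rewrite [RHS]scalerDr scaler_sumr [\sum_(psi | psi != u) _]big1 ?addr0 => [|psi ne].
      by rewrite [in LHS]scalerA idA_mul eqxx [RHS]scalerA idA_mul eqxx.
    by rewrite scalerA idA_mul eq_sym (negPf ne) scale0r.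
  rewrite [in LHS]scalerA idA_mul (inj_eq (addIr _)) (negPf ne) scale0r.
  have l0 : l 0 = 0 by apply: (addIr (l 0)); rewrite -lD !add0r.
  by rewrite l0 scaler0.
have gl' x : g (l' x) = f (pmono mnm0 x).
  rewrite /l' linear_sum -[in RHS](scale1r (pmono mnm0 x : Kos chi)) -sum_idA scaler_suml.
  rewrite linear_sum; apply: eq_bigr => psi _; rewrite linearZ_LR gl.
  rewrite -linearZ_LR; apply: (congr1 (fun y : Kos chi => f y)).
  apply: etrans (kos_mono_id _ _ _ _) (etrans _ (esym (kos_mono_id _ _ _ _))).
  congr (pmono _ _); apply: etrans (scalerA _ _ _) _.
  by rewrite weight0 addr0 idA_mul eqxx.
clearbody l'.
pose h : polymod -> N' := malg_ext (fun m x => monA rho m *: l' x).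
have hD : {morph h : u v / u + v}.
  by apply: malg_extD => m x y; rewrite l'D scalerDr.
have hU m x : h (pmono m x) = monA rho m *: l' x.
  by apply: malg_extU => k x1 x2; rewrite l'D scalerDr.
clearbody h.
have lh : linear (h : Kos chi -> N').
  apply: (alg_linear sum_rho) => [//|c v|psi v|i v].
  - move: v; apply: polymod_ext => [u v|u v|m x].
    + by rewrite -hD -[u + v]/(u + v : Kos chi) scalerDr.
    + by rewrite hD scalerDr.
    apply: etrans (congr1 h (kos_mono_scal chi c m x)) _; rewrite [LHS]hU [in RHS]hU l'Z.
    apply: etrans (scalerA _ _ _) _; rewrite -scalC; exact: (esym (scalerA _ _ _)).
  - move: v; apply: polymod_ext => [u v|u v|m x].
    + by rewrite -hD -[u + v]/(u + v : Kos chi) scalerDr.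
    + by rewrite hD scalerDr.
    apply: etrans (congr1 h (kos_mono_id chi psi m x)) _; rewrite [LHS]hU [in RHS]hU l'id.
    apply: etrans (scalerA _ _ _) _; rewrite -idA_mon //; exact: (esym (scalerA _ _ _)).
  - move: v; apply: polymod_ext => [u v|u v|m x].
    + by rewrite -hD -[u + v]/(u + v : Kos chi) scalerDr.
    + by rewrite hD scalerDr.
    apply: etrans (congr1 h (kos_mono_var chi i m x)) _; rewrite [LHS]hU [in RHS]hU (monA1 sum_rho).
    exact: (esym (scalerA _ _ _)).
exists (linear_of lh) => v; rewrite -[LHS]/(g (h v)).
move: v; apply: polymod_ext => [u v|u v|m x].
- by rewrite hD linearD.
- by rewrite -linearD.
rewrite hU linearZ_LR /= -(kos_mono_mon chi) linearZ_LR /=; congr (_ *: _).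
exact: gl'.
Qed.

Lemma koszul_projective : [/\ projective_module (Kos 0), projective_module (kos_P1 sum_rho M),
  projective_module (kos_P2 sum_rho M) & projective_module (kos_P3 sum_rho M)].
Proof.
by split; do ?[apply: projective_prod]; apply: kos_projective.
Qed.

Hypothesis co_dual : forall j l, co j (b l) = (j == l)%:R.

Definition scal_linear (f : M -> M) :=
  forall c x y, f (scal rho c *: x + y) = scal rho c *: f x + f y.

Definition fd_trace (f : M -> M) : K := \sum_j co j (f (b j)).

Lemma scal_linear_co f : scal_linear f ->
  forall j x, co j (f x) = \sum_l co l x * co j (f (b l)).
Proof.
move=> lf j x; rewrite {1}(co_expand x).
elim: (index_enum 'I_d) => [|l s IHs]; last first.
  by rewrite !big_cons lf coP IHs.
have f0 : f 0 = 0 by have := lf (- 1) 0 0; rewrite scaler0 addr0 scalN scal1 scaleN1r addNr.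
by rewrite !big_nil f0 co0.
Qed.

Lemma fd_traceC f g : scal_linear f -> scal_linear g -> fd_trace (f \o g) = fd_trace (g \o f).
Proof.
move=> lf lg; rewrite /fd_trace /=.
under eq_bigr => j _ do rewrite (scal_linear_co lf).
under [RHS]eq_bigr => j _ do rewrite (scal_linear_co lg).
rewrite exchange_big; apply: eq_bigr => j _; apply: eq_bigr => l _.
by rewrite mulrC.
Qed.

Lemma scal_linear_var i : scal_linear (fun x => varA rho i *: x).
Proof.
move=> c x y; rewrite scalerDr; congr (_ + _).
apply: etrans (scalerA _ _ _) _; rewrite -scalC; exact: (esym (scalerA _ _ _)).
Qed.

Let inj0 (v : polymod) : kos_P2 sum_rho M := (v, 0, 0).
Let inj1 (v : polymod) : kos_P2 sum_rho M := (0, v, 0).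
Let inj2 (v : polymod) : kos_P2 sum_rho M := (0, 0, v).

(** On a constant [x], [kos_D i] is the variable times [x] minus the constant [varA rho i *: x]. The
    linear maps turn the former into [varA rho i *: F x], so a commutator with [F] appears. *)
Lemma component_commutator (h : {linear kos_P2 sum_rho M -> kos_P3 sum_rho M}) i chi
    (inj : Kos chi -> kos_P2 sum_rho M) (F := fun x => kos_aug (h (inj (pmono mnm0 x)))) :
  linear inj ->
  scal_linear F /\ forall x,
    kos_aug (h (inj (kos_D i (pmono mnm0 x)))) = varA rho i *: F x - F (varA rho i *: x).
Proof.
move=> li; pose J := linear_of li.
have FD u v : kos_aug (h (inj (u + v))) = kos_aug (h (inj u)) + kos_aug (h (inj v)).
  by rewrite -[inj]/(J : _ -> _) linearD linearD; apply: kos_augD.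
have Fvar u : kos_aug (h (inj (varA rho i *: u))) = varA rho i *: kos_aug (h (inj u)).
  rewrite -[inj]/(J : _ -> _) linearZ_LR linearZ_LR.
  apply: etrans (congr1 _ (kos_varA _ _)) _; exact: kos_aug_var.
have Fscal c u : kos_aug (h (inj (scal rho c *: u))) = scal rho c *: kos_aug (h (inj u)).
  rewrite -[inj]/(J : _ -> _) linearZ_LR linearZ_LR.
  apply: etrans (congr1 _ (kos_scal _ _)) _; exact: kos_aug_scal.
split=> [c x y|x].
  rewrite /F pmonoD -(kos_mono_scal chi).
  by rewrite FD Fscal.
have F0 : kos_aug (h (inj 0)) = 0 by apply: (addIr (kos_aug (h (inj 0)))); rewrite -FD !add0r.
have FN u : kos_aug (h (inj (- u))) = - kos_aug (h (inj u)).
  by apply/eqP; rewrite -addr_eq0 -FD addNr F0.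
rewrite -Fvar -FN -FD; congr (kos_aug (h (inj _))).
by rewrite kos_varA /kos_D; congr (_ - _); apply: popU.
Qed.

(* An equation sum_i [x_i, F_i] = - id on M is impossible by taking traces. *)
Lemma koszul_not_split (h : {linear kos_P2 sum_rho M -> kos_P3 sum_rho M}) :
  (forall v, h (kos_d3 v) = - v) -> d%:R = 0 :> K.
Proof.
move=> hd3.
have l0 : linear (inj0 : Kos (rho i1 + rho i2) -> kos_P2 sum_rho M).
  by move=> a u v; congr (_, _, _); rewrite /= ?scaler0 ?addr0.
have l1 : linear (inj1 : Kos (rho i0 + rho i2) -> kos_P2 sum_rho M).
  by move=> a u v; congr (_, _, _); rewrite /= ?scaler0 ?addr0.
have l2 : linear (inj2 : Kos (rho i0 + rho i1) -> kos_P2 sum_rho M).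
  by move=> a u v; congr (_, _, _); rewrite /= ?scaler0 ?addr0.
have [F0l F0E] := component_commutator h i0 l0.
have [F1l F1E] := component_commutator h i1 l1.
have [F2l F2E] := component_commutator h i2 l2.
move: F0l F0E F1l F1E F2l F2E.
set F0 := fun x => kos_aug (h (inj0 _)); set F1 := fun x => kos_aug (h (inj1 _)).
set F2 := fun x => kos_aug (h (inj2 _)) => F0l F0E F1l F1E F2l F2E.
have e x : (varA rho i0 *: F0 x - F0 (varA rho i0 *: x)) +
   (varA rho i1 *: F1 x - F1 (varA rho i1 *: x)) +
   (varA rho i2 *: F2 x - F2 (varA rho i2 *: x)) = - x.
  rewrite -F0E -F1E -F2E -!kos_augD -!linearD.
  have -> : inj0 (kos_D i0 (pmono mnm0 x)) + inj1 (kos_D i1 (pmono mnm0 x)) +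
      inj2 (kos_D i2 (pmono mnm0 x)) = kos_d3 (pmono mnm0 x).
    by congr (_, _, _); rewrite /= ?addr0 ?add0r.
  rewrite hd3; have aN : kos_aug (- (pmono mnm0 x : kos_P3 sum_rho M)) = - kos_aug (pmono mnm0 x).
    apply/eqP; rewrite -addr_eq0 -kos_augD addNr.
    by apply/eqP/(addIr (kos_aug (pmono mnm0 x))); rewrite -kos_augD !add0r.
  by rewrite aN kos_augU monA0 scale1r.
have coN j x : co j (- x) = - co j x.
  by apply/eqP; rewrite -addr_eq0 -coD addNr co0.
have tr0 i F : scal_linear F ->
    \sum_j co j (varA rho i *: F (b j) - F (varA rho i *: b j)) = 0.
  move=> lF; under eq_bigr do rewrite coD coN; rewrite sumrB.
  by apply/eqP; rewrite subr_eq0; apply/eqP; apply: (fd_traceC (scal_linear_var i) lF).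
have : \sum_j co j (- b j) = 0.
  under eq_bigr do rewrite -e coD coD; rewrite big_split big_split /= tr0 // tr0 // tr0 //.
  by rewrite !addr0.
under eq_bigr do rewrite coN co_dual eqxx; rewrite sumrN sumr_const card_ord.
by move/eqP; rewrite oppr_eq0 => /eqP.
Qed.

Lemma fd_projective_dimension : d%:R != 0 :> K -> projective_dimension M 3.
Proof.
move=> d0; have [p0 p1 p2 p3] := koszul_projective.
have [res short] := koszul_resolution p0 p1 p2 p3; split=> // m resm.
rewrite leqNgt; apply/negP => m3; have [h hE] := short m m3 resm.
by move/eqP: d0; apply; apply: koszul_not_split hE.
Qed.

End FiniteDimensional.

(** * Simple modules *)

(* Schur's lemma with Dixmier's counting argument: if no z - c kills M, the
   vectors (z - c)^-1 s are linearly independent and uncountably many. *)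
Section CentralScalar.
Variables (K : closedFieldType) (A : pzRingType) (sc : {rmorphism K -> A}).
Hypothesis scC : forall c a, sc c * a = a * sc c.
Variables (T : countType) (G : T -> A).
Hypothesis G_span : forall a, exists (D : {fset T}) (c : T -> K),
  a = \sum_(k <- D) sc (c k) * G k.
Variables (M : lmodType A) (z : A).
Hypothesis zC : forall a, z * a = a * z.
Hypothesis simpleM : simple_module M.

Definition ev_central (p : {poly K}) : A := \sum_(i < size p) sc p`_i * z ^+ i.

Lemma ev_centralE n (p : {poly K}) : (size p <= n)%N ->
  ev_central p = \sum_(i < n) sc p`_i * z ^+ i.
Proof.
move=> le_pn; rewrite /ev_central (big_ord_widen n (fun i => sc p`_i * z ^+ i) le_pn).
rewrite big_mkcond; apply: eq_bigr => i _; case: ltnP => // le_pi.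
by rewrite nth_default // rmorph0 mul0r.
Qed.

Lemma ev_centralD p q : ev_central (p + q) = ev_central p + ev_central q.
Proof.
set n := maxn (size p) (size q).
rewrite (@ev_centralE n p) ?leq_maxl // (@ev_centralE n q) ?leq_maxr //.
rewrite (@ev_centralE n (p + q)) ?size_polyD // -big_split /=.
by apply: eq_bigr => i _; rewrite coefD rmorphD mulrDl.
Qed.

Lemma ev_centralZ c p : ev_central (c *: p) = sc c * ev_central p.
Proof.
rewrite (@ev_centralE (size p) (c *: p)) ?size_scale_leq // mulr_sumr.
by apply: eq_bigr => i _; rewrite coefZ rmorphM mulrA.
Qed.

Lemma ev_centralMX p : ev_central (p * 'X) = ev_central p * z.
Proof.
rewrite (@ev_centralE (size p).+1); last first.
  by apply: leq_trans (size_polyMleq _ _) _; rewrite size_polyX addn2.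
rewrite big_ord_recl coefMX /= rmorph0 mul0r add0r mulr_suml.
by apply: eq_bigr => i _; rewrite coefMX /= exprSr mulrA.
Qed.

Lemma ev_centralMXsub p c : ev_central (p * ('X - c%:P)) = (z - sc c) * ev_central p.
Proof.
rewrite mulrBr ev_centralD ev_centralMX -mulNr mulrC mul_polyC ev_centralZ.
rewrite mulrBl -zC; congr (_ + _).
by rewrite -scaleN1r ev_centralZ rmorphN rmorph1 mulN1r mulrN.
Qed.

Lemma ev_central1 : ev_central 1 = 1.
Proof. by rewrite /ev_central size_poly1 big_ord1 coefC eqxx rmorph1 mul1r. Qed.

Lemma simple_generator (s x : M) : s != 0 -> exists a, x = a *: s.
Proof.
move=> s0; have [_ sub] := simpleM.
have [|e|e] := sub [set x | exists a, x = a *: s]%classic.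
- split; first by exists 0; rewrite scale0r.
  by move=> a _ _ [u ->] [v ->]; exists (a * u + v); rewrite scalerDl scalerA.
- have /eqP : [set 0]%classic s by rewrite -e; exists 1; rewrite scale1r.
  by rewrite (negPf s0).
by have : [set x | exists a, x = a *: s]%classic x by rewrite e.
Qed.

Lemma central_scalar : ~ countable [set: K]%classic ->
  exists c, forall x : M, z *: x = sc c *: x.
Proof.
move=> Kunc; apply/not_existsP => noc.
have [[s s0] sub] := simpleM.
(* Kernel and image of the central element [z - sc c] are submodules; as [z] acts by no scalar,
   simplicity makes it bijective. *)
have zc_inj c (x : M) : (z - sc c) *: x = 0 -> x = 0.
  move=> zx; have [|e|e] := sub [set x | (z - sc c) *: x = 0]%classic.
  - split; first exact: scaler0.
    move=> a u v /= u0 v0; rewrite scalerDr scalerA v0 addr0.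
    by rewrite mulrBl zC scC -mulrBr -scalerA u0 scaler0.
  - by have : [set 0]%classic x by rewrite -e.
  case: (noc c) => y; apply/eqP; rewrite -subr_eq0 -scalerBl; apply/eqP.
  by have : [set x | (z - sc c) *: x = 0]%classic y by rewrite e.
have zc_surj c (x : M) : exists y, (z - sc c) *: y = x.
  have [|e|e] := sub [set x | exists y, (z - sc c) *: y = x]%classic.
  - split; first by exists 0; rewrite scaler0.
    move=> a _ _ [u <-] [v <-]; exists (a *: u + v).
    by rewrite scalerDr !scalerA mulrBl zC scC -mulrBr.
  - have /zc_inj/eqP : [set 0]%classic ((z - sc c) *: s) by rewrite -e; exists s.
    by rewrite (negPf s0).
  by have : [set x | exists y, (z - sc c) *: y = x]%classic x by rewrite e.
have [v vE] := choice (fun c => zc_surj c s).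
have [D DE] : exists D : K -> {fset T}, forall c, exists co : T -> K,
    v c = \sum_(k <- D c) (sc (co k) * G k) *: s.
  suff main c : exists D : {fset T}, exists co : T -> K, v c = \sum_(k <- D) (sc (co k) * G k) *: s.
    by have [D DE] := choice main; exists D.
  have [a ->] := simple_generator (v c) s0; have [D [co ->]] := G_span a.
  by exists D, co; rewrite scaler_suml.
have ev_inj p (x : M) : p != 0 -> ev_central p *: x = 0 -> x = 0.
  move=> p0; have [r ->] := closed_field_poly_normal p.
  rewrite ev_centralZ; have : lead_coef p != 0 by rewrite lead_coef_eq0.
  move: (lead_coef p) => l l0 /(congr1 (fun x => sc l^-1 *: x)).
  rewrite scaler0 scalerA mulrA -rmorphM mulVf // rmorph1 mul1r.
  elim: r x => [|c r IHr] x; first by rewrite big_nil ev_central1 scale1r.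
  rewrite big_cons mulrC ev_centralMXsub -scalerA => /zc_inj; exact: IHr.
have zcC c a : (z - sc c) * a = a * (z - sc c) by rewrite mulrBl mulrBr zC scC.
(* Multiplying a relation by all the [z - sc c] clears the denominators and leaves
   [ev_central p *: s], where the value of [p] at each [c] is [u c] times a nonzero product. By
   [ev_inj] the polynomial [p] is zero. *)
have indep (ls : seq K) (u : K -> K) : uniq ls -> \sum_(c <- ls) sc (u c) *: v c = 0 ->
    forall c, c \in ls -> u c = 0.
  pose P (r : seq K) := \prod_(c <- r) ('X - c%:P).
  have [p [pE pu]] : exists p, ev_central p *: s =
      ev_central (P ls) *: \sum_(c <- ls) sc (u c) *: v c /\
      (uniq ls -> p = 0 -> forall c, c \in ls -> u c = 0).
    elim: ls => [|c ls [p [pE pu]]].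
      by exists 0; rewrite big_nil scaler0 /ev_central size_poly0 big_ord0 scale0r.
    exists (p * ('X - c%:P) + u c *: P ls); split.
      rewrite ev_centralD ev_centralMXsub scalerDl -scalerA pE.
      rewrite /P !big_cons [('X - _) * _]mulrC ev_centralMXsub scalerDr addrC -/(P ls).
      congr (_ + _); last by rewrite scalerA.
      rewrite ev_centralZ -[in LHS](vE c) !scalerA; congr (_ *: _).
      by rewrite -[RHS]scC zcC mulrA.
    move=> /= /andP[cls uls] p0 e; have := congr1 (fun q => q.[e]) p0.
    have u0 : u c = 0.
      have := congr1 (fun q => q.[c]) p0; rewrite hornerD hornerM hornerXsubC subrr mulr0.
      rewrite add0r hornerZ horner0 => /eqP; rewrite mulf_eq0 => /orP[/eqP//|].
      by rewrite -[_ == 0]/(root (P ls) c) root_prod_XsubC (negPf cls).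
    move=> _; rewrite inE => /orP[/eqP ->//|els]; apply: pu => //.
    move/eqP: p0; rewrite u0 scale0r addr0 mulf_eq0 => /orP[/eqP//|].
    by rewrite polyXsubC_eq0.
  move=> uls e; rewrite e scaler0 in pE; apply: pu => //.
  by apply/eqP; apply: contraNT s0 => p0; rewrite (ev_inj p s).
(* There are countably many finite sets [E], so it suffices that each is [D c] for finitely many [c]
   only: more vectors [v c] than [E] has elements, all in a span indexed by [E], would be dependent,
   contrary to [indep]. *)
apply: Kunc; have -> : [set: K]%classic = (\bigcup_(E in [set: {fset T}]) [set c | D c =
  E])%classic.
  by apply/seteqP; split=> c // _; exists (D c).
apply: bigcup_countable => // E _; apply: finite_set_countable.
apply: contrapT => inf; have [B BE Bs] := infinite_set_fset #|`E|.+1 inf.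
have [co coE] := choice DE.
pose tB := in_tuple (B : seq K); pose tE := in_tuple (E : seq T).
pose C : 'M[K]_(size B, size E) := \matrix_(i, j) co (tnth tB i) (tnth tE j).
have : kermx C != 0.
  rewrite -mxrank_eq0 mxrank_ker subn_eq0 -ltnNge.
  exact: leq_ltn_trans (rank_leq_col _) Bs.
case/rowV0Pn => r /sub_kermxP rC r0.
have [i0 ri0] : exists i0, r ord0 i0 != 0.
  apply/existsP; apply: contraNT r0; rewrite negb_exists => /forallP r0.
  by apply/eqP/rowP => i; have := r0 i; rewrite negbK mxE => /eqP.
have tB_inj : injective (tnth tB).
  by apply/tuple_uniqP; apply: fset_uniq.
pose u c := \sum_i r ord0 i * (tnth tB i == c)%:R.
have uE i : u (tnth tB i) = r ord0 i.
  rewrite /u (bigD1 i) //= eqxx mulr1 big1 ?addr0 // => j ne.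
  by rewrite (inj_eq tB_inj) (negPf ne) mulr0.
have : u (tnth tB i0) = 0.
  apply: (indep (B : seq K)); [exact: fset_uniq | | exact: mem_tnth].
  rewrite big_tnth -/tB.
  have vB i : v (tnth tB i) = \sum_j (sc (C i j) * G (tnth tE j)) *: s.
    rewrite coE (_ : D _ = E); last by apply: (BE (tnth tB i)); apply: mem_tnth.
    by rewrite big_tnth; apply: eq_bigr => j _; rewrite mxE.
  under eq_bigr => i _ do rewrite uE vB scaler_sumr.
  rewrite exchange_big big1 //= => j _.
  under eq_bigr => i _ do rewrite scalerA mulrA -rmorphM.
  rewrite -scaler_suml -mulr_suml -rmorph_sum.
  have := congr1 (fun X : 'rV_(size E) => X ord0 j) rC; rewrite !mxE => ->.
  by rewrite rmorph0 mul0r scale0r.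
by rewrite uE => /eqP; rewrite (negPf ri0).
Qed.

End CentralScalar.

Section FiniteBasis.
Variables (K : fieldType) (V : lmodType K).

(* a spanning family of minimal length is a basis *)
Lemma spanning_basis n (e : 'I_n -> V) : (forall x, exists c, x = \sum_i c i *: e i) ->
  exists (d : nat) (b : 'I_d -> V) (co : 'I_d -> V -> K),
  [/\ forall j c x y, co j (c *: x + y) = c * co j x + co j y,
      forall x, x = \sum_j co j x *: b j & forall j l, co j (b l) = (j == l)%:R].
Proof.
move=> e_span.
pose S m := `[< exists b : 'I_m -> V, forall x, exists c, x = \sum_i c i *: b i >].
have exS : exists m, S m by exists n; apply/asboolP; exists e.
case: (ex_minnP exS) => d /asboolP[b bS] dmin.
have indep c : \sum_i c i *: b i = 0 -> forall i, c i = 0.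
  move=> c0 i; apply/eqP; apply: contraT => ci.
  case: d b bS dmin c c0 i ci => [|d] b bS dmin c c0 i ci; first by case: i ci.
  have : S d.
    apply/asboolP; exists (fun j => b (lift i j)) => x; have [a aE] := bS x.
    exists (fun j => a (lift i j) - a i / c i * c (lift i j)).
    have bi : b i = - \sum_j (c (lift i j) / c i) *: b (lift i j).
      apply/eqP; rewrite -addr_eq0; apply/eqP; have := congr1 (fun v => (c i)^-1 *: v) c0.
      rewrite scaler0 (bigD1_ord i) //= scalerDr scalerA mulVf // scale1r scaler_sumr.
      by move=> e0; rewrite -[RHS]e0; congr (_ + _); apply: eq_bigr => j _; rewrite scalerA mulrC.
    rewrite aE (bigD1_ord i) //= {1}bi scalerN scaler_sumr addrC -sumrB.
    apply: eq_bigr => j _; rewrite scalerBl scalerA; congr (_ - _ *: _).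
    by rewrite mulrA mulrAC.
  by move/dmin; rewrite ltnn.
have [co coE] := choice bS.
have uniq c x : x = \sum_i c i *: b i -> forall j, co x j = c j.
  move=> xE j; apply/eqP; rewrite -subr_eq0; apply/eqP.
  apply: (indep (fun j => co x j - c j)); under eq_bigr do rewrite scalerBl.
  by rewrite sumrB -coE -xE subrr.
exists d, b, (fun j x => co x j); split=> [j c x y|//|j l].
  apply: (uniq (fun j => c * co x j + co y j)).
  rewrite {1}(coE x) {1}(coE y) scaler_sumr -big_split.
  by apply: eq_bigr => i _; rewrite scalerA scalerDl.
apply: (uniq (fun j => (j == l)%:R)).
rewrite (bigD1 l) //= eqxx scale1r big1 ?addr0 // => i /negPf->.
by rewrite scale0r.
Qed.

End FiniteBasis.

(** * Projective dimension of the simple modules *)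

Section SimpleModules.
Variables (K : closedFieldType) (gT : finGroupType).
Variable rho : 'I_3 -> character K gT.
Local Notation char := (character K gT).
Local Notation A := (potential_algebra K (mckay_quiver rho)).
Local Notation i0 := (inord 0 : 'I_3).
Local Notation i1 := (inord 1 : 'I_3).
Local Notation i2 := (inord 2 : 'I_3).
Hypothesis sum_rho : \sum_i rho i = 0.
Hypothesis Kunc : ~ countable [set: K]%classic.

Lemma scal_additive : zmod_morphism (scal rho).
Proof. by move=> c d; rewrite scalD scalN. Qed.

Lemma scal_monoid : monoid_morphism (scal rho).
Proof. by split; [apply: scal1 | apply: scalM]. Qed.

HB.instance Definition _ :=
  GRing.isZmodMorphism.Build K A (scal rho) scal_additive.
HB.instance Definition _ :=
  GRing.isMonoidMorphism.Build K A (scal rho) scal_monoid.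

(** Each factor [varA rho i] moves an idempotent by [rho i], and [#|gT|] steps of [rho i] add up to
    0. *)
Lemma varX_order_central i (a : A) :
  varA rho i ^+ #|gT| * a = a * varA rho i ^+ #|gT|.
Proof.
elim/(potential_algebra_ind sum_rho): a => [|a b IHa IHb|c a IHa|chi m].
- by rewrite mulr0 mul0r.
- by rewrite mulrDr mulrDl IHa IHb.
- by rewrite mulrA -scalC -mulrA IHa mulrA.
have e : idA rho chi * varA rho i ^+ #|gT| = varA rho i ^+ #|gT| * idA rho chi.
  by rewrite idA_varX char_order addr0.
rewrite mulrA -e -!mulrA; congr (_ * _).
exact/commr_sym/commrX/commr_sym/comm_var_mon.
Qed.

Lemma potential_algebra_span (a : A) :
  exists (D : {fset (char * multinom 3)%type}) (c : char * multinom 3 -> K),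
    a = \sum_(k <- D) scal rho (c k) * (idA rho k.1 * monA rho k.2).
Proof.
have ext (D E : {fset (char * multinom 3)%type}) (c : char * multinom 3 -> K) :
    (D `<=` E)%fset -> exists c' : char * multinom 3 -> K,
    \sum_(k <- D) scal rho (c k) * (idA rho k.1 * monA rho k.2) =
    \sum_(k <- E) scal rho (c' k) * (idA rho k.1 * monA rho k.2).
  move=> DE; exists (fun k => if k \in D then c k else 0).
  rewrite -(big_fset_incl _ DE) => [|k _ /negPf->]; last by rewrite scal0 mul0r.
  by apply: eq_big_seq => k ->.
elim/(potential_algebra_ind sum_rho): a => [|a b [D [c ->]] [E [d ->]]|c a [D [d ->]]|chi m].
- by exists fset0, (fun=> 0); rewrite big_seq_fset0.
- have [c' ->] := ext D (D `|` E)%fset c (fsubsetUl _ _).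
  have [d' ->] := ext E (D `|` E)%fset d (fsubsetUr _ _).
  exists (D `|` E)%fset, (fun k => c' k + d' k); rewrite -big_split.
  by apply: eq_bigr => k _; rewrite scalD mulrDl.
- exists D, (fun k => c * d k); rewrite mulr_sumr.
  by apply: eq_bigr => k _; rewrite scalM mulrA.
by exists [fset (chi, m)]%fset, (fun=> 1); rewrite big_seq_fset1 scal1 mul1r.
Qed.

Variable M : lmodType A.
Hypothesis simpleM : simple_module M.

Lemma simple_varX_order i : exists c, forall x : M,
  varA rho i ^+ #|gT| *: x = scal rho c *: x.
Proof.
exact: (central_scalar (sc := scal rho) (@scalC _ _ rho) potential_algebra_span
  (varX_order_central i) simpleM Kunc).
Qed.

(** The powers [varA rho i ^+ #|gT|] act as scalars, so the exponents of the monomials applied to a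
    generator [s] can be reduced below [#|gT|]. *)
Lemma simple_finite_span : exists n (e : 'I_n -> restrict_scal M),
  forall x, exists c : 'I_n -> K, x = \sum_i c i *: e i.
Proof.
have [[s s0] sub] := simpleM.
have n0 := card_gT_gt0 gT; set n := #|gT| in n0.
pose I : finType := (char * {ffun 'I_3 -> 'I_n})%type.
pose w (f : 'I_3 -> nat) : A :=
  varA rho i0 ^+ f i0 * varA rho i1 ^+ f i1 * varA rho i2 ^+ f i2.
pose e (k : I) : M := (idA rho k.1 * w (fun i => k.2 i)) *: s.
pose S (x : M) := exists c : I -> K, x = \sum_k scal rho (c k) *: e k.
suff main x : S x.
  exists #|I|, (fun i => e (enum_val i)) => x; have [c ->] := main x.
  by exists (c \o enum_val); exact: (reindex _ (onW_bij _ (enum_val_bij I))).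
have S0 : S 0 by exists (fun=> 0); rewrite big1 // => k _; rewrite scal0 scale0r.
have SD u v : S u -> S v -> S (u + v).
  move=> [c ->] [d ->]; exists (fun k => c k + d k); rewrite -big_split.
  by apply: eq_bigr => k _; rewrite scalD scalerDl.
have SZ a u : S u -> S (scal rho a *: u).
  move=> [c ->]; exists (fun k => a * c k); rewrite scaler_sumr.
  by apply: eq_bigr => k _; rewrite scalM scalerA.
have [z zE] := choice simple_varX_order.
have red i k (y : M) : varA rho i ^+ k *: y =
    scal rho (z i ^+ (k %/ n)) *: (varA rho i ^+ (k %% n) *: y).
  rewrite {1}(divn_eq k n) exprD mulnC exprM -scalerA.
  elim: (k %/ n)%N (varA rho i ^+ (k %% n) *: y) => [|q IHq] u.
    by rewrite expr0 scal1.
  by rewrite exprS -scalerA zE IHq scalerA -scalM -exprS.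
have scalS a c (y : M) : a *: (scal rho c *: y) = scal rho c *: (a *: y).
  by rewrite !scalerA scalC.
have eS chi m : S ((idA rho chi * monA rho m) *: s).
  pose f : {ffun 'I_3 -> 'I_n} := [ffun i => Ordinal (ltn_pmod (m i) n0)].
  rewrite monAE -/i0; have -> : (idA rho chi *
      (varA rho i0 ^+ m i0 * varA rho i1 ^+ m i1 * varA rho i2 ^+ m i2)) *: s =
    scal rho (z i0 ^+ (m i0 %/ n) * z i1 ^+ (m i1 %/ n) * z i2 ^+ (m i2 %/ n))
     *: e (chi, f).
    rewrite /e /w /= !ffunE /= -!scalerA (red i2 (m i2)) (red i0 (m i0)).
    rewrite (red i1 (m i1)) !(scalS (varA rho i1 ^+ _)) !(scalS (varA rho i0 ^+ _)).
    rewrite !(scalS (idA rho chi)) !scalerA.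
    by rewrite !scalM.
  exists (fun k => if k == (chi, f) then
    (z i0 ^+ (m i0 %/ n) * z i1 ^+ (m i1 %/ n) * z i2 ^+ (m i2 %/ n)) else 0).
  rewrite (bigD1 (chi, f)) //= eqxx big1 ?addr0 // => k /negPf->.
  by rewrite scal0 scale0r.
have [a ->] := simple_generator simpleM x s0.
elim/(potential_algebra_ind sum_rho): a => [|a b IHa IHb|c a IHa|chi m].
- by rewrite scale0r.
- by rewrite scalerDl; apply: SD.
- by rewrite -scalerA; apply: SZ.
exact: eS.
Qed.

Lemma simple_projective_dimension : (forall d, (0 < d)%N -> d%:R != 0 :> K) ->
  projective_dimension M 3.
Proof.
move=> char0; have [n [e eE]] := simple_finite_span.
have [d [b [co [coP co_expand co_dual]]]] := spanning_basis eE.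
apply: (@fd_projective_dimension _ _ _ sum_rho M d b co) => //.
apply: char0; rewrite lt0n; apply/eqP => d0.
have [[x x0] _] := simpleM; move/eqP: x0; apply; rewrite (co_expand x).
by rewrite big1 // => j _; have := ltn_ord j; rewrite {2}d0.
Qed.

End SimpleModules.

(** A countable set of reals has Lebesgue measure 0, whereas the unit interval has measure 1. *)
Lemma complex_uncountable (R : realType) : ~ countable [set: R[i]]%classic.
Proof.
move=> cC; have : countable `[0 : R, 1]%classic.
  have [f finj] := countable_injP _ cC.
  apply/countable_injP; exists (fun x : R => f (x%:C)%C) => x y _ _ e.
  by have [] : (x%:C)%C = (y%:C)%C by apply: finj; rewrite ?inE.
move/countable_lebesgue_measure0 => /= e.
have := @lebesgue_measure_itv R `[0, 1]; rewrite e /= lte01 oppr0 adde0.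
by move=> [] /eqP; rewrite eq_sym oner_eq0.
Qed.

(* The non-commutative crepant resolution *)
Local Transparent potential_algebra.

Theorem mckay_nccr (R : realType) (gT : finGroupType)
    (rG : mx_representation R[i] [set: gT]%G 3)
    (faithfulG : mx_faithful rG)
    (detG : forall g : gT, \det (rG g) = 1)
    (rho : 'I_3 -> character R[i] gT)
    (P : 'M[R[i]]_3) (unitP : P \in unitmx)
    (decomposition : forall g : gT,
       rG g *m P = P *m diag_mx (\row_i rho i g)) :
  exists iota : {rmorphism invariant_ring rG ->
                           potential_algebra R[i] (mckay_quiver rho)},
    (forall c : R[i],
       iota (invariant_const rG c) =
       \pi_(potential_algebra R[i] (mckay_quiver rho))
         (c *: (1 : path_algebra R[i] (mckay_quiver rho)))) /\
    nccr iota.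
Proof.
have sep := faithful_separates unitP decomposition faithfulG.
have sum_rho := det1_sum_rho unitP decomposition detG.
pose t : {rmorphism invariant_ring rG -> mpoly 3 R[i]} :=
  (invariant_coord P : invariant_ring rG -> mpoly 3 R[i]).
have t_inv : forall r, wproj rho 0 (t r) = t r := invariant_coord_inv unitP decomposition.
have t_surj := invariant_coord_surj unitP decomposition.
have t_inj : injective t := @invariant_coord_inj _ _ rG _ unitP.
exists (invariant_to_alg_rmorphism sep sum_rho t); split.
  move=> c; exact: (invariant_to_alg_const sep sum_rho (invariant_coord_const rG P c)).
split; first exact: invariant_to_alg_central.
  exists (invariant_module t); split.
  - by exists (1 : mpoly 3 R[i]); exact: oner_neq0.
  - exact: (invariant_module_fin_gen (rho := rho)).
  - exact: (invariant_module_reflexive (rho := rho)).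
  - exact: alg_iso_End.
exists 3%N => M simpleM.
apply: (simple_projective_dimension sum_rho (@complex_uncountable R) simpleM) => d d0.
by rewrite Num.Theory.pnatr_eq0 -lt0n.
Qed.

Import Order.TTheory Num.Theory.
Import numFieldNormedType.Exports.
Local Open Scope classical_set_scope.
Local Open Scope ring_scope.
Local Open Scope quotient_scope.

(** * The torus glued from the triangles *)

Lemma pairD (U V : zmodType) (a c : U) (b d : V) : (a, b) + (c, d) = (a + c, b + d).
Proof. by []. Qed.

Lemma pairZ (F : pzRingType) (k a b : F) : k *: ((a, b) : F^o * F^o) = (k * a, k * b).
Proof. by []. Qed.

Section TorusTopology.
Variable R : realType.

Lemma tproj_eqP (x y : R * R) : tproj x = tproj y <->
  exists m n : int, x.1 = y.1 + m%:~R /\ x.2 = y.2 + n%:~R.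
Proof.
rewrite /tproj; split=> [/eqquotP/andP[/intrP[m mE] /intrP[n nE]]|[m [n [e1 e2]]]].
  by exists m, n; rewrite -mE -nE !(addrC _ (_ - _)) !subrK.
by apply/eqquotP/andP; rewrite e1 e2 ![_ + _%:~R - _]addrAC !subrr !add0r; split; apply: intr_int.
Qed.

Lemma tproj_continuous : continuous (@tproj R).
Proof. exact: pi_continuous. Qed.

Lemma tproj_surj (x : torus R) : exists z, tproj z = x.
Proof. by exists (repr x); rewrite /tproj reprK. Qed.

(** The preimage of the image is the union of the integral translates of [U]. *)
Lemma tproj_open (U : set (R * R)) : open U -> open (@tproj R @` U).
Proof.
move=> oU; rewrite /open/= /quotient_open.
have -> : (\pi_(quotient_topology {eq_quot @torus_rel R}) @^-1` (@tproj R @` U)) =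
    \bigcup_(k in [set: int * int]) ((fun z : R * R => z + (k.1%:~R, k.2%:~R)) @^-1` U).
  apply/seteqP; split=> [z [u Uu /tproj_eqP[m [n [e1 e2]]]]|z [[m n] _ /= Uz]].
    by exists (m, n) => //=; case: z u Uu e1 e2 => z1 z2 [u1 u2] Uu /= e1 e2;
      rewrite -[_ + _]/(_ + _, _ + _) -e1 -e2.
  by exists (z + (m%:~R, n%:~R)) => //; apply/tproj_eqP; exists m, n.
apply: bigcup_open => k _; apply: open_comp => // z _.
by apply: cvgD; [exact: cvg_id | exact: cvg_cst].
Qed.

(** Points that differ in the torus have a coordinate in which their difference is not an integer.
    Moving both by less than half the distance from this difference to the nearest integer keeps it
    so; this is the radius [e]. *)
Lemma torus_hausdorff : hausdorff_space (torus R).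
Proof.
have sep (x y : R) : (forall m : int, x <> y + m%:~R) ->
    exists2 e : R, 0 < e & forall x' y', `|x - x'| < e -> `|y - y'| < e ->
      forall m : int, x' <> y' + m%:~R.
  move=> xy; set n := Num.floor (x - y).
  have n0 : n%:~R < x - y.
    rewrite lt_neqAle ge_floor andbT; apply/eqP => e; apply: (xy n); rewrite e; lra.
  have n1 : x - y < (n + 1)%:~R := floorD1_gt _.
  have m0 : 0 < Num.min (x - y - n%:~R) ((n + 1)%:~R - (x - y)).
    by rewrite lt_min !subr_gt0 n0 n1.
  exists (Num.min (x - y - n%:~R) ((n + 1)%:~R - (x - y)) / 2); first lra.
  move=> x' y'; move: m0; set mm := Num.min _ _ => m0;
    rewrite !ltr_distl => /andP[x1 x2] /andP[y1 y2] m e.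
  have le1 : mm <= x - y - n%:~R by rewrite ge_min lexx.
  have le2 : mm <= (n + 1)%:~R - (x - y) by rewrite ge_min lexx orbT.
  have /andP[] : (n < m < n + 1)%R.
    by rewrite -!(ltr_int R); apply/andP; split; lra.
  lia.
rewrite open_hausdorff => x y; have [z <-] := tproj_surj x; have [w <-] := tproj_surj y.
move=> /eqP ne.
have [e e0 eP] : exists2 e : R, 0 < e & forall z' w', ball z e z' -> ball w e w' ->
  tproj z' <> tproj w'.
  have [[m mE]|no1] := pselect (exists m : int, z.1 = w.1 + m%:~R).
    have [[n nE]|no2] := pselect (exists n : int, z.2 = w.2 + n%:~R).
      by case: ne; apply/tproj_eqP; exists m, n.
    have [|e e0 eP] := sep z.2 w.2; first by move=> n nE; apply: no2; exists n.
    exists e => // z' w' [_ z'2] [_ w'2] /tproj_eqP[m' [n' [_]]]; exact: eP.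
  have [|e e0 eP] := sep z.1 w.1; first by move=> n nE; apply: no1; exists n.
  exists e => // z' w' [z'1 _] [w'1 _] /tproj_eqP[m' [n' [+ _]]]; exact: eP.
exists (@tproj R @` (ball z e)^°, @tproj R @` (ball w e)^°) => /=.
  by split; apply/mem_set; [exists z | exists w] => //; exact: nbhsx_ballx.
split; [exact/tproj_open/open_interior | exact/tproj_open/open_interior | ].
apply/eqP/seteqP; split=> // t [[z' /interior_subset zz' <-] [w' /interior_subset ww' e']].
by case: (eP z' w' zz' ww').
Qed.

End TorusTopology.

Lemma pair_continuous_at (T U V : topologicalType) (f : T -> U) (g : T -> V) x :
  {for x, continuous f} -> {for x, continuous g} ->
  {for x, continuous (fun x => (f x, g x))}.
Proof.
by move=> cf cg; exact: (@cvg_pair _ _ _ (nbhs x) (nbhs (f x)) (nbhs (g x))).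
Qed.

(** * The plane as universal cover of the torus *)

Section LinearProjection.
Variables (R : realType) (al be ga : R).
Hypotheses (al0 : 0 < al) (ga0 : 0 < ga).

(** By the Hermite normal form an upper triangular matrix with positive diagonal suffices; such a
    map preserves the orientation and the horizontal directions. *)
Definition shear (z : R * R) : R * R := (al * z.1 + be * z.2, ga * z.2).
Definition unshear (z : R * R) : R * R := ((z.1 - be * (z.2 / ga)) / al, z.2 / ga).

Lemma shearK : cancel shear unshear.
Proof.
by case=> x y; rewrite /unshear /= [ga * y]mulrC mulfK ?gt_eqF // addrK [al * x]mulrC mulfK ?gt_eqF.
Qed.

Lemma unshearK : cancel unshear shear.
Proof.
case=> x y; rewrite /shear /=; congr (_, _); last by rewrite mulrC divfK ?gt_eqF.
by rewrite mulrC divfK ?gt_eqF // subrK.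
Qed.

Lemma shearD z w : shear (z + w) = shear z + shear w.
Proof. by rewrite /shear /=; congr (_, _); rewrite /=; ring. Qed.

Lemma shearZ c z : shear (c *: z) = c *: shear z.
Proof. by rewrite /shear /=; congr (_, _); rewrite /= /GRing.scale /=; ring. Qed.

Lemma shear_continuous : continuous shear.
Proof.
move=> z; apply: (@pair_continuous_at (R * R)%type R R (fun z : R * R =>
  al * z.1 + be * z.2) (fun z : R * R => ga * z.2)).
  apply: cvgD; apply: cvgM; try exact: cvg_cst; [exact: cvg_fst | exact: cvg_snd].
by apply: cvgM; [exact: cvg_cst | exact: cvg_snd].
Qed.

Lemma unshear_continuous : continuous unshear.
Proof.
move=> z; apply: (@pair_continuous_at (R * R)%type R R (fun z : R * R =>
  (z.1 - be * (z.2 / ga)) / al) (fun z : R * R => z.2 / ga)).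
  apply: cvgM; last exact: cvg_cst.
  apply: cvgB; first exact: cvg_fst.
  apply: cvgM; first exact: cvg_cst.
  by apply: cvgM; [exact: cvg_snd | exact: cvg_cst].
by apply: cvgM; [exact: cvg_snd | exact: cvg_cst].
Qed.

Definition tshear (z : R * R) : torus R := tproj (shear z).

Lemma tshear_continuous : continuous tshear.
Proof.
move=> z; apply: continuous_comp; first exact: shear_continuous.
exact: tproj_continuous.
Qed.

Lemma tshear_open (U : set (R * R)) : open U -> open (tshear @` U).
Proof.
move=> oU; have -> : tshear @` U = @tproj R @` (unshear @^-1` U).
  apply/seteqP; split=> _ [z Uz <-]; last by exists (unshear z); rewrite // /tshear unshearK.
  by exists (shear z); rewrite //= shearK.
by apply/tproj_open/open_comp => // z _; exact: unshear_continuous.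
Qed.

Lemma tshear_surj x : exists z, tshear z = x.
Proof. by have [z <-] := tproj_surj x; exists (unshear z); rewrite /tshear unshearK. Qed.

End LinearProjection.

Section LatticeProjection.
Variables (R : realType) (K : closedFieldType) (gT : finGroupType).
Variable rho : 'I_3 -> character K gT.

(** [lattice_basis] gives the basis (d, 0), (b, a) of the lattice of relations; [al], [be], [ga] are
    the entries of the inverse of the matrix with these columns, which carries the lattice onto
    Z^2. *)
Lemma lattice_projection : exists al be ga : R, [/\ 0 < al, 0 < ga &
  forall z w, tshear al be ga z = tshear al be ga w <->
    exists p q : int, lattice_char rho p q = 0 /\ z = w + (p%:~R, q%:~R)].
Proof.
have [a [d [b [a0 d0 abd]]]] := lattice_basis rho.
have aR : 0 < a%:R :> R by rewrite ltr0n.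
have dR : 0 < d%:R :> R by rewrite ltr0n.
exists d%:R^-1, (- (b%:~R / (a%:R * d%:R))), a%:R^-1; rewrite !invr_gt0; split=> //.
case=> x y [x' y']; rewrite tproj_eqP /shear /=;
  split=> [[m [n [e1 e2]]]|[p [q [/abd [m [n [-> ->]]] [-> ->]]]]].
  exists (m * d%:Z + n * b), (n * a%:Z); split; first by apply/abd; exists m, n.
  have yE : y = y' + n%:~R * a%:R.
    have -> : y = a%:R * (a%:R^-1 * y) by field; exact: lt0r_neq0.
    by rewrite e2; field; exact: lt0r_neq0.
  rewrite -[_ + _]/(_ + _, _ + _); congr (_, _); last by rewrite yE rmorphM.
  rewrite rmorphD !rmorphM /=.
  have -> : x = d%:R * (d%:R^-1 * x + - (b%:~R / (a%:R * d%:R)) * y) + b%:~R / a%:R * y.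
    by field; rewrite !lt0r_neq0.
  by rewrite e1 yE; field; rewrite !lt0r_neq0.
by exists m, n; rewrite !rmorphD !rmorphM /=; split; field; rewrite ?lt0r_neq0.
Qed.

End LatticeProjection.

(** * The map from the glued triangles to the torus *)

Section GluedTriangles.
Variables (R : realType) (K : closedFieldType) (gT : finGroupType).
Variable rho : 'I_3 -> character K gT.
Local Notation char := (character K gT).
Local Notation i0 := (inord 0 : 'I_3).
Local Notation i1 := (inord 1 : 'I_3).
Local Notation i2 := (inord 2 : 'I_3).
Hypothesis sep : forall g, (forall i, rho i g = 1) -> g = 1%g.
Hypothesis sum_rho : \sum_i rho i = 0.
Variables al be ga : R.
Hypotheses (al0 : 0 < al) (ga0 : 0 < ga).
Local Notation cov := (tshear al be ga).
Hypothesis covE : forall z w, cov z = cov w <->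
  exists p q : int, lattice_char rho p q = 0 /\ z = w + (p%:~R, q%:~R).
Local Notation tri := (triangles R (mckay_face rho)).
Local Notation bd := (mckay_boundary (rho := rho)).

Definition char_lift (chi : char) : int * int := sval (cid (lattice_char_surj sep sum_rho chi)).

Lemma char_liftK chi : lattice_char rho (char_lift chi).1 (char_lift chi).2 = chi.
Proof. exact: svalP (cid (lattice_char_surj sep sum_rho chi)). Qed.

Lemma cov_shift p q p' q' (w : R * R) : lattice_char rho p q = lattice_char rho p' q' ->
  cov ((p%:~R, q%:~R) + w) = cov ((p'%:~R, q'%:~R) + w).
Proof.
move=> e; apply/covE; exists (p - p'), (q - q'); split.
  by rewrite lattice_charD lattice_charN e subrr.
rewrite -[LHS]/(_ + _, _ + _) -[RHS]/(_ + _ + _, _ + _ + _) /= !rmorphB /=.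
by congr (_, _); ring.
Qed.

Definition lift_pt chi : R * R := ((char_lift chi).1%:~R, (char_lift chi).2%:~R).

Lemma cov_lift p q w : cov (lift_pt (lattice_char rho p q) + w) = cov ((p%:~R, q%:~R) + w).
Proof. by apply: cov_shift; rewrite char_liftK. Qed.

(* The standard triangles with a corner at z: (0,0), (1,0), (1,1) and
   (0,0), (1,0), (0,-1), in this order. *)
Definition std_tri s (z : R * R) (t : 'rV[R]_3) : R * R :=
  z + (if s then (t ord0 i1 + t ord0 i2, t ord0 i2) else (t ord0 i1, - t ord0 i2)).

Lemma face_shift_exists (F : mckay_face rho) : exists k : 'I_3,
  bd F = rot k (std_word rho (positive (F : face (mckay_quiver rho)))
    (face_corner (positive (F : face (mckay_quiver rho))) F)) :> seq _.
Proof.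
have [s [chi [k [-> _ kE]]]] := mckay_face_std sum_rho F.
by exists k; rewrite std_face_positive // face_cornerK.
Qed.

Definition face_sign (F : mckay_face rho) : bool := positive (F : face (mckay_quiver rho)).
Definition face_shift F : 'I_3 := sval (cid (face_shift_exists F)).
Definition face_base F := face_corner (face_sign F) F.

Lemma face_sign_std s chi : face_sign (std_face rho s chi) = s.
Proof. exact: std_face_positive. Qed.

Lemma face_base_std s chi : face_base (std_face rho s chi) = chi.
Proof. by rewrite /face_base face_sign_std face_cornerK. Qed.

Lemma tnth_face F i :
  tnth (bd F) i = tnth (std_word rho (face_sign F) (face_base F)) (i + face_shift F).
Proof.
have e := svalP (cid (face_shift_exists F)); rewrite -/(face_shift F) in e.
rewrite !(tnth_nth (0, i0)) [tval _]e.
case: (face_shift F) i => [k hk] [j hj] /=.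
have s3 : size (std_word rho (face_sign F) (face_base F)) = 3%N by rewrite size_tuple.
rewrite /rot nth_cat size_drop s3 ltn_subRL addnC.
case: ltnP => h; first by rewrite nth_drop modn_small // addnC.
rewrite nth_take; last by lia.
congr nth; rewrite -[(j + k)%N](subnK h) modnDr modn_small; lia.
Qed.

(** Renumbering of the corners, to undo the rotation [face_shift] between the boundary of a face and
    its standard word. Sums in ['I_3] are modulo 3. *)
Definition rotv (k : 'I_3) (t : 'rV[R]_3) : 'rV[R]_3 := \row_j t ord0 (j + k).

Lemma rotvK k t : rotv (- k) (rotv k t) = t.
Proof. by apply/rowP => j; rewrite !mxE subrK. Qed.

Lemma rotvNK k t : rotv k (rotv (- k) t) = t.
Proof. by apply/rowP => j; rewrite !mxE addrK. Qed.

Lemma rotv_triangle k t : triangle t -> triangle (rotv k t).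
Proof.
move=> [t0 t1]; split=> [i|]; first by rewrite mxE.
rewrite -t1 (reindex_inj (addIr (- k))) /=.
by apply: eq_bigr => i _; rewrite mxE subrK.
Qed.

Lemma ordS_add1 (i : 'I_3) : ordS i = i + 1.
Proof. by apply: val_inj; case: i => [[|[|[|]]]]. Qed.

Lemma rotv_side k i (tau : R) : rotv k (side i tau) = side (i - k) tau.
Proof.
apply/rowP => j; rewrite !mxE !ordS_add1 /= [i - k + 1]addrAC.
have e (x : 'I_3) : (j == x - k) = (j + k == x) by rewrite eq_sym subr_eq eq_sym.
by rewrite !e.
Qed.

Definition glue_fun F (t : set_type (@triangle R)) : torus R :=
  cov (std_tri (face_sign F) (lift_pt (face_base F)) (rotv (- face_shift F) (val t))).

Definition glue_map (x : tri) : torus R := glue_fun (tag x) (tagged x).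

Definition bar (a b c : R) : 'rV[R]_3 := \row_j [:: a; b; c]`_j.

Lemma barE (t : 'rV[R]_3) : t = bar (t ord0 i0) (t ord0 i1) (t ord0 i2).
Proof. by apply/rowP => j; rewrite mxE; case: (I3_cases j) => ->; rewrite /= inordK. Qed.

Lemma side_bar (tau : R) : [/\ side i0 tau = bar tau (1 - tau) 0,
  side i1 tau = bar 0 tau (1 - tau) & side i2 tau = bar (1 - tau) 0 tau].
Proof.
have S0 : ordS i0 = i1 by apply: val_inj; rewrite /= !inordK.
have S1 : ordS i1 = i2 by apply: val_inj; rewrite /= !inordK.
have S2 : ordS i2 = i0 by apply: val_inj; rewrite /= !inordK.
by split; rewrite /side ?S0 ?S1 ?S2; apply/rowP => j; rewrite !mxE /=;
  case: (I3_cases j) => ->; rewrite !I3_eq //= inordK //= ?mulr0 ?mulr1 ?add0r ?addr0.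
Qed.

Lemma bar_triangle (a b c : R) : 0 <= a -> 0 <= b -> 0 <= c -> a + b + c = 1 ->
  triangle (bar a b c).
Proof.
move=> a0 b0 c0 e; split=> [j|]; last by rewrite sum3E !mxE !inordK.
by rewrite mxE; case: (I3_cases j) => ->; rewrite inordK.
Qed.

Lemma triangle_bar t : triangle t -> exists a b c : R,
  [/\ 0 <= a, 0 <= b, 0 <= c, a + b + c = 1 & t = bar a b c].
Proof.
by move=> [t0]; rewrite sum3E => t1; do 3! eexists; split; last exact: barE.
Qed.

(** The displacement in the plane from the target of an arrow of type [i] to its source; the last
    one reflects that [rho 2] is minus the sum of the others. *)
Definition arrow_vec (i : 'I_3) : R * R := [:: (1, 0); (0, 1); (-1, -1)]`_i.

Lemma cov_arrow chi (i : 'I_3) w :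
  cov (lift_pt (chi + rho i) + w) = cov (lift_pt chi + (arrow_vec i + w)).
Proof.
have r2 := sum_rho3 sum_rho.
rewrite -{1 2}[chi]char_liftK; case: (char_lift chi) => p q /=.
have [p' [q' [-> ->]]] : exists p' q' : int,
    lattice_char rho p q + rho i = lattice_char rho (p + p') (q + q') /\
    arrow_vec i = (p'%:~R, q'%:~R).
  case: (I3_cases i) => ->; rewrite /arrow_vec inordK //=.
  - by exists 1, 0; rewrite /lattice_char addr0 mulrzDr mulr1z addrAC.
  - by exists 0, 1; rewrite /lattice_char addr0 mulrzDr mulr1z addrA.
  exists (-1), (-1); rewrite lattice_charD lattice_charN; split=> //.
  congr (_ + _); apply/eqP; rewrite -addr_eq0 addrC /lattice_char !mulr1z; exact/eqP.
by rewrite !cov_lift addrA pairD -!rmorphD.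
Qed.

(** The image of a point on a side is expressed by the arrow and the parameter alone, which makes
    the map compatible with the gluing. *)
Lemma cov_side s chi j (tau : R) : let a := tnth (std_word rho s chi) j in
  cov (std_tri s (lift_pt chi) (side j tau)) =
  cov (lift_pt a.1 + (1 - tau) *: arrow_vec a.2).
Proof.
have [e0 e1 e2] := side_bar tau.
case: (I3_cases j) => ->; rewrite ?e0 ?e1 ?e2 /std_tri (tnth_nth (0, i0)) !mxE;
  rewrite !inordK //; case: s => /=; rewrite ?cov_arrow; congr (cov (_ + _));
  rewrite /arrow_vec !inordK //= !pairZ ?pairD; congr (_, _); rewrite /=; ring.
Qed.

Lemma glue_fun_side F i (tau : R) (t : set_type (@triangle R)) : val t = side i tau ->
  let a := tnth (bd F) i in glue_fun F t = cov (lift_pt a.1 + (1 - tau) *: arrow_vec a.2).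
Proof.
move=> tE; rewrite tnth_face /glue_fun; move: (val t) tE => u ->.
move: (face_shift F) (face_sign F) (face_base F) => k s chi.
by rewrite rotv_side cov_side opprK.
Qed.

Lemma glue_map_side (x y : tri) : glue_side bd x y -> glue_map x = glue_map y.
Proof.
case: x y => F t [F' t'] [i [j [tau [_ ae xE yE]]]].
apply: (etrans (glue_fun_side F (t := t) xE));
  apply: (etrans _ (esym (glue_fun_side F' (t := t') yE))).
exact: (congr1 (fun a : mckay_arrow K gT => cov (lift_pt a.1 + (1 - tau) *: arrow_vec a.2)) ae).
Qed.

Lemma glue_mapE F t : glue_map (existT _ F t) =
  cov (std_tri (face_sign F) (lift_pt (face_base F)) (rotv (- face_shift F) (val t))).
Proof. by []. Qed.

Local Opaque glue_map face_shift face_sign face_base.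

Lemma glue_map_rel (x y : tri) : glue_rel bd x y -> glue_map x = glue_map y.
Proof.
move=> /asboolP; elim=> [{}x {}y|{}x|{}x {}y _ e|{}x {}y z _ e1 _ e2].
- exact: glue_map_side.
- exact: erefl.
- exact: esym e.
by rewrite e1.
Qed.

Lemma triangle0 : bar 1 0 0 \in @triangle R.
Proof. by apply/mem_set/bar_triangle; rewrite ?addr0. Qed.

Definition to_triangle (t : 'rV[R]_3) : set_type (@triangle R) :=
  insubd (exist (fun t => t \in @triangle R) _ triangle0) t.

Definition std_point s chi (t : 'rV[R]_3) : tri :=
  existT _ (std_face rho s chi) (to_triangle (rotv (face_shift (std_face rho s chi)) t)).

Lemma val_std_point s chi t : triangle t ->
  val (tagged (std_point s chi t)) = rotv (face_shift (std_face rho s chi)) t.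
Proof. by move=> tT; apply: insubdK; apply: mem_set; apply: rotv_triangle. Qed.

Lemma glue_map_std s chi t : triangle t ->
  glue_map (std_point s chi t) = cov (std_tri s (lift_pt chi) t).
Proof.
move=> tT; rewrite glue_mapE -/(std_point s chi t) [val _]val_std_point //.
by rewrite rotvK face_sign_std face_base_std.
Qed.

Lemma std_point_surj (x : tri) :
  exists s p q t, triangle t /\ x = std_point s (lattice_char rho p q) t.
Proof.
case: x => F t; exists (face_sign F), (char_lift (face_base F)).1, (char_lift (face_base F)).2.
exists (rotv (- face_shift F) (val t)); split; first exact/rotv_triangle/set_valP.
rewrite /std_point char_liftK [std_face _ _ _](face_cornerKV sum_rho) rotvNK.
by congr existT; rewrite /to_triangle valKd.
Qed.

Lemma glue_std s chi j s' chi' j' (tau : R) : 0 <= tau <= 1 ->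
  tnth (std_word rho s chi) j = tnth (std_word rho s' chi') j' ->
  glue_rel bd (std_point s chi (side j tau)) (std_point s' chi' (side j' tau)).
Proof.
move=> tau01 e; apply/asboolP/Relation_Operators.rst_step.
have sT i : triangle (side i tau).
  have [s0 s1 s2] := side_bar tau; have /andP[t0 t1] := tau01.
  by case: (I3_cases i) => ->; rewrite ?s0 ?s1 ?s2; apply: bar_triangle => //; lra.
exists (j - face_shift (std_face rho s chi)), (j' - face_shift (std_face rho s' chi')), tau.
have wE s0 chi0 i : tnth (bd (std_face rho s0 chi0)) (i - face_shift (std_face rho s0 chi0)) =
    tnth (std_word rho s0 chi0) i.
  by rewrite tnth_face subrK face_sign_std face_base_std.
split; first exact: tau01.
- by refine (etrans (wE s chi j) (etrans e (esym (wE s' chi' j')))).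
- by rewrite (val_std_point _ _ (sT j)) rotv_side.
by rewrite (val_std_point _ _ (sT j')) rotv_side.
Qed.

End GluedTriangles.

(* A point of the plane is assigned to one closed standard triangle through it,
   according to the integral and fractional parts of its coordinates.  A chain
   of at most three gluings leads from any point of any triangle to the
   representative of its image in the plane. *)
Section GluingNormalForm.
Variables (R : realType) (K : closedFieldType) (gT : finGroupType).
Variable rho : 'I_3 -> character K gT.
Local Notation char := (character K gT).
Local Notation i0 := (inord 0 : 'I_3).
Local Notation i1 := (inord 1 : 'I_3).
Local Notation i2 := (inord 2 : 'I_3).
Hypothesis sum_rho : \sum_i rho i = 0.
Variables al be ga : R.
Hypotheses (al0 : 0 < al) (ga0 : 0 < ga).
Local Notation cov := (tshear al be ga).
Hypothesis covE : forall z w, cov z = cov w <->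
  exists p q : int, lattice_char rho p q = 0 /\ z = w + (p%:~R, q%:~R).
Variables (tri : Type) (rel : tri -> tri -> Prop) (glue_map : tri -> torus R).
Variable std_point : bool -> char -> 'rV[R]_3 -> tri.
Hypothesis rel_refl : forall x, rel x x.
Hypothesis rel_sym : forall x y, rel x y -> rel y x.
Hypothesis rel_trans : forall x y z, rel x y -> rel y z -> rel x z.
Hypothesis glue_map_std : forall s p q t, triangle t ->
  glue_map (std_point s (lattice_char rho p q) t) = cov (std_tri s (p%:~R, q%:~R) t).
Hypothesis std_point_surj : forall x : tri,
  exists s p q t, triangle t /\ x = std_point s (lattice_char rho p q) t.
Hypothesis glue_std : forall s chi j s' chi' j' (tau : R), 0 <= tau <= 1 ->
  tnth (std_word rho s chi) j = tnth (std_word rho s' chi') j' ->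
  rel (std_point s chi (side j tau)) (std_point s' chi' (side j' tau)).

(** In the unit square at [(p, q)] the triangle below the diagonal is the positive one with corner
    [(p, q)], the other half is the negative one with corner [(p, q + 1)]. The diagonal is assigned
    to the former. *)
Definition plane_point (z : R * R) : tri :=
  let p := Num.floor z.1 in let q := Num.floor z.2 in
  let u := z.1 - p%:~R in let v := z.2 - q%:~R in
  if v <= u then std_point true (lattice_char rho p q) (bar (1 - u) (u - v) v)
  else std_point false (lattice_char rho p (q + 1)) (bar (v - u) u (1 - v)).

Lemma plane_pointE (p q : int) (u v : R) : 0 <= u < 1 -> 0 <= v < 1 ->
  plane_point (p%:~R + u, q%:~R + v) =
  if v <= u then std_point true (lattice_char rho p q) (bar (1 - u) (u - v) v)
  else std_point false (lattice_char rho p (q + 1)) (bar (v - u) u (1 - v)).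
Proof.
move=> /andP[u0 u1] /andP[v0 v1]; rewrite /plane_point /=.
have fl (n : int) (w : R) : 0 <= w -> w < 1 -> Num.floor (n%:~R + w) = n.
  by move=> w0 w1; apply: floor_def; rewrite rmorphD /=; apply/andP; split; lra.
have e (n : int) (w : R) : n%:~R + w - n%:~R = w by rewrite addrAC subrr add0r.
by rewrite !fl // !e.
Qed.

Lemma plane_point_shift (p q : int) z : lattice_char rho p q = 0 ->
  plane_point (z + (p%:~R, q%:~R)) = plane_point z.
Proof.
move=> pq; case: z => x y; rewrite pairD.
have fr (w : R) : exists (n : int) u, w = n%:~R + u /\ 0 <= u < 1.
  exists (Num.floor w), (w - (Num.floor w)%:~R); split; first by rewrite addrC subrK.
  by have := ge_floor w; have := floorD1_gt w; rewrite rmorphD /= => h1 h2; apply/andP; split; lra.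
have [m [u [-> u01]]] := fr x; have [n [v [-> v01]]] := fr y.
rewrite ![_ + _ + _%:~R]addrAC -!rmorphD /= !plane_pointE //.
have -> : n + q + 1 = (n + 1) + q by rewrite addrAC.
by rewrite !lattice_charD pq !addr0.
Qed.

Lemma cov_plane_point z : glue_map (plane_point z) = cov z.
Proof.
rewrite /plane_point; case: z => x y /=.
have := ge_floor x; have := floorD1_gt x; have := ge_floor y; have := floorD1_gt y.
rewrite !rmorphD /=; move: (Num.floor x) (Num.floor y) => p q hy1 hy2 hx1 hx2.
case: leP => uv; rewrite glue_map_std; try by apply: bar_triangle; lra.
  rewrite /std_tri !mxE !inordK //= pairD; congr (cov (_, _)); ring.
rewrite /std_tri !mxE !inordK //= pairD rmorphD /=; congr (cov (_, _)); ring.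
Qed.

(** This and the next two lemmas are the gluings along arrows of types 0, 2 and 1, that is, across
    horizontal, diagonal and vertical sides. *)
Lemma glue_top (p q : int) (u : R) : 0 <= u <= 1 ->
  rel (std_point false (lattice_char rho p q) (bar (1 - u) u 0))
              (std_point true (lattice_char rho p q) (bar (1 - u) u 0)).
Proof.
move=> u01; have [e _ _] := side_bar (1 - u); move: e; rewrite subKr => <-.
by apply: glue_std; [lra | rewrite !(tnth_nth (0, i0)) !inordK].
Qed.

Lemma glue_diagonal (p q : int) (u : R) : 0 <= u <= 1 ->
  rel (std_point false (lattice_char rho p (q + 1)) (bar 0 u (1 - u)))
              (std_point true (lattice_char rho p q) (bar (1 - u) 0 u)).
Proof.
move=> u01; have [_ <- <-] := side_bar u; apply: glue_std => //.
rewrite !(tnth_nth (0, i0)) !inordK //=; congr (_, _).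
by rewrite /lattice_char mulrzDr mulr1z addrA [LHS]addrAC.
Qed.

Lemma glue_right (p q : int) (v : R) : 0 <= v <= 1 ->
  rel (std_point true (lattice_char rho p q) (bar 0 (1 - v) v))
              (std_point false (lattice_char rho (p + 1) (q + 1)) (bar v 0 (1 - v))).
Proof.
move=> v01; have [_ e1 e2] := side_bar (1 - v).
move: e1 e2; rewrite subKr => <- <-; apply: glue_std; first lra.
rewrite !(tnth_nth (0, i0)) !inordK //=; congr (_, _).
have e : lattice_char rho 1 1 = rho i0 + rho i1 by rewrite /lattice_char !mulr1z.
rewrite lattice_charD e -[_ + rho i0 in RHS]addrA -[RHS]addrA; congr (_ + _).
by rewrite addrAC (sum_rho3 sum_rho) add0r.
Qed.

Lemma glue_plane_pos (p q : int) (u v : R) : 0 <= v <= u -> u < 1 ->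
  std_point true (lattice_char rho p q) (bar (1 - u) (u - v) v) =
  plane_point (p%:~R + u, q%:~R + v).
Proof.
move=> /andP[v0 vu] u1; rewrite plane_pointE; try by apply/andP; split; lra.
by rewrite vu.
Qed.

(** The horizontal side [v = 1] and the diagonal [u = v] of a negative triangle are assigned to
    positive triangles, and one gluing leads there. *)
Lemma glue_plane_neg (p q : int) (u v : R) : 0 <= u <= v -> v <= 1 -> u < 1 ->
  rel (std_point false (lattice_char rho p (q + 1)) (bar (v - u) u (1 - v)))
    (plane_point (p%:~R + u, q%:~R + v)).
Proof.
move=> /andP[u0 uv] v1 u1; have [vlt|vge] := ltP v 1; last first.
  have -> : v = 1 by lra.
  rewrite subrr; apply: rel_trans (glue_top p (q + 1) (u := u) _) _; first lra.
  have := @glue_plane_pos p (q + 1) u 0; rewrite !subr0 addr0 rmorphD => ->; last lra; last lra.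
  exact: rel_refl.
have [ult|uge] := ltP u v.
  rewrite plane_pointE; try by apply/andP; split; lra.
  by rewrite leNgt ult; exact: rel_refl.
have -> : v = u by lra.
rewrite subrr; apply: rel_trans (glue_diagonal p q (u := u) _) _; first lra.
have := @glue_plane_pos p q u u; rewrite subrr => ->; [exact: rel_refl|lra|lra].
Qed.

(** Only the right side [b + c = 1] falls outside the half-open square; crossing it leads to a
    negative triangle of the next column, hence to [glue_plane_neg]. *)
Lemma glue_plane_true (p q : int) (b c : R) : 0 <= b -> 0 <= c -> b + c <= 1 ->
  rel (std_point true (lattice_char rho p q) (bar (1 - (b + c)) b c))
      (plane_point (p%:~R + (b + c), q%:~R + c)).
Proof.
move=> b0 c0 bc; have [lt1|ge1] := ltP (b + c) 1.
  have := @glue_plane_pos p q (b + c) c; rewrite addrK => ->; [exact: rel_refl | lra | lra].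
have e : b + c = 1 by lra.
have bE : b = 1 - c by lra.
rewrite e subrr bE; apply: rel_trans (glue_right p q (v := c) _) _; first lra.
have := @glue_plane_neg (p + 1) q 0 c; rewrite subr0 addr0 rmorphD /= rmorph1; apply; lra.
Qed.

Lemma glue_plane s (p q : int) t : triangle t ->
  rel (std_point s (lattice_char rho p q) t)
      (plane_point (std_tri s (p%:~R, q%:~R) t)).
Proof.
move=> /triangle_bar[a [b [c [a0 b0 c0 abc ->]]]].
have aE : a = 1 - (b + c) by lra.
rewrite /std_tri !mxE !inordK //= aE {a aE abc} in a0 *; case: s; rewrite pairD.
  by apply: glue_plane_true; lra.
have [lt1|ge1] := ltP b 1.
  have := @glue_plane_neg p (q - 1) b (1 - c); rewrite subrK rmorphB /= rmorph1 subKr.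
  have -> : 1 - c - b = 1 - (b + c) by ring.
  have -> : q%:~R - 1 + (1 - c) = q%:~R - c by ring.
  by apply; lra.
have -> : b = 1 by lra.
have -> : c = 0 by lra.
rewrite oppr0 addr0 subrr;
  apply: rel_trans (_ : rel _ (std_point true (lattice_char rho p q) (bar 0 1 0))) _.
  by have := @glue_top p q 1; rewrite subrr; apply; lra.
by have := @glue_plane_true p q 1 0; rewrite !addr0 subrr; apply; lra.
Qed.

Lemma glue_map_inj x y : glue_map x = glue_map y -> rel x y.
Proof.
have [s [p [q [t [tT ->]]]]] := std_point_surj x.
have [s' [p' [q' [t' [tT' ->]]]]] := std_point_surj y.
rewrite !glue_map_std // => /covE[m [n [mn e]]].
apply: rel_trans (glue_plane s p q tT) _; rewrite e plane_point_shift //.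
exact/rel_sym/glue_plane.
Qed.

Lemma glue_map_surj x : exists y, glue_map y = x.
Proof.
by have [z <-] := tshear_surj be al0 ga0 x; exists (plane_point z); exact: cov_plane_point.
Qed.

End GluingNormalForm.

(** * Compactness and the homeomorphism with the torus *)

Lemma set_type_compact (T : topologicalType) (A : set T) :
  compact A -> compact [set: set_type A].
Proof.
move=> cA F PF _.
pose v : set_type A -> T := \val.
have FA : (v @ F) A by apply: (@filterS _ F _ setT) (filterT) => x _; exact: set_valP.
have [p [Ap clp]] := cA (v @ F) _ FA.
pose x : set_type A := exist _ p (mem_set Ap).
exists x; split=> // U V FU /= [_ [[W oW <-] /= Wx WV]].
have [|_ [[y Uy <-] Wy]] := clp (v @` U) W _ (open_nbhs_nbhs (conj oW Wx)).
  by apply: (@filterS _ F _ U) FU => y Uy; exists y.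
by exists y; split=> //; apply: WV.
Qed.

Lemma triangle_compact (R : realType) : compact (@triangle R).
Proof.
have cB := @rV_compact _ 3 (fun=> `[0 : R, 1]%classic) (fun=> @segment_compact R 0 1).
apply: (subclosed_compact _ cB); last first.
  move=> x [x0 x1] i /=; rewrite in_itv /= x0 /= -x1 (bigD1 i) //= lerDl.
  exact: sumr_ge0.
have -> : @triangle R = (\bigcap_(i in [set: 'I_3]) [set x | 0 <= x ord0 i]) `&`
    [set x | \sum_i x ord0 i = 1].
  by apply/seteqP; split=> x [x0 x1]; split=> // i; [move=> _|]; apply: x0.
apply: closedI.
  apply: closed_bigI => i _;
    apply: (@closed_comp _ _ (fun x : 'rV[R]_3 => x ord0 i) [set y | 0 <= y]).
    by move=> x _; exact: coord_continuous.
  exact: closed_ge.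
apply: (@closed_comp _ _ (fun x : 'rV[R]_3 => \sum_i x ord0 i) [set y | y = 1]).
  have -> : (fun x : 'rV[R]_3 => \sum_i x ord0 i) =
      fun x => x ord0 (inord 0) + x ord0 (inord 1) + x ord0 (inord 2).
    by apply/funext => x; rewrite sum3E.
  have c i : continuous (fun x : 'rV[R]_3 => x ord0 i) by exact: coord_continuous.
  by move=> x _; exact: (cvgD (cvgD (c _ x) (c _ x)) (c _ x)).
exact: closed_eq.
Qed.

Lemma compact_hausdorff_homeomorphic (X Y : topologicalType) (f : X -> Y) :
  compact [set: X] -> hausdorff_space Y -> continuous f -> injective f ->
  (forall y, exists x, f x = y) -> homeomorphic X Y.
Proof.
move=> cX hY cf finj fsurj; have [g gK] := choice fsurj.
exists f, g; split=> //; last by move=> x; apply: finj; rewrite gK.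
apply/continuous_closedP => C cC.
have -> : g @^-1` C = f @` C.
  apply/seteqP; split=> [y Cy|_ [x Cx <-]]; first by exists (g y).
  by rewrite /= (_ : g (f x) = x) //; apply: finj; rewrite gK.
apply: compact_closed => //; apply: continuous_compact.
  exact: continuous_subspaceT.
by apply: subclosed_compact cX _.
Qed.

Section GluedTorus.
Variables (R : realType) (K : closedFieldType) (gT : finGroupType).
Variable rho : 'I_3 -> character K gT.
Hypothesis sep : forall g, (forall i, rho i g = 1) -> g = 1%g.
Hypothesis sum_rho : \sum_i rho i = 0.
Local Notation tri := (triangles R (mckay_face rho)).
Local Notation bd := (mckay_boundary (rho := rho)).

Lemma std_tri_continuous al be ga s z k :
  continuous (fun t : set_type (@triangle R) => tshear al be ga (std_tri s z (rotv k (val t)))).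
Proof.
have cc i : continuous (fun t : set_type (@triangle R) => rotv k (val t) ord0 i).
  have -> : (fun t : set_type (@triangle R) => rotv k (val t) ord0 i) =
      (fun x : 'rV[R]_3 => x ord0 (i + k)) \o set_val.
    by apply/funext => t; rewrite /rotv mxE.
  by move=> t; apply: continuous_comp; [exact: initial_continuous | exact: coord_continuous].
move=> t; apply: (@continuous_comp _ _ _ (fun t : set_type (@triangle R) =>
  std_tri s z (rotv k (val t))) (tshear al be ga)).
  pose c i (t : set_type (@triangle R)) : R := rotv k (val t) ord0 (inord i).
  case: s.
    apply: (@pair_continuous_at _ R R (fun t => z.1 + (c 1%N t + c 2%N t)) (fun t =>
      z.2 + c 2%N t)).
      by apply: cvgD (cvg_cst _) (cvgD (cc _ t) (cc _ t)).
    by apply: cvgD (cvg_cst _) (cc _ t).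
  apply: (@pair_continuous_at _ R R (fun t => z.1 + c 1%N t) (fun t => z.2 - c 2%N t)).
    by apply: cvgD (cvg_cst _) (cc _ t).
  by apply: cvgB (cvg_cst _) (cc _ t).
exact: tshear_continuous.
Qed.

Theorem glued_homeomorphic_torus : homeomorphic (glued R bd) (torus R).
Proof.
have [al [be [ga [al0 ga0 covE]]]] := lattice_projection R rho.
pose f : tri -> torus R := glue_map sep sum_rho al be ga.
have f_cont : continuous f.
  apply: (@sigT_continuous (mckay_face rho) (fun=> set_type (@triangle R)) _
    (glue_fun sep sum_rho al be ga)) => F.
  exact: std_tri_continuous.
pose sp := std_point sum_rho (R := R) (rho := rho).
have f_std s p q t : triangle t ->
    f (sp s (lattice_char rho p q) t) = tshear al be ga (std_tri s (p%:~R, q%:~R) t).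
  move=> tT; apply: etrans (glue_map_std sep sum_rho al be ga s _ tT) _.
  exact: cov_lift.
have f_rel x y : glue_rel bd x y -> f x = f y := glue_map_rel sep sum_rho al0 ga0 covE (y := y).
have sp_surj := std_point_surj sep sum_rho (R := R) : forall x : tri,
  exists s p q t, triangle t /\ x = sp s (lattice_char rho p q) t.
have sp_glue := glue_std sum_rho al0 ga0 : forall s chi j s' chi' j' (tau : R), 0 <= tau <= 1 ->
  tnth (std_word rho s chi) j = tnth (std_word rho s' chi') j' ->
  glue_rel bd (sp s chi (side j tau)) (sp s' chi' (side j' tau)).
clearbody f sp.
have f_inj := glue_map_inj sum_rho covE (@glue_rel_refl _ _ _ bd)
  (fun x y xy => etrans (glue_rel_sym bd y x) xy)
  (fun x y z => @glue_rel_trans _ _ _ bd y x z) f_std sp_surj sp_glue.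
have f_surj x : exists y, f y = x by apply: (glue_map_surj al0 ga0 f_std).
pose h : glued R bd -> torus R := f \o repr.
apply: (@compact_hausdorff_homeomorphic _ _ h).
- have -> : [set: glued R bd] = \pi_(glued R bd) @` [set: tri].
    by apply/seteqP; split=> // x _; exists (repr x); rewrite ?reprK.
  apply: continuous_compact; first exact/continuous_subspaceT/pi_continuous.
  apply: sigT_compact => [|F]; first exact: finite_finset.
  exact/set_type_compact/triangle_compact.
- exact: torus_hausdorff.
- apply: repr_comp_continuous => // x y /eqP/eqmodP xy; apply/eqP.
  exact: f_rel.
- move=> x y; rewrite /h /= => /f_inj xy; rewrite -[x]reprK -[y]reprK.
  exact/eqmodP.
move=> x; have [y yx] := f_surj x; exists (\pi_(glued R bd) y); rewrite /h /= -yx.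
have : glue_rel bd y (repr (\pi_(glued R bd) y)) by apply/eqmodP; rewrite reprK.
by move/f_rel => <-.
Qed.

End GluedTorus.

(** * The brick wall tiling *)

Section ConnectedComponents.
Variable T : topologicalType.

Lemma open_disjoint_separated (A B : set T) : open A -> open B -> A `&` B = set0 ->
  separated A B.
Proof.
move=> oA oB AB; split; apply/seteqP; split=> // x [].
  move=> clx Bx; have [y [Ay By]] := clx B (open_nbhs_nbhs (conj oB Bx)).
  by have : (A `&` B) y by []; rewrite AB.
move=> Ax clx; have [y [By Ay]] := clx A (open_nbhs_nbhs (conj oA Ax)).
by have : (A `&` B) y by []; rewrite AB.
Qed.

Lemma connected_component_disjoint_open (I : Type) (U : I -> set T) (D : set T) :
  (forall i, open (U i)) -> (forall i, connected (U i)) ->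
  (forall i j x, U i x -> U j x -> i = j) -> D = \bigcup_i U i ->
  forall i x, U i x -> connected_component D x = U i.
Proof.
move=> oU cU disj -> i x Ux; apply/seteqP; split; last first.
  by apply: connected_component_max => // y Uy; exists i.
have sep : separated (U i) (\bigcup_(j in [set j | j <> i]) U j).
  apply: open_disjoint_separated => //; first exact: bigcup_open.
  by apply/seteqP; split=> // y [Uiy [j ji Ujy]]; apply: ji; apply: disj Ujy Uiy.
have Dx : (\bigcup_j U j) x by exists i.
have [|//|sub] := connected_subset sep _ (@component_connected _ (\bigcup_j U j) x).
  move=> y /connected_component_sub[j _ Uy].
  by have [<-|ne] := pselect (j = i); [left | right; exists j].
have [j ji Ujx] := sub x (connected_component_refl Dx).
by case: ji; apply: disj Ujx Ux.
Qed.

Lemma path_connected_connected (R : realType) (A : set T) : path_connected R A -> connected A.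
Proof.
move=> pA; have [->|/set0P[x Ax]] := eqVneq A set0; first exact: connected0.
have ex (y : T) : exists gam : R -> T, A y -> [/\ {within `[0, 1], continuous gam},
    forall t, 0 <= t <= 1 -> A (gam t), gam 0 = x & gam 1 = y].
  have [Ay|nAy] := pselect (A y); last by exists (fun=> x).
  by have [g gP] := pA x y Ax Ay; exists g.
have [gam gamP] := choice ex.
have -> : A = \bigcup_(y in A) (gam y @` `[0, 1]).
  apply/seteqP; split=> [y Ay|z [y Ay [t t01 <-]]].
    have [_ _ _ g1] := gamP y Ay; exists y => //; exists 1 => //=.
    by rewrite in_itv /= ler01 lexx.
  by have [_ gA _ _] := gamP y Ay; apply: gA; move: t01; rewrite /= in_itv.
apply: bigcup_connected.
  exists x => y Ay; have [_ _ g0 _] := gamP y Ay; exists 0 => //=.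
  by rewrite in_itv /= lexx ler01.
move=> y Ay; have [gc _ _ _] := gamP y Ay.
by apply: connected_continuous_connected => //; exact: segment_connected.
Qed.

End ConnectedComponents.

(** * Simply connected images of convex sets *)

Section ConvexImage.
Variables (R : realType) (T : topologicalType) (h : R * R -> T) (B : set (R * R)).
Hypothesis h_cont : continuous h.
Hypothesis h_open : forall U, open U -> open (h @` U).
Hypothesis B_open : open B.
Hypothesis h_inj : forall x y, B x -> B y -> h x = h y -> x = y.
Hypothesis B_convex : forall x y (t : R), B x -> B y -> 0 <= t <= 1 ->
  B ((1 - t) *: x + t *: y).

(** The inverse of [h] on the image of [B] is continuous because [h] is open; outside this image the
    values of [g] are arbitrary. *)
Lemma local_section : exists g : T -> R * R, forall y, (h @` B) y ->
  [/\ B (g y), h (g y) = y & {for y, continuous g}].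
Proof.
have ex (y : T) : exists z : R * R, (h @` B) y -> B z /\ h z = y.
  have [[z Bz zy]|no] := pselect ((h @` B) y); first by exists z.
  by exists 0.
have [g gP] := choice ex.
exists g => y By; have [Bg gy] := gP y By; split=> // V /= nV.
have : nbhs y (h @` (V^° `&` B)).
  apply: open_nbhs_nbhs; split; first exact/h_open/openI/B_open/open_interior.
  by exists (g y).
apply: filterS => _ [z [Vz Bz] <-].
have [Bgz hgz] := gP (h z) (ex_intro2 _ _ z Bz erefl).
by rewrite /preimage /= (h_inj Bgz Bz hgz); exact: interior_subset Vz.
Qed.

Lemma convex_image_path_connected : path_connected R (h @` B).
Proof.
move=> _ _ [x Bx <-] [y By <-]; exists (fun t => h ((1 - t) *: x + t *: y)); split.
- apply: continuous_subspaceT => t; apply: continuous_comp; last exact: h_cont.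
  apply: cvgD; apply: cvgZr_tmp; last exact: cvg_id.
  by apply: cvgB; [exact: cvg_cst | exact: cvg_id].
- by move=> t t01; exists ((1 - t) *: x + t *: y) => //; apply: B_convex.
- by rewrite subr0 scale1r scale0r addr0.
- by rewrite subrr scale1r scale0r add0r.
Qed.

(** The section lifts the loop to [B], where it contracts along straight segments. *)
Lemma convex_image_simply_connected : simply_connected R (h @` B).
Proof.
split=> [|gam gam_c gam_in gam01]; first exact: convex_image_path_connected.
have [g gP] := local_section.
have z01 : 0 <= (0 : R) <= 1 by rewrite lexx ler01.
have lift_c (t : R) : 0 <= t <= 1 -> (g \o gam) @ within `[0, 1] (nbhs t) --> g (gam t).
  move=> t01; have [_ _ gc] := gP _ (gam_in t t01).
  have /subspace_continuousP/(_ t) gamt := gam_c.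
  have it : `[0, 1]%classic t by rewrite /= in_itv.
  have {}gamt : gam @ within `[0, 1] (nbhs t) --> gam t := gamt it.
  exact: cvg_comp gamt gc.
exists (fun x => h ((1 - x.2) *: g (gam x.1) + x.2 *: g (gam 0))); split.
- apply/subspace_continuousP => -[t s] [/=]; rewrite !in_itv /= => t01 s01.
  pose u x : R * R := (1 - x.2) *: g (gam x.1) + x.2 *: g (gam 0).
  suff uc : u @ within (`[0 : R, 1] `*` `[0 : R, 1]) (nbhs (t, s)) --> u (t, s).
    have huc : (h \o u) @ within (`[0 : R, 1] `*` `[0 : R, 1]) (nbhs (t, s)) --> h (u (t, s)).
      by apply: (@cvg_comp _ _ _ u h _ (nbhs (u (t, s))) _ uc); exact: h_cont.
    exact: huc.
  have fst_c : fst @ within (`[0 : R, 1] `*` `[0 : R, 1]) (nbhs (t, s)) --> within `[0, 1] (nbhs t).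
    move=> V VP; have {}VP : nbhs t (fun x : R => `[0, 1]%classic x -> V x) := VP.
    have : nbhs (t, s) (fst @^-1` (fun x : R => `[0, 1]%classic x -> V x)).
      exact: (@cvg_fst R R (nbhs t) (nbhs s) _ _ VP).
    by apply: filterS => -[x y] /= xP [x01 _]; exact: xP.
  have snd_c : snd @ within (`[0 : R, 1] `*` `[0 : R, 1]) (nbhs (t, s)) --> s.
    by apply: cvg_trans (@cvg_snd R R (nbhs t) (nbhs s) _); apply: cvg_app; exact: cvg_within.
  apply: cvgD; last by apply: cvgZr_tmp.
  apply: cvgZ; first by apply: cvgB => //; exact: cvg_cst.
  exact: cvg_comp fst_c (lift_c t t01).
- move=> t s t01 s01; have [B0 _ _] := gP _ (gam_in 0 z01); have [Bt _ _] := gP _ (gam_in t t01).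
  by eexists; last reflexivity; apply: B_convex.
- move=> t t01; rewrite subr0 scale1r scale0r addr0 subrr scale0r scale1r add0r.
  by have [_ -> _] := gP _ (gam_in t t01); have [_ -> _] := gP _ (gam_in 0 z01).
move=> s s01; rewrite /= -gam01 -scalerDl subrK scale1r.
by have [_ -> _] := gP _ (gam_in 0 z01).
Qed.

End ConvexImage.

(* The brick wall is the hexagonal tiling drawn with straight edges.  In the
   coordinates of the plane that are used here, the vertex p rho_0 + q rho_1 of
   the quiver is the brick ]2p-q-2, 2p-q[ x ]q-1, q[, whose upper right corner
   is a white node and whose lower right corner is a black one. *)
Section BrickWall.
Variables (R : realType) (K : closedFieldType) (gT : finGroupType).
Variable rho : 'I_3 -> character K gT.
Local Notation char := (character K gT).
Local Notation i0 := (inord 0 : 'I_3).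
Local Notation i1 := (inord 1 : 'I_3).
Local Notation i2 := (inord 2 : 'I_3).
Hypothesis sep : forall g, (forall i, rho i g = 1) -> g = 1%g.
Hypothesis sum_rho : \sum_i rho i = 0.

(** The vectors of [rho 0] and [rho 1] are (2, 0) and (-1, 1): bricks of width 2 in rows of height
    1, shifted by half a brick from row to row. *)
Definition brick_pt (p q : int) : R * R := ((2 * p - q)%:~R, q%:~R).

Definition brick (a : R * R) : set (R * R) :=
  [set z | a.1 - 2 < z.1 < a.1 /\ a.2 - 1 < z.2 < a.2].

(** The edges dual to the three arrows with target [chi], relative to the corner of the brick [chi]:
    its right side, the left half of its top and the left half of its bottom, each run from the
    white to the black node. *)
Definition edge_offset (i : 'I_3) (t : R) : R * R :=
  [:: (0, - t); (t - 2, 0); (- t - 1, -1)]`_i.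

Lemma edge_offsetE t : [/\ edge_offset i0 t = (0, - t), edge_offset i1 t = (t - 2, 0) &
  edge_offset i2 t = (- t - 1, -1)].
Proof. by rewrite /edge_offset !inordK. Qed.

Lemma int_close (m n : int) (x y : R) : m%:~R + x = n%:~R + y -> -1 < x - y < 1 -> m = n.
Proof.
move=> e /andP[xy1 xy2].
have : (m - 1)%:~R < n%:~R :> R by rewrite rmorphB /= rmorph1; lra.
have : (n - 1)%:~R < m%:~R :> R by rewrite rmorphB /= rmorph1; lra.
rewrite !ltr_int; lia.
Qed.

Lemma brick_ptD p q p' q' : brick_pt (p + p') (q + q') = brick_pt p q + brick_pt p' q'.
Proof. by rewrite /brick_pt pairD -!rmorphD /=; congr (_%:~R, _%:~R); lia. Qed.

Lemma brick_open a : open (brick a).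
Proof.
have -> : brick a = (fst @^-1` `]a.1 - 2, a.1[%classic) `&` (snd @^-1` `]a.2 - 1, a.2[%classic).
  by apply/seteqP; split=> z; rewrite /brick /= !in_itv.
apply: openI; apply: open_comp => [z _|]; try exact: itv_open.
  exact: cvg_fst.
exact: cvg_snd.
Qed.

Lemma brick_convex a x y (t : R) : brick a x -> brick a y -> 0 <= t <= 1 ->
  brick a ((1 - t) *: x + t *: y).
Proof.
case: x y => [x1 x2] [y1 y2] [/= /andP[xa xb] /andP[xc xd]] [/= /andP[ya yb] /andP[yc yd]]
  /andP[t0 t1].
have conv (l u v : R) : l < u -> l < v -> l < (1 - t) * u + t * v.
  move=> lu lv; have [t_gt|t_le] := ltP 0 t; last by have -> : t = 0; lra.
  have h1 : 0 < t * (v - l) by rewrite mulr_gt0 // subr_gt0.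
  have h2 : 0 <= (1 - t) * (u - l) by rewrite mulr_ge0 // subr_ge0 // ltW.
  by rewrite !mulrBr !mulrBl !mul1r in h1 h2 *; lra.
have conv' (l u v : R) : u < l -> v < l -> (1 - t) * u + t * v < l.
  move=> ul vl; have := conv (- l) (- u) (- v); rewrite !mulrN -opprD !ltrN2; exact.
by rewrite !pairZ pairD; split=> /=; apply/andP; split; auto.
Qed.

Lemma brick_disjoint p q p' q' z : brick (brick_pt p q) z -> brick (brick_pt p' q') z ->
  p = p' /\ q = q'.
Proof.
case: z => x y [/= /andP[x1 x2] /andP[y1 y2]] [/= /andP[x1' x2'] /andP[y1' y2']].
have qq : q = q' by apply: (@int_close _ _ 0 (q%:~R - q'%:~R)); lra.
rewrite -{q'}qq in x1' x2' y1' y2' *; split=> //.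
rewrite !rmorphB !rmorphM /= in x1 x2 x1' x2'.
by apply: (@int_close _ _ 0 (p%:~R - p'%:~R)); lra.
Qed.

Lemma edge_not_brick p q p' q' i (t : R) : 0 <= t <= 1 ->
  ~ brick (brick_pt p q) (brick_pt p' q' + edge_offset i t).
Proof.
move=> t01; have [e0 e1 e2] := edge_offsetE t.
have qq : ~ (q%:~R - 1 < q'%:~R :> R) \/ ~ (q'%:~R < q%:~R :> R).
  have [lt|ge] := ltP q' q; [left | right]; last by rewrite ltr_int; lia.
  have : q'%:~R <= (q - 1)%:~R :> R by rewrite ler_int; lia.
  by rewrite rmorphB /=; lra.
case: (I3_cases i) => ->; rewrite ?e0 ?e1 ?e2 pairD => -[/= /andP[x1 x2] /andP[y1 y2]].
- have e : q' = q.
    have : (q - 1)%:~R < q'%:~R :> R by rewrite rmorphB /= rmorph1; lra.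
    have : q'%:~R < (q + 1)%:~R :> R by rewrite rmorphD /= rmorph1; lra.
    rewrite !ltr_int; lia.
  rewrite e !rmorphB !rmorphM /= in x1 x2.
  have : (p - 1)%:~R < p'%:~R :> R by rewrite rmorphB /= rmorph1; lra.
  have : p'%:~R < p%:~R :> R by lra.
  rewrite !ltr_int; lia.
- by case: qq => qq; apply: qq; lra.
have : (q - 1)%:~R < (q' - 1)%:~R :> R by rewrite !rmorphB /= rmorph1; lra.
have : (q' - 1)%:~R < q%:~R :> R by rewrite !rmorphB /= rmorph1; lra.
rewrite !ltr_int; lia.
Qed.

Lemma ceil_int (x : R) : exists n : int, n%:~R - 1 < x <= n%:~R.
Proof.
exists (- Num.floor (- x)); have := ge_floor (- x); have := floorD1_gt (- x).
by rewrite rmorphD rmorphN /= rmorph1 => ? ?; apply/andP; split; lra.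
Qed.

Lemma brick_or_edge z : (exists p q, brick (brick_pt p q) z) \/
  exists p q i (t : R), 0 <= t <= 1 /\ z = brick_pt p q + edge_offset i t.
Proof.
case: z => x y; have [q /andP[yq]] := ceil_int y; rewrite le_eqVlt => /predU1P[yE|yq'].
  right; have [m /andP[m1 m2]] := ceil_int x.
  (* On a horizontal line the unit segments are alternately edges of types 2 and 1, according to the
     parity of [m + q]. *)
  have [p mE] : exists p : int, m = 2 * p - q \/ m = 2 * p - q - 1.
    by exists ((m + q + 1) %/ 2)%Z; lia.
  case: mE => mE; move: m1 m2; rewrite mE !rmorphB !rmorphM /= => m1 m2.
    exists (p + 1), (q + 1), i2, (2 * p%:~R - q%:~R - x); split; first by apply/andP; split; lra.
    have [_ _ ->] := edge_offsetE (2 * p%:~R - q%:~R - x).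
    rewrite pairD yE !rmorphB !rmorphM !rmorphD /=; congr (_, _); lra.
  exists p, q, i1, (x - (2 * p%:~R - q%:~R - 2)); split; first by apply/andP; split; lra.
  have [_ -> _] := edge_offsetE (x - (2 * p%:~R - q%:~R - 2)).
  rewrite pairD yE !rmorphB !rmorphM /=; congr (_, _); lra.
have [p /andP[xp]] := ceil_int ((x + q%:~R) / 2); rewrite le_eqVlt => /predU1P[xE|xp'].
  right; exists p, q, i0, (q%:~R - y); split; first by apply/andP; split; lra.
  have [-> _ _] := edge_offsetE (q%:~R - y).
  rewrite pairD !rmorphB !rmorphM /=; congr (_, _); lra.
left; exists p, q; split; rewrite /= ?rmorphB ?rmorphM /=; apply/andP; split; lra.
Qed.

Lemma edge_offset_inj p q p' q' i i' (t t' : R) : 0 < t < 1 -> 0 < t' < 1 ->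
  brick_pt p q + edge_offset i t = brick_pt p' q' + edge_offset i' t' ->
  [/\ p = p', q = q', i = i' & t = t'].
Proof.
move=> t01 t01'; have [e0 e1 e2] := edge_offsetE t; have [e0' e1' e2'] := edge_offsetE t'.
have half (a b : int) (x : R) : 2 * a%:~R = 2 * b%:~R + x -> -2 < x < 2 -> a = b.
  by move=> e x2; apply: (@int_close _ _ 0 (x / 2)); lra.
have absurd12 (a b c d : int) (x y : R) : 0 < x < 1 -> 0 < y < 1 ->
    brick_pt a b + (x - 2, 0) <> brick_pt c d + (- y - 1, -1).
  move=> x01 y01; rewrite !pairD addr0 => -[ex ey].
  rewrite !rmorphB !rmorphM /= in ex.
  have : a%:~R < c%:~R :> R by lra.
  have : (c - 1)%:~R < a%:~R :> R by rewrite rmorphB /= rmorph1; lra.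
  rewrite !ltr_int; lia.
case: (I3_cases i) => ->; case: (I3_cases i') => ->; rewrite ?e0 ?e1 ?e2 ?e0' ?e1' ?e2';
  try by [move/absurd12; case | move/esym/absurd12; case]; rewrite !pairD => -[ex ey];
  have qq : q = q' by (apply: (int_close ey); lra).
all: rewrite -{q'}qq ?rmorphB ?rmorphM /= in ex ey *.
all: try by exfalso; lra.
all: have pp : p = p' by (apply: (half _ _ (2 * p%:~R - 2 * p'%:~R)); lra).
all: rewrite -{p'}pp in ex *; split=> //; lra.
Qed.

End BrickWall.

Lemma affine_derive (R : realType) (V : normedModType R) (c v : V) (t : R) :
  is_derive t 1 (fun t => c + t *: v) v.
Proof.
set f := fun t : R => c + t *: v.
have fv : h^-1 *: ((f \o shift t) (h *: 1) - f t) @[h --> 0^'] --> v.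
  apply: cvg_near_cst.
  near=> h; have h0 : h != 0 by near: h; exact: nbhs_dnbhs_neq.
  rewrite /f /= -[h *: 1]/(h * 1) mulr1 opprD addrACA subrr add0r -scalerBl addrK.
  by rewrite scalerA mulVf // scale1r.
split; first exact: cvgP fv.
exact: (cvg_lim (@norm_hausdorff _ _) fv).
Unshelve. all: by end_near. Qed.

(** * Cyclic order of directions *)

Section Counterclockwise.
Variable R : realType.

Lemma polar_upper (x y : R) : 0 < y ->
  exists r phi : R, [/\ 0 < r, 0 < phi < pi, x = r * cos phi & y = r * sin phi].
Proof.
move=> y0; pose r := Num.sqrt (x ^+ 2 + y ^+ 2).
have xy0 : 0 < x ^+ 2 + y ^+ 2 by rewrite ltr_wpDl ?sqr_ge0 // exprn_gt0.
have r0 : 0 < r by rewrite sqrtr_gt0.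
have r2 : r ^+ 2 = x ^+ 2 + y ^+ 2 by rewrite sqr_sqrtr // ltW.
have xr : (x / r) ^+ 2 < 1.
  rewrite expr_div_n r2 ltr_pdivrMr // mul1r ltrDl exprn_gt0 //.
have xr1 : -1 < x / r < 1 by rewrite -ltr_norml -(ltr_pXn2r (n := 2)) ?nnegrE // expr1n real_normK
  ?num_real.
have xr1' : -1 <= x / r <= 1 by case/andP: xr1 => *; rewrite !ltW.
case/andP: xr1 => xr1 xr2.
exists r, (acos (x / r)); split=> //.
- by rewrite acos_gt0 ?acos_ltpi ?xr1 ?xr2 ?ltW.
- by rewrite acosK ?in_itv //= mulrC divfK ?gt_eqF.
have -> : sin (acos (x / r)) = y / r.
  rewrite sin_acos //; have -> : 1 - (x / r) ^+ 2 = (y / r) ^+ 2.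
    by rewrite !expr_div_n r2; field; rewrite gt_eqF.
  by rewrite sqrtr_sqr ger0_norm // divr_ge0 // ltW.
by rewrite mulrC divfK ?gt_eqF.
Qed.

(** The angle of the vector that moves to the end is increased by a full turn. *)
Lemma ccw_rcons (v : R * R) s : ccw (v :: s) -> ccw (rcons s v).
Proof.
move=> [r [theta [rP thetaP]]].
exists (fun i => if (i < size s)%N then r i.+1 else r 0%N).
exists (fun i => if (i < size s)%N then theta i.+1 else theta 0%N + 2 * pi).
rewrite size_rcons; split=> [i|i j /andP[ij js]].
  rewrite ltnS leq_eqVlt => /predU1P[->|lti]; rewrite nth_rcons.
    by rewrite ltnn eqxx; have [//|r0 /= ->] := rP 0%N;
    rewrite mulr_natl cosD sinD cos2pi sin2pi !mulr1 !mulr0 subr0 addr0.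
  by rewrite lti; apply: (rP i.+1).
have [jlt|jge] := ltnP j (size s).
  by rewrite (ltn_trans ij jlt); apply: thetaP; rewrite /= !ltnS ij.
have ilt : (i < size s)%N by apply: leq_trans ij _; rewrite -ltnS.
rewrite ilt; have := thetaP 0%N i.+1; rewrite /= !ltnS => /(_ ilt); lra.
Qed.

Lemma ccw_rot k (s : seq (R * R)) : ccw s -> ccw (rot k s).
Proof.
elim: k => [|k IHk] sC; first by rewrite rot0.
have [lt|ge] := ltnP k (size s); last by rewrite rot_oversize // leqW.
rewrite rotS //; move: (IHk sC); case: (rot k s) => [//|v s']; rewrite rot1_cons; exact: ccw_rcons.
Qed.

Lemma ccw3 (r0 r1 r2 t0 t1 t2 : R) : 0 < r0 -> 0 < r1 -> 0 < r2 ->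
  t0 < t1 -> t1 < t2 -> t2 < t0 + 2 * pi ->
  ccw [:: (r0 * cos t0, r0 * sin t0); (r1 * cos t1, r1 * sin t1); (r2 * cos t2, r2 * sin t2)].
Proof.
move=> r0_gt r1_gt r2_gt t01 t12 t20; exists (nth 0 [:: r0; r1; r2]), (nth 0 [:: t0; t1; t2]).
split=> [[|[|[|]]]//|i j /andP[]]; case: j => [|[|[|//]]]; case: i => [|[|i]] //= _ _;
  apply/andP; split; lra.
Qed.

End Counterclockwise.

(** * The brick wall on the torus *)

Section BrickTiling.
Variables (R : realType) (K : closedFieldType) (gT : finGroupType).
Variable rho : 'I_3 -> character K gT.
Local Notation char := (character K gT).
Local Notation i0 := (inord 0 : 'I_3).
Local Notation i1 := (inord 1 : 'I_3).
Local Notation i2 := (inord 2 : 'I_3).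
Hypothesis sep : forall g, (forall i, rho i g = 1) -> g = 1%g.
Hypothesis sum_rho : \sum_i rho i = 0.
Variables al be ga : R.
Hypotheses (al0 : 0 < al) (ga0 : 0 < ga).
Local Notation cov := (tshear al be ga).
Hypothesis covE : forall z w, cov z = cov w <->
  exists p q : int, lattice_char rho p q = 0 /\ z = w + brick_pt R p q.
Local Notation brick := (@brick R).
Local Notation brick_pt := (@brick_pt R).
Local Notation edge_offset := (@edge_offset R).

Definition brick_corner (chi : char) : R * R :=
  let l := char_lift sep sum_rho chi in brick_pt l.1 l.2.

Lemma brick_cornerE chi : exists p q,
  lattice_char rho p q = chi /\ brick_corner chi = brick_pt p q.
Proof.
by exists (char_lift sep sum_rho chi).1, (char_lift sep sum_rho chi).2; rewrite char_liftK.
Qed.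

Lemma cov_corner chi p q w :
  cov (brick_corner (chi + lattice_char rho p q) + w) = cov (brick_corner chi + (brick_pt p q + w)).
Proof.
have [a [b [ab ->]]] := brick_cornerE (chi + lattice_char rho p q).
have [c [d [cd ->]]] := brick_cornerE chi.
apply/covE; exists (a - (c + p)), (b - (d + q)); split.
  by rewrite lattice_charD lattice_charN ab lattice_charD cd subrr.
by rewrite [brick_pt c d + _]addrA -brick_ptD [LHS]addrC addrAC [LHS]addrC -brick_ptD !subrKC.
Qed.

Lemma cov_corner_eq chi chi' w w' : cov (brick_corner chi + w) = cov (brick_corner chi' + w') ->
  exists p q p' q', [/\ lattice_char rho p q = chi, lattice_char rho p' q' = chi' &
    brick_pt p q + w = brick_pt p' q' + w'].
Proof.
move=> /covE[p [q [pq e]]].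
have [a [b [ab aE]]] := brick_cornerE chi; have [c [d [cd cE]]] := brick_cornerE chi'.
exists a, b, (c + p), (d + q); split=> //; first by rewrite lattice_charD cd pq addr0.
by rewrite -aE e cE brick_ptD addrAC.
Qed.

Lemma brick_pt_inj p q p' q' : brick_pt p q = brick_pt p' q' -> p = p' /\ q = q'.
Proof. by move=> [/intr_inj e1 /intr_inj e2]; split; lia. Qed.

Definition edge_dir (i : 'I_3) : R * R := [:: (0, -1); (1, 0); (-1, 0)]`_i.

Lemma edge_dirE : [/\ edge_dir i0 = (0, -1), edge_dir i1 = (1, 0) & edge_dir i2 = (-1, 0)].
Proof. by rewrite /edge_dir !inordK. Qed.

Lemma edge_offset_line i t : edge_offset i t = edge_offset i 0 + t *: edge_dir i.
Proof.
have [e0 e1 e2] := edge_offsetE t; have [z0 z1 z2] := edge_offsetE (0 : R).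
have [d0 d1 d2] := edge_dirE.
by case: (I3_cases i) => ->; rewrite ?e0 ?e1 ?e2 ?z0 ?z1 ?z2 ?d0 ?d1 ?d2 pairZ pairD;
  congr (_, _); ring.
Qed.

(** A white node bears the character of the brick whose upper right corner it is, a black node that
    of the brick whose lower right corner it is; [edge_white] and [edge_black] name the ends of the
    segments in [edge_offset]. *)
Definition edge_white (e : mckay_arrow K gT) : char :=
  [:: e.1; e.1 - rho i0; e.1 + rho i2]`_(e.2).
Definition edge_black (e : mckay_arrow K gT) : char :=
  [:: e.1; e.1 + rho i1; e.1 - rho i0]`_(e.2).

Definition brick_wall : torus_graph R := {|
  white := char; black := char; edge := mckay_arrow K gT;
  white_end := edge_white; black_end := edge_black;
  position := fun v => shear al be ga
    match v with inl chi => brick_corner chi | inr chi => brick_corner chi + (0, -1) end;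
  curve := fun e t => shear al be ga (brick_corner e.1 + edge_offset e.2 t) |}.

Lemma lattice_char_rho : [/\ lattice_char rho (-1) 0 = - rho i0, lattice_char rho 0 1 = rho i1 &
  lattice_char rho (-1) (-1) = rho i2].
Proof.
split; rewrite /lattice_char ?mulr0z ?mulr1z ?addr0 ?add0r //.
by apply/eqP; rewrite -opprD eq_sym -addr_eq0 addrC (sum_rho3 sum_rho).
Qed.

Lemma brick_edge0 (e : mckay_arrow K gT) :
  edge_pt (B := brick_wall) e 0 = node_pt (B := brick_wall) (inl (edge_white e)).
Proof.
have [z0 z1 z2] := edge_offsetE (0 : R); have [c1 c2 c3] := lattice_char_rho.
case: e => chi i; rewrite /edge_pt /node_pt /= -!/(cov _) /edge_white /=.
case: (I3_cases i) => ->; rewrite ?z0 ?z1 ?z2 inordK //=.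
- by congr cov; rewrite oppr0; exact: addr0.
- rewrite -c1 -[brick_corner (_ + _)]addr0 cov_corner; congr (cov (_ + _)).
  by rewrite /brick_pt addr0; congr (_, _); rewrite ?subr0 //=; ring.
rewrite -c3 -[brick_corner (_ + _)]addr0 cov_corner; congr (cov (_ + _)).
by rewrite /brick_pt addr0 oppr0 sub0r.
Qed.

Lemma brick_edge1 (e : mckay_arrow K gT) :
  edge_pt (B := brick_wall) e 1 = node_pt (B := brick_wall) (inr (edge_black e)).
Proof.
have [z0 z1 z2] := edge_offsetE (1 : R); have [c1 c2 c3] := lattice_char_rho.
case: e => chi i; rewrite /edge_pt /node_pt /= -!/(cov _) /edge_black /=.
case: (I3_cases i) => ->; rewrite ?z0 ?z1 ?z2 inordK //=.
- rewrite -c2 cov_corner; congr (cov (_ + _)).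
  by rewrite /brick_pt pairD; congr (_, _); ring.
rewrite -c1 cov_corner; congr (cov (_ + _)).
by rewrite /brick_pt pairD; congr (_, _); ring.
Qed.

Lemma edge_not_lattice p q i (t : R) (m n : int) : 0 < t < 1 ->
  brick_pt p q + edge_offset i t <> (m%:~R, n%:~R).
Proof.
move=> t01; have [e0 e1 e2] := edge_offsetE t.
case: (I3_cases i) => ->; rewrite ?e0 ?e1 ?e2 pairD => -[ex ey].
- have qn : q = n by apply: (@int_close R _ _ (- t) 0); lra.
  by rewrite qn in ey; lra.
- have e : 2 * p - q - 1 = m.
    by apply: (@int_close R _ _ (t - 1) 0); rewrite ?rmorphB /= ?rmorph1 ?rmorphB /= in ex *; lra.
  by rewrite -e !rmorphB /= rmorph1 in ex; lra.
have e : 2 * p - q - 1 = m.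
  by apply: (@int_close R _ _ (- t) 0); rewrite ?rmorphB /= ?rmorph1 ?rmorphB /= in ex *; lra.
by rewrite -e !rmorphB /= rmorph1 in ex; lra.
Qed.

Definition edge_velocity (e : mckay_arrow K gT) (t : R) : R * R :=
  shear al be ga (edge_dir e.2).

Lemma curve_line e t : curve (t := brick_wall) e t =
  shear al be ga (brick_corner e.1 + edge_offset e.2 0) + t *: edge_velocity e 0.
Proof.
rewrite /= [in LHS]edge_offset_line addrA [in LHS]shearD; congr (_ + _); exact: shearZ.
Qed.

Lemma curve_continuous e : continuous (curve (t := brick_wall) e).
Proof.
have -> : curve (t := brick_wall) e = fun t =>
    shear al be ga (brick_corner e.1 + edge_offset e.2 0) + t *: edge_velocity e 0.
  by apply/funext => t; rewrite curve_line.
by move=> t; apply: cvgD; [exact: cvg_cst | apply: cvgZr_tmp; exact: cvg_id].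
Qed.

Lemma curve_derive e (t : R) : is_derive t 1 (curve (t := brick_wall) e) (edge_velocity e t).
Proof.
have -> : curve (t := brick_wall) e = fun t =>
    shear al be ga (brick_corner e.1 + edge_offset e.2 0) + t *: edge_velocity e 0.
  by apply/funext => t'; rewrite curve_line.
exact: affine_derive.
Qed.

(** White nodes have an even coordinate sum and black ones an odd sum, so the two kinds never
    coincide. *)
Lemma brick_parity p q p' q' : (2 * p - q)%:~R = (2 * p' - q')%:~R + 0 :> R ->
  q%:~R = q'%:~R - 1 :> R -> False.
Proof.
rewrite addr0 => /intr_inj ex ey.
have : q = q' - 1 by apply: (@intr_inj R); rewrite rmorphB.
lia.
Qed.

Lemma brick_wall_embedded : embedded brick_wall.
Proof.
split.
- move=> [chi|chi] [chi'|chi']; rewrite /node_pt /= -!/(cov _).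
  + rewrite -[brick_corner chi]addr0 -[brick_corner chi']addr0.
    by move=> /cov_corner_eq[p [q [p' [q' [<- <-]]]]]; rewrite !addr0 => /brick_pt_inj[-> ->].
  + rewrite -[brick_corner chi]addr0 => /cov_corner_eq[p [q [p' [q' [_ _]]]]].
    by rewrite addr0 pairD => -[ex ey]; case: (brick_parity ex ey).
  + rewrite -[brick_corner chi']addr0 => /esym/cov_corner_eq[p [q [p' [q' [_ _]]]]].
    by rewrite addr0 pairD => -[ex ey]; case: (brick_parity ex ey).
  by move=> /cov_corner_eq[p [q [p' [q' [<- <-]]]]] /addIr/brick_pt_inj[-> ->].
- by move=> e; exact/continuous_subspaceT/curve_continuous.
- by move=> e; split; [exact: brick_edge0 | exact: brick_edge1].
- move=> [chi i] [chi' i'] t t' t01 t01'; rewrite /edge_pt /= -!/(cov _).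
  move=> /cov_corner_eq[p [q [p' [q' [<- <-]]]]] /(edge_offset_inj t01 t01')[-> -> -> ->].
  by [].
move=> [chi i] t [chi'|chi'] t01; rewrite /edge_pt /node_pt /= -!/(cov _).
  rewrite -[brick_corner chi']addr0 => /cov_corner_eq[p [q [p' [q' [_ _]]]]].
  rewrite addr0; exact: edge_not_lattice.
move=> /cov_corner_eq[p [q [p' [q' [_ _]]]]]; rewrite pairD addr0 -[-1]/((-1)%:~R) -rmorphD.
exact: edge_not_lattice.
Qed.

Definition region (chi : char) : set (torus R) := cov @` brick (brick_corner chi).

Lemma brick_shift a z w : brick a z -> brick (a + w) (z + w).
Proof.
move=> [/andP[x1 x2] /andP[y1 y2]]; split; rewrite /= !ltrD2r.
  by rewrite x2 andbT -addrAC ltrD2r.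
by rewrite y2 andbT -addrAC ltrD2r.
Qed.

Lemma region_cov p q z : brick (brick_pt p q) z -> region (lattice_char rho p q) (cov z).
Proof.
have [a [b [ab abE]]] := brick_cornerE (lattice_char rho p q).
move=> /(brick_shift (brick_pt (a - p) (b - q))); rewrite -brick_ptD !subrKC -abE => bz.
exists (z + brick_pt (a - p) (b - q)) => //.
by apply/covE; exists (a - p), (b - q); split=> //; rewrite lattice_charD lattice_charN ab subrr.
Qed.

Lemma region_lift chi z : region chi (cov z) ->
  exists p q, lattice_char rho p q = chi /\ brick (brick_pt p q) z.
Proof.
have [a [b [ab abE]]] := brick_cornerE chi; rewrite /region abE.
move=> [w bw /esym/covE[p [q [pq ->]]]]; exists (a + p), (b + q).
rewrite lattice_charD ab pq addr0; split=> //; rewrite brick_ptD; exact: brick_shift.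
Qed.

Lemma region_disjoint chi chi' x : region chi x -> region chi' x -> chi = chi'.
Proof.
have [z <-] := tshear_surj be al0 ga0 x => /region_lift[p [q [<- b]]] /region_lift[p' [q' [<- b']]].
by have [-> ->] := brick_disjoint b b'.
Qed.

Lemma region_open chi : open (region chi).
Proof. by apply: tshear_open => //; exact: brick_open. Qed.

Lemma region_simply_connected chi : simply_connected R (region chi).
Proof.
apply: convex_image_simply_connected.
- exact: tshear_continuous.
- exact: tshear_open.
- exact: brick_open.
- have [a [b [_ ->]]] := brick_cornerE chi.
  move=> x y bx by_ /covE[p [q [_ e]]].
  have : brick (brick_pt (a + p) (b + q)) x by rewrite e brick_ptD; exact: brick_shift.
  move=> /(brick_disjoint bx)[pE qE].
  have p0 : p = 0 by apply: (addrI a); rewrite addr0.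
  have q0 : q = 0 by apply: (addrI b); rewrite addr0.
  by rewrite e p0 q0 /brick_pt mulr0 subr0; exact: addr0.
by move=> x y t; exact: brick_convex.
Qed.

Lemma region_nonempty chi : region chi !=set0.
Proof.
exists (cov (brick_corner chi - (1, 2^-1))), (brick_corner chi - (1, 2^-1)) => //.
by case: (brick_corner chi) => x y; split=> /=; apply/andP; split; lra.
Qed.

Lemma drawingE : ~` drawing brick_wall = \bigcup_chi region chi.
Proof.
have edge_in (p q : int) i (t : R) : 0 <= t <= 1 ->
  drawing brick_wall (cov (brick_pt p q + edge_offset i t)).
  move=> t01; right; exists (lattice_char rho p q, i), t; split=> //.
  have [a [b [ab abE]]] := brick_cornerE (lattice_char rho p q).
  rewrite /edge_pt /= -/(cov _) abE; apply/covE; exists (p - a), (q - b).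
  by rewrite lattice_charD lattice_charN ab subrr; split=> //; rewrite addrAC -brick_ptD !subrKC.
have in_edge x : drawing brick_wall x ->
  exists e t, 0 <= t <= 1 /\ x = edge_pt (B := brick_wall) e t.
  case=> [[[chi|chi] _ <-]|//].
    exists (chi, i0), 0; rewrite lexx ler01 brick_edge0; split=> //.
    by rewrite /edge_white /= inordK.
  exists (chi, i0), 1; rewrite lexx ler01 brick_edge1; split=> //.
  by rewrite /edge_black /= inordK.
apply/seteqP; split=> x.
  have [z <-] := tshear_surj be al0 ga0 x; have [[p [q bz]] _|] := brick_or_edge z.
    by exists (lattice_char rho p q) => //; exact: region_cov.
  by move=> [p [q [i [t [t01 ->]]]]] /(_ (edge_in _ _ _ _ t01)).
move=> [chi _ rx] /in_edge[[chi' i] [t [t01 xE]]].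
move: rx; rewrite xE /edge_pt /= -/(cov _) => /region_lift[p [q [_]]].
have [a [b [_ ->]]] := brick_cornerE chi'; exact: edge_not_brick.
Qed.

Lemma region_component chi x : region chi x ->
  connected_component (~` drawing brick_wall) x = region chi.
Proof.
apply: (connected_component_disjoint_open (U := region)).
- exact: region_open.
- by move=> i; apply: (@path_connected_connected _ R); have [] := region_simply_connected i.
- by move=> i j y; exact: region_disjoint.
exact: drawingE.
Qed.

Lemma tiling_facesE : range region = tiling_faces brick_wall.
Proof.
apply/seteqP; split=> [A [chi _ <-]|A [x]].
  have [x rx] := region_nonempty chi; exists x; last exact: region_component.
  by rewrite drawingE; exists chi.
rewrite {1}drawingE => -[chi _ rx] <-; exists chi => //.
by rewrite (region_component rx).
Qed.

Lemma brick_wall_tiling : brane_tiling brick_wall.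
Proof.
split; first exact: brick_wall_embedded.
by move=> A; rewrite -tiling_facesE => -[chi _ <-]; exact: region_simply_connected.
Qed.

(** The left normal of a sheared edge, expressed in the coordinates in which bricks are rectangles.
    Shearing does not preserve right angles, but the side of the edge to which the vector points is
    unchanged, as [side_dirE] records. *)
Definition side_dir (i : 'I_3) : R * R := unshear al be ga (turn_left (shear al be ga (edge_dir
  i))).

Lemma side_dirE : [/\ 0 < (side_dir i0).1, 0 < (side_dir i1).2 & (side_dir i2).2 < 0].
Proof.
rewrite /side_dir; have [-> -> ->] := edge_dirE.
rewrite /unshear /turn_left /shear /= !mulr0 !mulr1 !mulrN1 !add0r !addr0 ?opprK; split.
- rewrite divr_gt0 //; have := sqr_ge0 (be / ga); rewrite expr2 => h.
  have -> : ga - be * (- be / ga) = ga * (1 + be / ga * (be / ga)) by field; rewrite gt_eqF.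
  by rewrite mulr_gt0 //; lra.
- by rewrite divr_gt0.
by rewrite mulNr oppr_lt0 divr_gt0.
Qed.

Lemma near_right_lt (x c y : R) : x < y \/ x <= y /\ c < 0 ->
  \forall eps \near 0^'+, x + eps * c < y.
Proof.
move=> h; have c1 : 0 < `|c| + 1 by rewrite ltr_pwDr.
have [lt|ge] := ltP x y.
  have d0 : 0 < (y - x) / (`|c| + 1) by rewrite divr_gt0 // subr_gt0.
  near=> eps; have e0 : 0 < eps by near: eps; exact: nbhs_right_gt.
  have : eps < (y - x) / (`|c| + 1) by near: eps; exact: nbhs_right_lt.
  rewrite ltr_pdivlMr // => h1.
  have : eps * c <= eps * `|c| by rewrite ler_pM2l // ler_norm.
  by rewrite mulrDr mulr1 in h1; lra.
near=> eps; have e0 : 0 < eps by near: eps; exact: nbhs_right_gt.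
case: h => [|[xy c0]]; first lra.
have : eps * c < 0 by rewrite pmulr_rlt0.
lra.
Unshelve. all: by end_near. Qed.

Lemma near_right_gt (x c y : R) : y < x \/ y <= x /\ 0 < c ->
  \forall eps \near 0^'+, y < x + eps * c.
Proof.
move=> h; have := @near_right_lt (- x) (- c) (- y); rewrite !ltrN2 lerN2 oppr_lt0 => /(_ h).
by apply: filterS => eps; rewrite mulrN -opprD ltrN2.
Qed.

Lemma near_brick (a z m : R * R) :
  (a.1 - 2 < z.1 \/ a.1 - 2 <= z.1 /\ 0 < m.1) -> (z.1 < a.1 \/ z.1 <= a.1 /\ m.1 < 0) ->
  (a.2 - 1 < z.2 \/ a.2 - 1 <= z.2 /\ 0 < m.2) -> (z.2 < a.2 \/ z.2 <= a.2 /\ m.2 < 0) ->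
  \forall eps \near 0^'+, brick a (z + eps *: m).
Proof.
move=> /near_right_gt h1 /near_right_lt h2 /near_right_gt h3 /near_right_lt h4.
near=> eps; split; apply/andP; split; near: eps; [exact: h1|exact: h2|exact: h3|exact: h4].
Unshelve. all: by end_near. Qed.

Lemma region_near chi p q z m n : n = shear al be ga m -> lattice_char rho p q = chi ->
  (\forall eps \near 0^'+, brick (brick_pt p q) (z + eps *: m)) ->
  \forall eps \near 0^'+, region chi (tproj (shear al be ga z + eps *: n)).
Proof.
move=> -> <-; apply: filterS => eps /region_cov; rewrite /tshear shearD.
by rewrite -[shear al be ga (eps *: m)]/(shear _ _ _ _) shearZ.
Qed.

(** On the right of the edge lies the brick [chi]; on its left lies, for the types 0, 1 and 2, the
    next brick in the row, one in the row above and one in the row below, in each case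
    [chi + rho i]. *)
Lemma brick_sides (a : mckay_arrow K gT) (t : R) : 0 < t < 1 ->
  let x := curve (t := brick_wall) a t in
  let n := turn_left (edge_velocity a t) in
  \forall eps \near 0^'+,
    region (mckay_src rho a) (tproj (x + eps *: n)) /\
    region (mckay_tgt a) (tproj (x - eps *: n)).
Proof.
case: a => chi i t01 x n.
have [p [q [pq cE]]] := brick_cornerE chi.
have nE : n = shear al be ga (side_dir i) by rewrite unshearK.
have nE' : - n = shear al be ga (- side_dir i).
  by rewrite nE /shear /=; congr (_, _); rewrite /=; ring.
have [p' [q' [srcE h]]] : exists p' q', lattice_char rho p' q' = mckay_src rho (chi, i) /\
    ((\forall eps \near 0^'+, brick (brick_pt p' q') (brick_pt p q + edge_offset i t + eps *:
      side_dir i)) /\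
     (\forall eps \near 0^'+, brick (brick_pt p q) (brick_pt p q + edge_offset i t + eps *: (-
       side_dir i)))).
  have [e0 e1 e2] := edge_offsetE t; have [s0 s1 s2] := side_dirE.
  have [c1 c2 c3] := lattice_char_rho.
  have srcE p' q' : lattice_char rho p' q' = rho i ->
    lattice_char rho (p + p') (q + q') = mckay_src rho (chi, i).
    by move=> e; rewrite lattice_charD e pq.
  move: srcE; case: (I3_cases i) => -> srcE; rewrite ?e0 ?e1 ?e2.
  - exists (p + 1), (q + 0); split; first by apply: srcE; rewrite /lattice_char mulr1z mulr0z addr0.
    move: (side_dir i0) s0 => m m0; rewrite addr0; split; apply: near_brick;
      rewrite /= ?(rmorphB, rmorphD, rmorphM, rmorph1) /=;
      first [by left; lra | by right; split; lra].
  - exists (p + 0), (q + 1); split; first exact: srcE.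
    move: (side_dir i1) s1 => m m0; rewrite addr0; split; apply: near_brick;
      rewrite /= ?(rmorphB, rmorphD, rmorphM, rmorph1) /=;
      first [by left; lra | by right; split; lra].
  exists (p - 1), (q - 1); split; first exact: srcE.
  move: (side_dir i2) s2 => m m0; split; apply: near_brick;
    rewrite /= ?(rmorphB, rmorphD, rmorphM, rmorph1) /=;
    first [by left; lra | by right; split; lra].
case: h => h1 h2; have xE : x = shear al be ga (brick_pt p q + edge_offset i t) by rewrite /x /= cE.
have := region_near nE srcE h1; have := region_near nE' pq h2.
rewrite -xE; apply: filterS2 => eps r1 r2; split; first exact: r2.
by move: r1; rewrite scalerN.
Qed.

End BrickTiling.

(** * The McKay quiver as dual of the brick wall *)

Section BrickDual.
Variables (R : realType) (K : closedFieldType) (gT : finGroupType).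
Variable rho : 'I_3 -> character K gT.
Local Notation char := (character K gT).
Local Notation i0 := (inord 0 : 'I_3).
Local Notation i1 := (inord 1 : 'I_3).
Local Notation i2 := (inord 2 : 'I_3).
Hypothesis sep : forall g, (forall i, rho i g = 1) -> g = 1%g.
Hypothesis sum_rho : \sum_i rho i = 0.
Local Notation Q := (mckay_quiver rho).

Lemma std_word_uniq s (chi : char) : uniq (std_word rho s chi).
Proof. by case: s; rewrite /= !inE !xpair_eqE !I3_eq // !andbF. Qed.

Lemma std_word_cycle s (chi : char) :
  path.cycle (fun a b => mckay_src rho a == mckay_tgt b) (std_word rho s chi).
Proof.
have r2 := sum_rho3 sum_rho; have r2' : rho i0 + rho i2 + rho i1 = 0 by rewrite addrAC.
have src (a : mckay_arrow K gT) : mckay_src rho a = a.1 + rho a.2 by [].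
by case: s; rewrite /= !src /= /mckay_tgt /= !eqxx -!addrA ?[rho i0 + (_ + _)]addrA ?r2 ?r2' addr0
  eqxx.
Qed.

Lemma std_word_white (chi : char) a : (a \in (std_word rho true chi : seq _)) = (edge_white rho a
  == chi).
Proof.
case: a => psi i; rewrite !inE !xpair_eqE /edge_white /=.
case: (I3_cases i) => ->; rewrite !I3_eq //= !andbT !andbF ?orbF ?inordK //=.
- by rewrite subr_eq.
have -> : chi + rho i0 + rho i1 = chi - rho i2.
  by rewrite -addrA; congr (_ + _); apply/eqP; rewrite -addr_eq0 (sum_rho3 sum_rho).
by rewrite -subr_eq opprK.
Qed.

Lemma std_word_black (chi : char) a : (a \in (std_word rho false chi : seq _)) = (edge_black rho a
  == chi).
Proof.
case: a => psi i; rewrite !inE !xpair_eqE /edge_black /=.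
case: (I3_cases i) => ->; rewrite !I3_eq //= !andbT !andbF ?orbF ?inordK //=.
- have -> : chi + rho i0 + rho i2 = chi - rho i1.
    by rewrite -addrA; congr (_ + _); apply/eqP; rewrite -addr_eq0 addrAC (sum_rho3 sum_rho).
  by rewrite -subr_eq opprK.
by rewrite subr_eq.
Qed.

Lemma shear_dir (al be ga : R) : [/\ shear al be ga (edge_dir R i0) = (- be, - ga),
  shear al be ga (edge_dir R i1) = (al, 0) & shear al be ga (edge_dir R i2) = (- al, 0)].
Proof.
have [-> -> ->] := edge_dirE R.
by rewrite /shear /= !mulr0 !mulr1 !mulrN1 !add0r !addr0.
Qed.

(** Of the three directions at a white node two are horizontal and opposite and one points
    downwards; with [phi] the angle of [(be, ga)] their angles are [phi - pi], 0 and [pi]. At the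
    black nodes the directions are the opposite ones. *)
Lemma white_ccw (al be ga : R) chi : 0 < al -> 0 < ga ->
  ccw [seq edge_velocity al be ga a 0 | a <- std_word rho true chi].
Proof.
move=> al0 ga0; have [r [phi [r0 /andP[phi0 phi1] bE gE]]] := polar_upper be ga0.
rewrite /= /edge_velocity /=; have [-> -> ->] := shear_dir al be ga.
have := ccw3 (t0 := phi - pi) (t1 := 0) (t2 := pi) r0 al0 al0;
  rewrite cosB sinB cospi sinpi cos0 sin0.
rewrite !mulr0 !mulrN1 !mulr1 addr0 subr0 !mulrN -bE -gE.
by move=> h; apply: h; have := pi_gt0 R; lra.
Qed.

Lemma black_ccw (al be ga : R) chi : 0 < al -> 0 < ga ->
  ccw (rev [seq - edge_velocity al be ga a 1 | a <- std_word rho false chi]).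
Proof.
move=> al0 ga0; have [r [phi [r0 /andP[phi0 phi1] bE gE]]] := polar_upper be ga0.
rewrite /= /edge_velocity /=; have [-> -> ->] := shear_dir al be ga.
have := ccw3 (t0 := pi) (t1 := 2 * pi) (t2 := phi + 2 * pi) al0 al0 r0.
have c2 : cos (2 * pi) = 1 :> R by rewrite mulr_natl cos2pi.
have s2 : sin (2 * pi) = 0 :> R by rewrite mulr_natl sin2pi.
rewrite cosD sinD c2 s2 cospi sinpi !mulr0 !mulrN1 !mulr1 addr0 subr0 -bE -gE.
rewrite /rev /= -[- (al, 0)]/(- al, - 0) -[- (- al, 0)]/(- - al, - 0) -[- (- be, - ga)]/(- - be, -
  - ga).
rewrite !opprK !oppr0 => h; apply: h; have := pi_gt0 R; lra.
Qed.

Definition face_node (F : mckay_face rho) : char + char :=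
  if positive (F : face Q) then inl (face_corner true F) else inr (face_corner false F).

Lemma face_nodeE s chi : face_node (std_face rho s chi) = if s then inl chi else inr chi.
Proof. by rewrite /face_node std_face_positive //; case: s; rewrite face_cornerK. Qed.

Lemma face_node_bij : bijective face_node.
Proof.
exists (fun v => match v with inl chi => std_face rho true chi | inr chi =>
  std_face rho false chi end).
  move=> F; have [s [chi [k [-> _ _]]]] := mckay_face_std sum_rho F.
  by rewrite face_nodeE; case: s.
by case=> chi; rewrite face_nodeE.
Qed.

Lemma boundary_std s chi : exists k,
  mckay_boundary (std_face rho s chi) = rot k (std_word rho s chi) :> seq _.
Proof.
have [s' [chi' [k [/std_face_inj[<- <-] _ e]]]] := mckay_face_std sum_rho (std_face rho s chi).
by exists k.
Qed.

Theorem mckay_dual_to_brane_tiling : dual_to_brane_tiling R Q.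
Proof.
have [al [be [ga [al0 ga0 covE]]]] := lattice_projection R rho.
(* Brick coordinates [(x, y)] correspond to lattice coordinates [((x + y) / 2, y)], which inverts
   [brick_pt]; composing with the shear gives the entries [al / 2] and [al / 2 + be]. *)
have al2 : 0 < al / 2 by rewrite divr_gt0.
pose be2 := al / 2 + be.
have covE2 z w : tshear (al / 2) be2 ga z = tshear (al / 2) be2 ga w <->
    exists p q : int, lattice_char rho p q = 0 /\ z = w + brick_pt R p q.
  have sE u : tshear (al / 2) be2 ga u = tshear al be ga ((u.1 + u.2) / 2, u.2).
    by rewrite /tshear /shear /be2 /=; congr (tproj (_, _)); lra.
  rewrite !sE covE; split=> -[p [q [pq e]]]; exists p, q; split=> //.
    have := congr1 fst e; have := congr1 snd e; rewrite /= => e2 e1.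
    case: z w e1 e2 {e} => z1 z2 [w1 w2] /= e1 e2.
    by rewrite /brick_pt pairD rmorphB rmorphM /=; congr (_, _); lra.
  rewrite e /brick_pt pairD /= rmorphB rmorphM /=; congr (_, _); lra.
exists (brick_wall sep sum_rho (al / 2) be2 ga); split; first exact: brick_wall_tiling.
exists (region sep sum_rho (al / 2) be2 ga), id, face_node, (@edge_velocity R K gT (al / 2) be2 ga).
split.
- split; last exact: tiling_facesE.
  move=> chi chi' e; have [x rx] := region_nonempty sep sum_rho (al / 2) be2 ga chi.
  by apply: (region_disjoint al2 ga0 covE2 rx); rewrite -e.
- exact: (Bijective (g := id)).
- split; first exact: face_node_bij.
  by move=> F; rewrite /face_node; case: ifP.
- move=> e t _; split; first exact: curve_derive.
  have [v0 v1 v2] := shear_dir (al / 2) be2 ga; rewrite /edge_velocity.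
  have ne0 (x y : R) : x != 0 \/ y != 0 -> (x, y) != 0 :> R * R.
    by case=> h; apply: contra h => /eqP[x0 y0]; apply/eqP.
  case: (I3_cases e.2) => ->; rewrite ?v0 ?v1 ?v2; apply: ne0.
  - by right; rewrite oppr_eq0 gt_eqF.
  - by left; rewrite gt_eqF.
  by left; rewrite oppr_eq0 gt_eqF.
split.
- move=> a t t01; exact: brick_sides.
- move=> F; have [s [chi [k [-> _ e]]]] := mckay_face_std sum_rho F.
  have [k' {}e] := boundary_std s chi.
  by rewrite /= e rot_uniq rot_cycle std_word_uniq std_word_cycle.
- move=> F w; have [s [chi [k [-> _ _]]]] := mckay_face_std sum_rho F.
  rewrite face_nodeE; case: s => // -[<-]; have [k' e] := boundary_std true chi.
  split=> [a|]; first by rewrite /= e mem_rot std_word_white.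
  rewrite /= e map_rot; apply: ccw_rot.
  exact: white_ccw.
move=> F w; have [s [chi [k [-> _ _]]]] := mckay_face_std sum_rho F.
rewrite face_nodeE; case: s => // -[<-]; have [k' e] := boundary_std false chi.
split=> [a|]; first by rewrite /= e mem_rot std_word_black.
rewrite /= e map_rot rev_rot; apply: ccw_rot.
exact: black_ccw.
Qed.

End BrickDual.

Local Close Scope classical_set_scope.

Theorem mainTheorem7 (R : realType) (gT : finGroupType)
    (rG : mx_representation R[i] [set: gT]%G 3)
    (abelG : abelian [set: gT]%G)
    (faithfulG : mx_faithful rG)
    (detG : forall g : gT, \det (rG g) = 1)
    (rho : 'I_3 -> character R[i] gT)
    (P : 'M[R[i]]_3) (unitP : P \in unitmx)
    (decomposition : forall g : gT,
       rG g *m P = P *m diag_mx (\row_i rho i g)) :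
  [/\ homeomorphic (glued R (mckay_boundary (rho := rho))) (torus R),
      dual_to_brane_tiling R (mckay_quiver rho) &
      exists iota : {rmorphism invariant_ring rG ->
                               potential_algebra R[i] (mckay_quiver rho)},
        (forall c : R[i],
           iota (invariant_const rG c) =
           \pi_(potential_algebra R[i] (mckay_quiver rho))
             (c *: (1 : path_algebra R[i] (mckay_quiver rho)))) /\
        nccr iota].
Proof.
have sep := faithful_separates unitP decomposition faithfulG.
have sum_rho := det1_sum_rho unitP decomposition detG.
split; last exact: (mckay_nccr faithfulG detG unitP decomposition).
- exact: glued_homeomorphic_torus.
exact: mckay_dual_to_brane_tiling.
Qed.
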